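(* Let $b>0$ and let $p\ge0$ be an integer. There is a constant $c_p$ such that the following holds. Let $q\in C^{(p)}[0,b]$ be complex-valued, let $f$ be a non-vanishing solution of $f''-qf=0$ on $[0,b]$ with $f(0)=1$, $h:=f'(0)$, let $K$, $\beta_j$ be as defined in the context, let $$K_N(x,t):=\sum_{j=0}^{N}\frac{\beta_j(x)}{x}P_j\!\left(\frac tx\right),\qquad M:=\max_{0\le x\le b,\ |t|\le x}\bigl|\partial_t^{p+1}K(x,t)\bigr| .$$ Then for all integers $N>p$, all $0<x\le b$ and all $|t|\le x$, $$\bigl|K(x,t)-K_N(x,t)\bigr|\le\frac{c_pMx^{p+1}}{N^{p+1/2}} .$$ (The constant $c_p$ does not depend on $q$ and $N$.)
   Context: $P_n$ denotes the Legendre polynomial of degree $n$. Transmutation kernel: $K$ is the (unique continuous) function on $\{(x,t):0\le x\le b,\ |t|\le x\}$ satisfying $$K(x,t)=\frac h2+\frac12\int_0^{\frac{x+t}{2}}q(s)\,ds+\int_0^{\frac{x+t}{2}}\int_0^{\frac{x-t}{2}}q(\alpha+\beta)K(\alpha+\beta,\alpha-\beta)\,d\beta\,d\alpha .$$ It is the kernel of the transmutation operator $Tu(x)=u(x)+\int_{-x}^{x}K(x,t)u(t)\,dt$, which satisfies $\left(-\frac{d^2}{dx^2}+q\right)T[u]=T[-u'']$ for $u\in C^2$ and $T[1]=f$. For $q\in C^{(p)}[0,b]$ the kernel $K$ is $p+1$ times continuously differentiable with respect to each variable, so $M$ is well defined. Formal powers: $X^{(0)}\equiv\widetilde X^{(0)}\equiv1$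 and, for $n\ge1$, $$X^{(n)}(x)=n\int_0^xX^{(n-1)}(s)\,(f^2(s))^{(-1)^n}ds,\qquad \widetilde X^{(n)}(x)=n\int_0^x\widetilde X^{(n-1)}(s)\,(f^2(s))^{(-1)^{n-1}}ds;$$ $\varphi_k=fX^{(k)}$ for odd $k$ and $\varphi_k=f\widetilde X^{(k)}$ for even $k$. Coefficients: let $p_{j,k}:=\int_{-1}^1P_j(y)y^k\,dy$. For $x\in(0,b]$ define recursively $$\beta_0(x)=\frac{f(x)-1}{2},\qquad \beta_1(x)=\frac32\left(\frac{\varphi_1(x)}{x}-1\right),$$ and for $k\ge2$ $$\beta_k(x)=\frac1{p_{k,k}}\Bigl(\frac{\varphi_k(x)}{x^k}-1-\sum_{j}p_{j,k}\beta_j(x)\Bigr),$$ where the sum runs over all $j$ with $0\le j\le k-2$ having the same parity as $k$. *)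

(* Defs.v *)
From Stdlib Require Import Reals Lra Lia Arith.
From Coquelicot Require Import Coquelicot.

Open Scope R_scope.

Definition CInt (g : R -> C) (a c : R) : C :=
  @RInt C_R_CompleteNormedModule g a c.

Definition Csum (a : nat -> C) (n : nat) : C := @sum_n C_AbelianMonoid a n.

(* Derivative relative to a subset D of the line: at an endpoint of an interval
   it is the one-sided derivative. *)
Definition is_derive_in (D : R -> Prop) (g : R -> C) (x : R) (l : C) : Prop :=
  @filterdiff R_AbsRing R_NormedModule C_R_NormedModule
    g (within D (locally x)) (fun y : R => @scal R_AbsRing C_R_NormedModule y l).

Definition segment (a c : R) : R -> Prop := fun x => a <= x <= c.

(* The tower G lists the successive derivatives of g; nothing is required of
   G k for k > n. *)
Definition is_Cn (n : nat) (D : R -> Prop) (g : R -> C) : Prop :=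
  exists G : nat -> R -> C,
    (forall x, D x -> G 0%nat x = g x) /\
    (forall k x, (k < n)%nat -> D x -> is_derive_in D (G k) x (G (S k) x)) /\
    (forall k, (k <= n)%nat -> @continuous_on R_UniformSpace C_UniformSpace D (G k)).

Definition triangle (b : R) : R * R -> Prop :=
  fun z => 0 <= fst z <= b /\ Rabs (snd z) <= fst z.

Definition continuous_triangle (b : R) (G : R -> R -> C) : Prop :=
  @continuous_on (prod_UniformSpace R_UniformSpace R_UniformSpace) C_UniformSpace
    (triangle b) (fun z => G (fst z) (snd z)).

Definition is_transmutation_kernel
    (b : R) (q : R -> C) (h : C) (K : R -> R -> C) : Prop :=
  continuous_triangle b K /\
  forall x t, triangle b (x, t) ->
    K x t =
      (h / 2 + / 2 * CInt q 0 ((x + t) / 2)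
       + CInt (fun u =>
           CInt (fun v => q (u + v)%R * K (u + v)%R (u - v)%R)
             0 ((x - t) / 2))
           0 ((x + t) / 2))%C.

(* D is the n-th derivative of K in its second variable. For x > 0 the
   derivatives are taken along the segment [-x, x], one-sided at its endpoints.
   For x = 0 this segment is a point, and the value at the vertex (0, 0) is the
   one given by continuity on the closed triangle. *)
Definition is_partial_t (b : R) (n : nat) (K D : R -> R -> C) : Prop :=
  exists G : nat -> R -> R -> C,
    (forall x t, triangle b (x, t) -> G 0%nat x t = K x t) /\
    (forall x t, triangle b (x, t) -> G n x t = D x t) /\
    (forall k, (k <= n)%nat -> continuous_triangle b (G k)) /\
    (forall k x t, (k < n)%nat -> 0 < x -> triangle b (x, t) ->
       is_derive_in (segment (- x) x) (G k x) t (G (S k) x t)).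

Definition is_max_norm (b : R) (D : R -> R -> C) (M : R) : Prop :=
  (exists x t, triangle b (x, t) /\ M = Cmod (D x t)) /\
  (forall x t, triangle b (x, t) -> Cmod (D x t) <= M).

(* Bonnet's recursion (m + 1) P_{m+1} = (2 m + 1) y P_m - m P_{m-1}. *)
Fixpoint legendre (n : nat) (y : R) : R :=
  match n with
  | O => 1
  | S m =>
      match m with
      | O => y
      | S k =>
          ((2 * INR m + 1) * y * legendre m y - INR m * legendre k y)
          / INR (S m)
      end
  end.

(* w ^ ((-1) ^ n) *)
Definition pow_sign (w : C) (n : nat) : C :=
  if Nat.even n then w else (/ w)%C.

Fixpoint Xpow (f : R -> C) (n : nat) (x : R) : C :=
  match n with
  | O => 1%C
  | S m =>
      (INR (S m) *
       CInt (fun s => Xpow f m s * pow_sign (f s ^ 2) (S m)) 0 x)%C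
  end.

Fixpoint Xtpow (f : R -> C) (n : nat) (x : R) : C :=
  match n with
  | O => 1%C
  | S m =>
      (INR (S m) *
       CInt (fun s => Xtpow f m s * pow_sign (f s ^ 2) m) 0 x)%C
  end.

Definition phi (f : R -> C) (k : nat) (x : R) : C :=
  (f x * (if Nat.even k then Xtpow f k x else Xpow f k x))%C.

Definition legendre_moment (j k : nat) : R :=
  RInt (fun y => legendre j y * y ^ k) (-1) 1.

(* The value of beta_k(x) in terms of a table B of the values beta_j(x), j < k. *)
Definition beta_step (f : R -> C) (x : R) (k : nat) (B : nat -> C) : C :=
  match k with
  | O => ((f x - 1) / 2)%C
  | S O => (3 / 2 * (phi f 1 x / x - 1))%C
  | S (S m) =>
      (/ legendre_moment k k *
       (phi f k x / x ^ k - 1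
        - Csum (fun j => if Bool.eqb (Nat.even j) (Nat.even k)
                         then legendre_moment j k * B j else 0) m))%C
  end.

Fixpoint beta_table (f : R -> C) (x : R) (n : nat) : nat -> C :=
  match n with
  | O => fun _ => 0%C
  | S k => fun j =>
      if Nat.eqb j k then beta_step f x k (beta_table f x k)
      else beta_table f x k j
  end.

Definition beta (f : R -> C) (k : nat) (x : R) : C := beta_table f x (S k) k.

Lemma beta_table_lt f x n j : (j < n)%nat -> beta_table f x n j = beta f j x.
Proof.
induction n as [|n IH]; intros Hj; [lia|].
destruct (Nat.eq_dec j n) as [->|Hne]; [reflexivity|].
simpl; rewrite (proj2 (Nat.eqb_neq j n) Hne); apply IH; lia.
Qed.

Lemma beta_0 f x : beta f 0 x = ((f x - 1) / 2)%C.
Proof. reflexivity. Qed.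

Lemma beta_1 f x : beta f 1 x = (3 / 2 * (phi f 1 x / x - 1))%C.
Proof. reflexivity. Qed.

Lemma beta_rec f x k : (2 <= k)%nat ->
  beta f k x =
    (/ legendre_moment k k *
     (phi f k x / x ^ k - 1
      - Csum (fun j => if Bool.eqb (Nat.even j) (Nat.even k)
                       then legendre_moment j k * beta f j x else 0)
             (k - 2)))%C.
Proof.
intros Hk; destruct k as [|[|m]]; [lia|lia|].
replace (S (S m) - 2)%nat with m by lia.
transitivity (beta_step f x (S (S m)) (beta_table f x (S (S m)))).
{ unfold beta; cbn [beta_table]; rewrite Nat.eqb_refl; reflexivity. }
unfold beta_step, Csum; apply f_equal, f_equal, sum_n_ext_loc; intros j Hj.
rewrite beta_table_lt by lia; reflexivity.
Qed.

Definition K_approx (f : R -> C) (N : nat) (x t : R) : C :=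
  Csum (fun j => (beta f j x / x * legendre j (t / x)%R)%C) N.

(* Main.v *)
Require Import Defs.
From Stdlib Require Import Reals Lra Lia Arith.
From Coquelicot Require Import Coquelicot.

(** For fixed x the functions beta_j(x) / x are the Legendre coefficients of
    y |-> K(x, x y) on [-1, 1], so K_N(x, .) is a partial sum of the Legendre
    series. The estimate is thus a uniform bound for the Legendre partial sums
    S_N g of a function g with a bounded derivative of order p + 1, applied to
    the real and imaginary parts of K ([legendre_projection_error]). Three
    things have to be shown.

    The rate. Let w be the derivative of g. Integration by parts yields an
    exact formula for g(y) - S_N g(y): up to two terms at the cut, it is minus
    the integral of w against the part of the indicator of [y, 1] that is
    orthogonal to the polynomials of degree < N ([legendre_error_formula]).
    The squared norm of that part has the derivative - P_{N-1} P_N in y and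
    vanishes at y = 1, so it is at most 2 / (2 N - 1), for all y
    ([step_residual_bound]). By Cauchy-Schwarz the error is at most a constant
    times N^(-1/2) times the L^2 distance from w to the polynomials of degree
    < N. Each further derivative gains a factor of order 1 / N in such a
    distance ([residual_derive]), since (2 n + 1) times a coefficient of w is a
    difference of two coefficients of its derivative. Together this gives
    N^(-p-1/2).

    The coefficients. It must be shown that phi_k is T[t^k]
    ([phi_transmuted]); the recursion for beta_k is then the expansion of y^k
    in Legendre polynomials ([beta_coef]). When q is only continuous, K is only
    of class C^1 and satisfies no differential equation of second order in x
    and t. But in the characteristic variables u = (x+t)/2, v = (x-t)/2 the
    kernel H satisfies H_uv = q(u+v) H, and the integrals of H against a smooth
    function over the lines u + v = x can be differentiated twice in x, because
    each derivative can be made to fall on a variable in which H, H_u or H_v is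
    still differentiable. The outcome is T[u]'' = q T[u] + T[u'']
    ([transmuted_monomial_ode]), and the Wronskian with f leads to the formal
    powers.

    The regularity of K. The right-hand side of the integral equation is one
    degree smoother than K, as far as q permits. After q is extended to a
    function of class C^p on the line and K to a continuous function on the
    plane, p + 1 substitutions into the right-hand side produce a function of
    class C^(p+1) on the plane that still coincides with K on the triangle
    ([kernel_smooth]). The derivatives at the boundary of the triangle are then
    restrictions of ordinary ones. *)

Open Scope R_scope.

(** * Legendre polynomials: derivatives and the uniform bound *)

Lemma nat_pair_ind (Q : nat -> Prop) :
  Q 0%nat -> Q 1%nat -> (forall n, Q n -> Q (S n) -> Q (S (S n))) ->
  forall n, Q n.
Proof.
intros H0 H1 HS n; cut (Q n /\ Q (S n)); [tauto|].
induction n as [|n [IH1 IH2]]; split; auto.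
Qed.

Lemma INR_S_neq_0 n : INR (S n) <> 0.
Proof. apply not_0_INR; discriminate. Qed.

Lemma legendre_SS n y :
  legendre (S (S n)) y =
    ((2 * INR (S n) + 1) * y * legendre (S n) y - INR (S n) * legendre n y)
    / INR (S (S n)).
Proof. reflexivity. Qed.

Lemma legendre_bonnet n y :
  (INR n + 2) * legendre (S (S n)) y =
    (2 * INR n + 3) * y * legendre (S n) y - (INR n + 1) * legendre n y.
Proof.
rewrite legendre_SS, !S_INR. pose proof (pos_INR n). field. lra.
Qed.

Lemma continuous_legendre n y : continuous (legendre n) y.
Proof.
revert y; induction n as [| |n IH0 IH1] using nat_pair_ind; intros y.
- apply continuous_const.
- apply continuous_id.
- apply (continuous_ext (fun y => ((2 * INR (S n) + 1) * y * legendre (S n) y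
      - INR (S n) * legendre n y) * / INR (S (S n)))); [reflexivity|].
  apply (continuous_mult (K:=R_AbsRing)); [|apply continuous_const].
  apply (continuous_minus (V:=R_NormedModule)).
  + apply (continuous_mult (K:=R_AbsRing)); [|apply IH1].
    apply (continuous_mult (K:=R_AbsRing));
      [apply continuous_const|apply continuous_id].
  + apply (continuous_mult (K:=R_AbsRing)); [apply continuous_const|apply IH0].
Qed.

(** The derivative of [legendre], by differentiating Bonnet's recursion. *)
Fixpoint dlegendre (n : nat) (y : R) : R :=
  match n with
  | O => 0
  | S m =>
      match m with
      | O => 1
      | S k =>
          ((2 * INR m + 1) * (legendre m y + y * dlegendre m y)
           - INR m * dlegendre k y) / INR (S m)
      end
  end.

Lemma dlegendre_bonnet n y :
  (INR n + 2) * dlegendre (S (S n)) y =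
    (2 * INR n + 3) * (legendre (S n) y + y * dlegendre (S n) y)
    - (INR n + 1) * dlegendre n y.
Proof.
change (dlegendre (S (S n)) y) with
  (((2 * INR (S n) + 1) * (legendre (S n) y + y * dlegendre (S n) y)
           - INR (S n) * dlegendre n y) / INR (S (S n))).
rewrite !S_INR. pose proof (pos_INR n). field. lra.
Qed.

Lemma is_derive_legendre n y : is_derive (legendre n) y (dlegendre n y).
Proof.
revert y; induction n as [| |n IH0 IH1] using nat_pair_ind; intros y.
- apply is_derive_ext with (f := fun _ => 1); [reflexivity|].
  apply (is_derive_const (V:=R_NormedModule)).
- apply is_derive_ext with (f := fun y => y); [reflexivity|].
  apply (is_derive_id (K:=R_AbsRing)).
- apply (is_derive_ext (fun y => ((2 * INR (S n) + 1) * y * legendre (S n) y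
      - INR (S n) * legendre n y) / INR (S (S n)))); [reflexivity|].
  change (dlegendre (S (S n)) y) with
  (((2 * INR (S n) + 1) * (legendre (S n) y + y * dlegendre (S n) y)
           - INR (S n) * dlegendre n y) / INR (S (S n))).
  pose proof (INR_S_neq_0 (S n)).
  specialize (IH0 y); specialize (IH1 y).
  generalize dependent (INR (S (S n))); generalize (INR (S n)); intros m e H.
  generalize dependent (legendre (S n)); generalize (dlegendre (S n) y).
  generalize dependent (legendre n); generalize (dlegendre n y).
  intros l0 f0 H0 l1 f1 H1. auto_derive.
  { split; [eexists; apply H1|split; [eexists; apply H0|trivial]]. }
  replace (Derive (fun x => f1 x) y) with l1
    by (symmetry; apply is_derive_unique; exact H1).
  replace (Derive (fun x => f0 x) y) with l0
    by (symmetry; apply is_derive_unique; exact H0).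
  simpl; field; exact H.
Qed.

(** Neither relation is proved alone: each step of the induction for one of
    them uses the other, through (1 - y^2) P'_{n+1} = (n+1) (P_n - y P_{n+1}). *)
Lemma dlegendre_relations n y :
  dlegendre (S n) y = (INR n + 1) * legendre n y + y * dlegendre n y /\
  y * dlegendre (S n) y - dlegendre n y = (INR n + 1) * legendre (S n) y.
Proof.
induction n as [|n [IHA IHB]].
- simpl; split; ring.
- pose proof (dlegendre_bonnet n y) as D; pose proof (legendre_bonnet n y) as L.
  pose proof (pos_INR n). rewrite S_INR.
  set (d2 := dlegendre (S (S n)) y) in *; set (d1 := dlegendre (S n) y) in *.
  set (d0 := dlegendre n y) in *.
  set (p2 := legendre (S (S n)) y) in *; set (p1 := legendre (S n) y) in *.
  set (p0 := legendre n y) in *.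
  assert (A : d2 = (INR n + 1 + 1) * p1 + y * d1).
  { apply (Rmult_eq_reg_l (INR n + 2)); [|lra].
    rewrite D. replace d0 with (y * d1 - (INR n + 1) * p1) by lra. ring. }
  split; [exact A|].
  apply (Rmult_eq_reg_l 1); [|lra].
  replace ((INR n + 1 + 1) * p2) with ((INR n + 2) * p2) by ring. rewrite L.
  assert (E : (1 - y * y) * d1 = (INR n + 1) * (p0 - y * p1)).
  { replace ((1 - y * y) * d1) with (d1 - y * (y * d1)) by ring.
    replace (y * d1) with (d0 + (INR n + 1) * p1) by lra.
    rewrite IHA. ring. }
  rewrite A.
  replace (1 * (y * ((INR n + 1 + 1) * p1 + y * d1) - d1))
    with ((INR n + 2) * y * p1 - (1 - y * y) * d1) by ring.
  rewrite E. ring.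
Qed.

Lemma dlegendre_diff n y :
  dlegendre (S (S n)) y - dlegendre n y = (2 * INR n + 3) * legendre (S n) y.
Proof.
destruct (dlegendre_relations n y) as [_ B].
destruct (dlegendre_relations (S n) y) as [A _].
rewrite A, S_INR. lra.
Qed.

Lemma legendre_1 n : legendre n 1 = 1.
Proof.
induction n as [| |n IH0 IH1] using nat_pair_ind; try reflexivity.
rewrite legendre_SS, IH0, IH1, !S_INR. pose proof (pos_INR n). field. lra.
Qed.

Lemma legendre_opp n y : legendre n (- y) = (-1) ^ n * legendre n y.
Proof.
induction n as [| |n IH0 IH1] using nat_pair_ind; [simpl; ring|simpl; ring|].
rewrite !legendre_SS, IH0, IH1. simpl pow. field. apply INR_S_neq_0.
Qed.

Lemma legendre_m1 n : legendre n (-1) = (-1) ^ n.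
Proof.
replace (-1) with (- (1)) at 1 by ring.
rewrite legendre_opp, legendre_1; ring.
Qed.

(** Because (1 - y^2) P'_n = n (P_{n-1} - y P_n) and (1 - y^2) P'_{n-1} = n (y
    P_{n-1} - P_n), the quantities P_n^2 + (1 - y^2) (P'_n / n)^2 and
    P_{n-1}^2 + (1 - y^2) (P'_{n-1} / n)^2 are both equal to (P_n^2 +
    P_{n-1}^2 - 2 y P_n P_{n-1}) / (1 - y^2). Replacing the last n by n - 1
    only increases the second one, so this energy decreases with n, starting
    from 1. *)
Lemma legendre_sonin n y : -1 <= y <= 1 ->
  legendre (S n) y ^ 2
  + (1 - y ^ 2) * (dlegendre (S n) y / INR (S n)) ^ 2 <= 1.
Proof.
intros Hy; induction n as [|n IH].
- simpl. apply Req_le; field.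
- apply Rle_trans with (2 := IH).
  destruct (dlegendre_relations (S n) y) as [A B].
  pose proof (pos_INR n) as Hn.
  rewrite <- S_INR in *. rewrite !(S_INR (S n)), (S_INR n) in *.
  set (d2 := dlegendre (S (S n)) y) in *; set (d1 := dlegendre (S n) y) in *.
  set (p2 := legendre (S (S n)) y) in *; set (p1 := legendre (S n) y) in *.
  replace (p2 ^ 2 + (1 - y ^ 2) * (d2 / (INR n + 1 + 1)) ^ 2)
    with (p1 ^ 2 + (1 - y ^ 2) * (d1 / (INR n + 1 + 1)) ^ 2).
  2:{ replace d1 with (y * d2 - (INR n + 1 + 1) * p2) by lra.
      replace p1 with ((d2 - y * d1) / (INR n + 1 + 1)) by (rewrite A; field; lra).
      replace d1 with (y * d2 - (INR n + 1 + 1) * p2) by lra.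
      field; lra. }
  apply Rplus_le_compat_l, Rmult_le_compat_l; [nra|].
  unfold Rdiv; rewrite !Rpow_mult_distr.
  apply Rmult_le_compat_l; [apply pow2_ge_0|].
  apply pow_incr; split.
  + left; apply Rinv_0_lt_compat; lra.
  + apply Rinv_le_contravar; lra.
Qed.

Lemma legendre_bounded n y : -1 <= y <= 1 -> Rabs (legendre n y) <= 1.
Proof.
intros Hy; destruct n as [|n].
- simpl; rewrite Rabs_R1; lra.
- pose proof (legendre_sonin n y Hy).
  assert (legendre (S n) y ^ 2 <= 1).
  { assert (0 <= (1 - y ^ 2) * (dlegendre (S n) y / INR (S n)) ^ 2).
    { apply Rmult_le_pos; [nra|apply pow2_ge_0]. }
    lra. }
  apply Rabs_le; nra.
Qed.

(** * Calculus on the line *)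

(** The derivative is required in the open interval only, as one-sided
    derivatives at the endpoints give nothing two-sided there. *)
Lemma RInt_derive_interior (g w : R -> R) (a c : R) : a <= c ->
  (forall x, continuous g x) -> (forall x, continuous w x) ->
  (forall x, a < x < c -> is_derive g x (w x)) ->
  RInt w a c = g c - g a.
Proof.
intros Hac Hg Hw Hd.
assert (HI : forall x, is_derive (fun x => RInt w a x) x (w x)).
{ intros x; apply (is_derive_RInt (V:=R_NormedModule) w _ a x).
  - apply filter_forall; intros z. apply (RInt_correct (V:=R_CompleteNormedModule)).
    apply (ex_RInt_continuous (V:=R_CompleteNormedModule)); intros; apply Hw.
  - apply Hw. }
destruct (MVT_gen (fun x => RInt w a x - g x) a c (fun x => 0)) as [z [_ Hz]].
- rewrite Rmin_left, Rmax_right by lra; intros x Hx.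
  replace 0 with (minus (w x) (w x)) by (rewrite minus_eq_zero; reflexivity).
  apply (is_derive_minus (V:=R_NormedModule)); auto.
- intros x _. apply continuity_pt_filterlim.
  apply (continuous_minus (V:=R_NormedModule) (fun x => RInt w a x) g); [|apply Hg].
  apply (ex_derive_continuous (K:=R_AbsRing)); eexists; apply HI.
- rewrite RInt_point in Hz. change (@zero R_CompleteNormedModule) with 0 in Hz. lra.
Qed.

Lemma ex_RInt_cont (f : R -> R) a c : (forall x, continuous f x) -> ex_RInt f a c.
Proof.
intros H; apply (ex_RInt_continuous (V:=R_CompleteNormedModule)); auto.
Qed.

Lemma continuous_Rmult (f g : R -> R) x :
  continuous f x -> continuous g x -> continuous (fun s => f s * g s) x.
Proof. apply (continuous_mult (K:=R_AbsRing)). Qed.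
Lemma continuous_Rplus (f g : R -> R) x :
  continuous f x -> continuous g x -> continuous (fun s => f s + g s) x.
Proof. apply (continuous_plus (V:=R_NormedModule)). Qed.
Lemma continuous_Rminus (f g : R -> R) x :
  continuous f x -> continuous g x -> continuous (fun s => f s - g s) x.
Proof. apply (continuous_minus (V:=R_NormedModule)). Qed.

Lemma continuous_Rext (f g : R -> R) x :
  (forall s, f s = g s) -> continuous f x -> continuous g x.
Proof. apply (continuous_ext (U:=R_UniformSpace)). Qed.
Lemma continuous_Rpow (f : R -> R) n x :
  continuous f x -> continuous (fun s => f s ^ n) x.
Proof.
intros H; induction n as [|n IH]; [apply continuous_const|].
now apply (continuous_Rmult f (fun s => f s ^ n)).
Qed.
Ltac rcont := repeat lazymatch goal with
  | |- continuous (fun _ => ?c) _ => apply continuous_const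
  | |- continuous (fun s => s) _ => apply continuous_id
  | |- continuous (fun s => legendre ?n s) _ => apply (continuous_legendre n)
  | |- continuous (legendre ?n) _ => apply (continuous_legendre n)
  | |- continuous (fun s => @?f s * @?g s) _ => apply (continuous_Rmult f g)
  | |- continuous (fun s => @?f s ^ _) _ => apply (continuous_Rpow f)
  | |- continuous (fun s => @?f s + @?g s) _ => apply (continuous_Rplus f g)
  | |- continuous (fun s => @?f s - @?g s) _ => apply (continuous_Rminus f g)
  | H : forall x, continuous ?w x |- continuous ?w _ => apply H
  | H : forall x, continuous ?w x |- continuous (fun s => ?w s) _ => apply H
  end.

Lemma RInt_Rext (f g : R -> R) a c : (forall x, f x = g x) ->
  RInt f a c = RInt g a c.
Proof. intros H; apply RInt_ext; auto. Qed.
Lemma is_RInt_Rext (f g : R -> R) a c (l : R) :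
  (forall x, Rmin a c < x < Rmax a c -> f x = g x) ->
  is_RInt f a c l -> is_RInt g a c l.
Proof. apply (is_RInt_ext (V:=R_NormedModule)). Qed.
(** Congruence with the codomain fixed to the real line, so that both side
    conditions are equations between real numbers. *)
Lemma is_RInt_Rcongr (f g : R -> R) a c (l m : R) :
  (forall x, Rmin a c < x < Rmax a c -> f x = g x) -> l = m ->
  is_RInt f a c l -> is_RInt g a c m.
Proof. intros H <-; now apply is_RInt_Rext. Qed.
Lemma is_derive_Rcongr (f g : R -> R) (x l m : R) :
  (forall s, f s = g s) -> l = m -> is_derive f x l -> is_derive g x m.
Proof. intros H <-; now apply is_derive_ext. Qed.
Lemma RInt_Rplus (f g : R -> R) a c : ex_RInt f a c -> ex_RInt g a c ->
  RInt (fun x => f x + g x) a c = RInt f a c + RInt g a c.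
Proof. apply (RInt_plus (V:=R_CompleteNormedModule)). Qed.
Lemma RInt_Rminus (f g : R -> R) a c : ex_RInt f a c -> ex_RInt g a c ->
  RInt (fun x => f x - g x) a c = RInt f a c - RInt g a c.
Proof. apply (RInt_minus (V:=R_CompleteNormedModule)). Qed.
Lemma RInt_Rscal (f : R -> R) l a c : ex_RInt f a c ->
  RInt (fun x => l * f x) a c = l * RInt f a c.
Proof. apply (RInt_scal (V:=R_CompleteNormedModule)). Qed.

(** * Legendre coefficients and integration by parts *)

Definition legendre_coef (w : R -> R) (n : nat) : R :=
  RInt (fun s => w s * legendre n s) (-1) 1.

(** Since (2n+3) P_{n+1} is the derivative of P_{n+2} - P_n, which vanishes at
    both endpoints, one integration by parts expresses a coefficient of g
    through two coefficients of its derivative w. This identity is the source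
    of every gain of a power of n. *)
Lemma legendre_coef_derive_S (g w : R -> R) n :
  (forall x, continuous g x) -> (forall x, continuous w x) ->
  (forall x, -1 < x < 1 -> is_derive g x (w x)) ->
  (2 * INR n + 3) * legendre_coef g (S n) = legendre_coef w n - legendre_coef w (S (S n)).
Proof.
intros Hg Hw Hd.
set (W s := legendre (S (S n)) s - legendre n s).
assert (E : RInt (fun s => w s * W s + (2 * INR n + 3) * (g s * legendre (S n) s)) (-1) 1
            = g 1 * W 1 - g (-1) * W (-1)).
{ apply (RInt_derive_interior (fun s => g s * W s)); [lra| | |]; unfold W.
  - intros; rcont.
  - intros; rcont.
  - intros x Hx.
    replace ((2 * INR n + 3) * (g x * legendre (S n) x))
      with (g x * (dlegendre (S (S n)) x - dlegendre n x))
      by (rewrite dlegendre_diff; ring).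
    apply (is_derive_mult g (fun s => legendre (S (S n)) s - legendre n s) x (w x)
            (dlegendre (S (S n)) x - dlegendre n x)); [auto| |intros; apply Rmult_comm].
    apply (is_derive_minus (V:=R_NormedModule)); apply is_derive_legendre. }
replace (W 1) with 0 in E by (unfold W; rewrite !legendre_1; ring).
replace (W (-1)) with 0 in E by (unfold W; rewrite !legendre_m1; simpl; ring).
rewrite RInt_Rplus in E by (apply ex_RInt_cont; intros; unfold W; rcont).
rewrite RInt_Rscal in E by (apply ex_RInt_cont; intros; rcont).
unfold legendre_coef. rewrite
  (RInt_Rext _ (fun s => w s * legendre (S (S n)) s - w s * legendre n s)) in E
  by (intros; unfold W; ring).
rewrite RInt_Rminus in E by (apply ex_RInt_cont; intros; rcont). lra.
Qed.

(** P_0 is the derivative of 1 + s, which does not vanish at 1; this is the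
    only boundary term. *)
Lemma legendre_coef_derive_0 (g w : R -> R) :
  (forall x, continuous g x) -> (forall x, continuous w x) ->
  (forall x, -1 < x < 1 -> is_derive g x (w x)) ->
  legendre_coef g 0 = 2 * g 1 - legendre_coef w 0 - legendre_coef w 1.
Proof.
intros Hg Hw Hd.
assert (E : RInt (fun s => (w s * 1 + w s * s) + g s * 1) (-1) 1
            = g 1 * (1 + 1) - g (-1) * (1 + -1)).
{ apply (RInt_derive_interior (fun s => g s * (1 + s))); [lra| | |].
  - intros; rcont.
  - intros; rcont.
  - intros x Hx.
    replace (w x * 1 + w x * x) with (w x * (1 + x)) by ring.
    apply (is_derive_mult g (fun s => 1 + s) x (w x) 1); [auto| |intros; apply Rmult_comm].
    auto_derive; trivial. }
rewrite RInt_Rplus in E by (apply ex_RInt_cont; intros; rcont).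
rewrite RInt_Rplus in E by (apply ex_RInt_cont; intros; rcont).
unfold legendre_coef; simpl legendre. lra.
Qed.

(** * Orthogonality *)

Definition legendre_ip (m n : nat) : R :=
  RInt (fun s => legendre m s * legendre n s) (-1) 1.

Lemma legendre_ip_sym m n : legendre_ip m n = legendre_ip n m.
Proof. apply RInt_Rext; intros; ring. Qed.

Lemma legendre_ip_0_S n : legendre_ip 0 (S n) = 0.
Proof.
assert (E : (2 * INR n + 3) * legendre_coef (fun _ => 1) (S n)
  = legendre_coef (fun _ => 0) n - legendre_coef (fun _ => 0) (S (S n))).
{ apply legendre_coef_derive_S; intros; [apply continuous_const|apply continuous_const|
  apply (is_derive_const (V:=R_NormedModule))]. }
unfold legendre_coef in E. 
rewrite (RInt_Rext (fun s => 0 * legendre n s) (fun s => 0)) in E by (intros; ring).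
rewrite (RInt_Rext (fun s => 0 * legendre (S (S n)) s) (fun s => 0)) in E by (intros; ring).
change (legendre_ip 0 (S n)) with (RInt (fun s => 1 * legendre (S n) s) (-1) 1).
pose proof (pos_INR n). nra.
Qed.

(** Multiplication by y is symmetric, and Bonnet's recursion may be applied to
    either factor of y P_{m+1} P_{n+1}. *)
Lemma legendre_ip_bonnet m n :
  (2 * INR n + 3) * ((INR m + 2) * legendre_ip (S (S m)) (S n)
    + (INR m + 1) * legendre_ip m (S n)) =
  (2 * INR m + 3) * ((INR n + 2) * legendre_ip (S m) (S (S n))
    + (INR n + 1) * legendre_ip (S m) n).
Proof.
unfold legendre_ip.
rewrite <- !RInt_Rscal by (apply ex_RInt_cont; intros; rcont).
rewrite <- !RInt_Rplus by (apply ex_RInt_cont; intros; rcont).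
rewrite <- !RInt_Rscal by (apply ex_RInt_cont; intros; rcont).
apply RInt_Rext; intros s.
transitivity ((2 * INR n + 3) * (2 * INR m + 3) * s
              * (legendre (S m) s * legendre (S n) s)).
- transitivity ((2 * INR n + 3) * ((2 * INR m + 3) * s * legendre (S m) s)
                * legendre (S n) s); [|ring].
  replace ((2 * INR m + 3) * s * legendre (S m) s)
    with ((INR m + 2) * legendre (S (S m)) s + (INR m + 1) * legendre m s)
    by (rewrite legendre_bonnet; ring).
  ring.
- transitivity ((2 * INR m + 3) * ((2 * INR n + 3) * s * legendre (S n) s)
                * legendre (S m) s); [ring|].
  replace ((2 * INR n + 3) * s * legendre (S n) s)
    with ((INR n + 2) * legendre (S (S n)) s + (INR n + 1) * legendre n s)
    by (rewrite legendre_bonnet; ring).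
  ring.
Qed.

Lemma legendre_ip_bonnet_0 n :
  (2 * INR n + 3) * legendre_ip 1 (S n) = (INR n + 2) * legendre_ip 0 (S (S n))
    + (INR n + 1) * legendre_ip 0 n.
Proof.
unfold legendre_ip.
rewrite <- !RInt_Rscal by (apply ex_RInt_cont; intros; rcont).
rewrite <- !RInt_Rplus by (apply ex_RInt_cont; intros; rcont).
apply RInt_Rext; intros s.
pose proof (legendre_bonnet n s) as Hn.
change (legendre 0 s) with 1; change (legendre 1 s) with s. lra.
Qed.

Lemma legendre_ip_lt m n : (m < n)%nat -> legendre_ip m n = 0.
Proof.
revert n; induction m as [| |m IH0 IH1] using nat_pair_ind; intros n Hn.
- destruct n; [lia|apply legendre_ip_0_S].
- destruct n as [|n]; [lia|]. destruct n as [|n]; [lia|].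
  pose proof (legendre_ip_bonnet_0 (S n)) as H. rewrite !legendre_ip_0_S, !S_INR in H.
  pose proof (pos_INR n). nra.
- destruct n as [|n]; [lia|].
  pose proof (legendre_ip_bonnet m n) as H.
  rewrite (IH0 (S n)), (IH1 (S (S n))), (IH1 n) in H by lia.
  pose proof (pos_INR n); pose proof (pos_INR m).
  assert ((2 * INR n + 3) * (INR m + 2) <> 0) by nra. 
  apply (Rmult_eq_reg_l ((2 * INR n + 3) * (INR m + 2))); [lra|assumption].
Qed.

Lemma legendre_ip_neq m n : m <> n -> legendre_ip m n = 0.
Proof.
intros H; destruct (Nat.lt_total m n) as [h|[h|h]]; [now apply legendre_ip_lt|lia|].
rewrite legendre_ip_sym; now apply legendre_ip_lt.
Qed.

Lemma legendre_ip_diag n : legendre_ip n n = 2 / (2 * INR n + 1).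
Proof.
induction n as [|n IH].
- unfold legendre_ip; simpl. rewrite (RInt_Rext _ (fun _ => 1)) by (intros; ring).
  rewrite RInt_const. unfold scal; simpl; unfold mult; simpl. field.
- pose proof (pos_INR n) as Hn.
  destruct n as [|n].
  + pose proof (legendre_ip_bonnet_0 0) as H. rewrite (legendre_ip_neq 0 2), IH in H by lia.
    change (INR 0) with 0 in *. change (INR 1) with 1. nra.
  + pose proof (legendre_ip_bonnet n (S n)) as H.
    rewrite IH, (legendre_ip_neq n (S (S n))), (legendre_ip_neq (S n) (S (S (S n)))) in H
      by lia.
    rewrite !S_INR in *. pose proof (pos_INR n).
    apply (Rmult_eq_reg_l ((2 * (INR n + 1) + 3) * (INR n + 2))); [|nra].
    replace ((2 * (INR n + 1) + 3) * (INR n + 2) * legendre_ip (S (S n)) (S (S n)))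
     with ((2 * (INR n + 1) + 3) *
       ((INR n + 2) * legendre_ip (S (S n)) (S (S n)) + (INR n + 1) * 0)) by ring.
    rewrite H. field. lra.
Qed.

(** * Partial sums, Bessel, and the distance to polynomials *)

Definition legendre_sum (c : nat -> R) (N : nat) (s : R) : R :=
  sum_f_R0 (fun n => (2 * INR n + 1) / 2 * c n * legendre n s) N.

(** The squared norm of [legendre_sum], when c lists inner products with the
    Legendre polynomials; see [legendre_ip_diag]. *)
Definition energy (c : nat -> R) (N : nat) : R :=
  sum_f_R0 (fun n => (2 * INR n + 1) / 2 * c n ^ 2) N.

(** The function u is given by its integrals rather than assumed continuous,
    so that the lemma also covers functions with a jump. Subtracting one term
    at a time keeps the remainder orthogonal to the polynomials already
    treated. *)
Lemma is_RInt_residual (u : R -> R) (c : nat -> R) (I : R) (N : nat) :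
  is_RInt (fun s => u s ^ 2) (-1) 1 I ->
  (forall n, is_RInt (fun s => u s * legendre n s) (-1) 1 (c n)) ->
  is_RInt (fun s => (u s - legendre_sum c N s) ^ 2) (-1) 1 (I - energy c N)
  /\ (forall k, is_RInt (fun s => (u s - legendre_sum c N s) * legendre k s) (-1) 1
        (if le_dec k N then 0 else c k)).
Proof.
intros H2 H1.
assert (Hl : forall m n, is_RInt (fun s => legendre m s * legendre n s) (-1) 1
  (legendre_ip m n)).
{ intros; apply (RInt_correct (V:=R_CompleteNormedModule)), ex_RInt_cont; intros; rcont. }
assert (step : forall (r : R -> R) (a : nat -> R) (I' : R) n,
  is_RInt (fun s => r s ^ 2) (-1) 1 I' ->
   (forall k, is_RInt (fun s => r s * legendre k s) (-1) 1 (a k)) ->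
   is_RInt (fun s => (r s - (2 * INR n + 1) / 2 * a n * legendre n s) ^ 2) (-1) 1
     (I' - (2 * INR n + 1) / 2 * a n ^ 2) /\
   (forall k, is_RInt (fun s =>
     (r s - (2 * INR n + 1) / 2 * a n * legendre n s) * legendre k s) (-1) 1
     (if Nat.eq_dec k n then 0 else a k))).
{ intros r a I' n Hr Ha. set (e := (2 * INR n + 1) / 2 * a n). pose proof (pos_INR n).
  split.
  - apply (is_RInt_Rext (fun s => r s ^ 2 + (-2 * e * (r s * legendre n s)
             + e ^ 2 * (legendre n s * legendre n s)))); [intros; ring|].
    replace (I' - _) with (I' + (-2 * e * a n + e ^ 2 * legendre_ip n n))
      by (rewrite legendre_ip_diag; unfold e; field; lra).
    apply (is_RInt_plus (V:=R_NormedModule)); [assumption|].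
    apply (is_RInt_plus (V:=R_NormedModule)); apply (is_RInt_scal (V:=R_NormedModule));
      auto.
  - intros k.
    apply (is_RInt_Rext (fun s => r s * legendre k s
      + - e * (legendre n s * legendre k s)));
      [intros; ring|].
    match goal with |- is_RInt _ _ _ ?x =>
      assert (E : (x : R) = a k + - e * legendre_ip n k :> R) end.
    { destruct (Nat.eq_dec k n) as [->|Hk].
        - rewrite legendre_ip_diag; unfold e; field; lra.
        - rewrite legendre_ip_neq by auto; ring. }
    rewrite E; apply (is_RInt_plus (V:=R_NormedModule)); [auto|].
    apply (is_RInt_scal (V:=R_NormedModule)); auto. }
induction N as [|N [IH2 IH1]].
- destruct (step u c I 0%nat H2 H1) as [A B]; split.
  + exact A.
  + intros k; specialize (B k). destruct (le_dec k 0), (Nat.eq_dec k 0); try lia; exact B.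
- destruct (step _ _ _ (S N) IH2 IH1) as [A B].
  destruct (le_dec (S N) N); [lia|]. split.
  + unfold energy; rewrite tech5. fold (energy c N).
    replace (I - _) with (I - energy c N - (2 * INR (S N) + 1) / 2 * c (S N) ^ 2) by ring.
    apply is_RInt_Rext with (2 := A).
    intros s _; unfold legendre_sum; rewrite tech5; ring.
  + intros k; specialize (B k).
    refine (is_RInt_Rcongr _ _ _ _ _ _ _ _ B).
    * intros s _; unfold legendre_sum; rewrite tech5; ring.
    * destruct (le_dec k (S N)), (Nat.eq_dec k (S N)), (le_dec k N);
        try lia; reflexivity.
Qed.

Lemma bessel (u : R -> R) (c : nat -> R) (I : R) (N : nat) :
  is_RInt (fun s => u s ^ 2) (-1) 1 I ->
  (forall n, is_RInt (fun s => u s * legendre n s) (-1) 1 (c n)) ->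
  energy c N <= I.
Proof.
intros H2 H1; destruct (is_RInt_residual u c I N H2 H1) as [A _].
enough (0 <= I - energy c N) by lra.
apply (is_RInt_ge_0 (fun s => (u s - legendre_sum c N s) ^ 2) (-1) 1); [lra|exact A|].
intros; apply pow2_ge_0.
Qed.

Definition sqnorm (w : R -> R) : R := RInt (fun s => w s ^ 2) (-1) 1.
(** The squared distance in L^2(-1,1) from w to the polynomials of degree at
    most N. *)
Definition residual (w : R -> R) (N : nat) : R := sqnorm w - energy (legendre_coef w) N.

Lemma cauchy_schwarz_psd A B C :
  (forall l, 0 <= A + 2 * l * B + l ^ 2 * C) -> B ^ 2 <= A * C.
Proof.
intros H; pose proof (H 0) as H0.
destruct (Req_dec C 0) as [->|HC].
- destruct (Req_dec B 0) as [->|HB]; [lra|].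
  exfalso. specialize (H (- (A + 1) / (2 * B))).
  replace (A + 2 * (- (A + 1) / (2 * B)) * B + (- (A + 1) / (2 * B)) ^ 2 * 0) with (-1) in H
    by (field; auto). lra.
- assert (0 < C).
  { destruct (Rlt_le_dec 0 C) as [|h]; [assumption|exfalso].
    set (l := (1 + Rabs A + 2 * Rabs B) / - C + 1).
    assert (Hl : 0 < - C) by lra.
    assert (l * - C >= 1 + Rabs A + 2 * Rabs B).
    { unfold l. rewrite Rmult_plus_distr_r. unfold Rdiv.
      rewrite Rmult_assoc, Rinv_l by lra. lra. }
    assert (1 <= l).
    { unfold l. assert (0 <= (1 + Rabs A + 2 * Rabs B) / - C); [|lra].
      apply Rmult_le_pos; [pose proof (Rabs_pos A); pose proof (Rabs_pos B); lra|].
      left; now apply Rinv_0_lt_compat. }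
    specialize (H l). pose proof (Rle_abs A). pose proof (Rle_abs B).
    pose proof (Rabs_pos A); pose proof (Rabs_pos B).
    assert (l * (l * - C) >= l * (1 + Rabs A + 2 * Rabs B)).
    { apply Rle_ge, Rmult_le_compat_l; lra. }
    assert (l * B <= l * Rabs B) by (apply Rmult_le_compat_l; lra).
    assert (l * (1 + Rabs A) >= 1 + Rabs A) by nra.
    nra. }
  (* the quadratic is smallest at l = - B / C *)
  specialize (H (- B / C)).
  replace (A + 2 * (- B / C) * B + (- B / C) ^ 2 * C) with ((A * C - B ^ 2) / C) in H
    by (field; auto).
  assert (0 <= (A * C - B ^ 2) / C * C) by (apply Rmult_le_pos; lra).
  replace ((A * C - B ^ 2) / C * C) with (A * C - B ^ 2) in H2 by (field; auto). lra.
Qed.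

(** * The indicator of [y, 1] *)

Definition step (y s : R) : R := if Rle_dec y s then 1 else 0.

(** The inner product of P_n with the indicator [step] of [y, 1]. *)
Definition step_coef (y : R) (n : nat) : R := RInt (legendre n) y 1.

Lemma is_RInt_step (v : R -> R) y : -1 <= y <= 1 -> (forall x, continuous v x) ->
  is_RInt (fun s => step y s * v s) (-1) 1 (RInt v y 1).
Proof.
intros Hy Hv. replace (RInt v y 1) with (0 + RInt v y 1) by ring.
apply (is_RInt_Chasles (V:=R_NormedModule)) with y.
- refine (is_RInt_Rcongr (fun _ => 0) _ _ _ ((y - -1) * 0) _ _ _
            (is_RInt_const (V:=R_NormedModule) (-1) y 0)); [|ring].
  rewrite Rmin_left, Rmax_right by lra; intros x Hx.
  unfold step; destruct (Rle_dec y x); lra.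
- apply (is_RInt_Rext v).
  + rewrite Rmin_left, Rmax_right by lra; intros x Hx.
    unfold step; destruct (Rle_dec y x); lra.
  + apply (RInt_correct (V:=R_CompleteNormedModule)), ex_RInt_cont; auto.
Qed.

(** The inner product of w and of the indicator of [y, 1] after both are
    projected onto the orthogonal complement of the polynomials of degree at
    most N. *)
Definition step_form (w : R -> R) (y : R) (N : nat) : R :=
  RInt w y 1 - sum_f_R0 (fun n => (2 * INR n + 1) / 2 * step_coef y n * legendre_coef w n)
    N.

(** The quantity [residual] for the indicator of [y, 1]. *)
Definition step_residual (y : R) (N : nat) : R := (1 - y) - energy (step_coef y) N.

(** Cauchy-Schwarz for the projected inner product, whose positivity is
    Bessel's inequality for w + l [step y]. *)
Lemma step_form_bound (w : R -> R) y N : -1 <= y <= 1 -> (forall x, continuous w x) ->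
  step_form w y N ^ 2 <= residual w N * step_residual y N.
Proof.
intros Hy Hw; apply cauchy_schwarz_psd; intros l.
assert (Hi : forall v : R -> R, (forall x, continuous v x) ->
  is_RInt v (-1) 1 (RInt v (-1) 1)).
{ intros; apply (RInt_correct (V:=R_CompleteNormedModule)), ex_RInt_cont; auto. }
assert (B : energy (fun n => legendre_coef w n + l * step_coef y n) N
            <= sqnorm w + (2 * l * RInt w y 1 + l ^ 2 * RInt (fun _ => 1) y 1)).
{ apply (bessel (fun s => w s + l * step y s)).
  - apply (is_RInt_Rext (fun s => w s ^ 2
      + (2 * l * (step y s * w s) + l ^ 2 * (step y s * 1)))).
    { intros x _; unfold step; destruct (Rle_dec y x); ring. }
    apply (is_RInt_plus (V:=R_NormedModule)).
    { apply (Hi (fun s => w s ^ 2)); intros; rcont. }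
    apply (is_RInt_plus (V:=R_NormedModule)); apply (is_RInt_scal (V:=R_NormedModule));
      apply is_RInt_step; auto; intros; rcont.
  - intros n.
    apply (is_RInt_Rext (fun s => w s * legendre n s + l * (step y s * legendre n s)));
      [intros; ring|].
    apply (is_RInt_plus (V:=R_NormedModule)).
    { apply (Hi (fun s => w s * legendre n s)); intros; rcont. }
    apply (is_RInt_scal (V:=R_NormedModule)). apply is_RInt_step; auto.
    intros; apply continuous_legendre. }
rewrite RInt_const in B; unfold scal in B; simpl in B; unfold mult in B; simpl in B.
assert (E : energy (fun n => legendre_coef w n + l * step_coef y n) N =
   energy (legendre_coef w) N
     + 2 * l * sum_f_R0 (fun n => (2 * INR n + 1) / 2 * step_coef y n * legendre_coef w n) N
   + l ^ 2 * energy (step_coef y) N).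
{ unfold energy; rewrite !scal_sum, <- !plus_sum; apply sum_eq; intros; ring. }
unfold residual, step_form, step_residual. rewrite E in B. lra.
Qed.

Lemma step_coef_0 y : step_coef y 0 = 1 - y.
Proof.
unfold step_coef; simpl. rewrite RInt_const. unfold scal; simpl; unfold mult; simpl. ring.
Qed.

Lemma RInt_derive_all (g w : R -> R) (a c : R) :
  (forall x, continuous w x) -> (forall x, is_derive g x (w x)) ->
  RInt w a c = g c - g a.
Proof.
intros Hw Hd; apply is_RInt_unique.
apply (is_RInt_derive (V:=R_CompleteNormedModule) g w a c); auto.
Qed.

Lemma step_coef_S y n : (2 * INR n + 3) * step_coef y (S n)
  = legendre n y - legendre (S (S n)) y.
Proof.
unfold step_coef. rewrite <- RInt_Rscal by (apply ex_RInt_cont; intros; rcont).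
rewrite (RInt_derive_all (fun s => legendre (S (S n)) s - legendre n s)).
- rewrite !legendre_1; ring.
- intros; rcont.
- intros x; rewrite <- dlegendre_diff.
  apply (is_derive_minus (V:=R_NormedModule)); apply is_derive_legendre.
Qed.

(** The sum telescopes: differentiating 1 - y - energy gives -y plus the sum
    of P_n (P_{n-1} - P_{n+1}) for 1 <= n <= N, that is, -P_N P_{N+1}. *)
Lemma is_derive_step_residual N y :
  is_derive (fun y => step_residual y N) y (- (legendre N y * legendre (S N) y)).
Proof.
assert (Hd : forall n y, is_derive (fun y => step_coef y n) y (- legendre n y)).
{ intros n z; unfold step_coef.
  apply (is_derive_RInt' (V:=R_NormedModule) (legendre n) _ z 1).
  - apply filter_forall; intros s. 
    apply (RInt_correct (V:=R_CompleteNormedModule)), ex_RInt_cont; intros; rcont.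
  - rcont. }
assert (He : forall n y, is_derive (fun y => (2 * INR n + 1) / 2 * step_coef y n ^ 2) y
           (- ((2 * INR n + 1) * step_coef y n * legendre n y))).
{ intros n z.
  replace (- ((2 * INR n + 1) * step_coef z n * legendre n z)) with
     ((2 * INR n + 1) / 2 * (INR 2 * - legendre n z * step_coef z n ^ 1)) by (simpl; field).
  apply (is_derive_scal (fun y => step_coef y n ^ 2)).
  apply (is_derive_pow (fun y => step_coef y n)). auto. }
induction N as [|N IH].
- replace (- (legendre 0 y * legendre 1 y))
    with (-1 - - ((2 * INR 0 + 1) * step_coef y 0 * legendre 0 y))
   by (rewrite step_coef_0; simpl; ring).
  apply (is_derive_minus (V:=R_NormedModule) (fun y => 1 - y)
          (fun y => (2 * INR 0 + 1) / 2 * step_coef y 0 ^ 2)); [|apply He].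
  auto_derive; trivial; ring.
- refine (is_derive_Rcongr
    (fun y => step_residual y N - (2 * INR (S N) + 1) / 2 * step_coef y (S N) ^ 2) _ _
    (- (legendre N y * legendre (S N) y)
     - - ((2 * INR (S N) + 1) * step_coef y (S N) * legendre (S N) y)) _ _ _ _).
  + intros; unfold step_residual, energy; rewrite tech5; ring.
  + pose proof (step_coef_S y N). rewrite S_INR.
    replace (2 * (INR N + 1) + 1) with (2 * INR N + 3) by ring. rewrite H. ring.
  + apply (is_derive_minus (V:=R_NormedModule)); [exact IH|apply He].
Qed.

Lemma RInt_legendre_product_le y N : -1 <= y <= 1 ->
  RInt (fun s => legendre N s * legendre (S N) s) y 1 <= 2 / (2 * INR N + 1).
Proof.
intros Hy; pose proof (pos_INR N).
set (Q s := legendre N s * legendre N s + legendre (S N) s * legendre (S N) s).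
assert (Qc : forall x, continuous Q x) by (intros; unfold Q; rcont).
assert (Qp : forall x, 0 <= Q x) by (intros; unfold Q; nra).
apply Rle_trans with (/ 2 * RInt Q (-1) 1).
- apply Rle_trans with (RInt (fun s => / 2 * Q s) y 1).
  + apply RInt_le; [lra|apply ex_RInt_cont; intros; rcont|apply ex_RInt_cont; intros;
      rcont|].
    intros x _; unfold Q. pose proof (pow2_ge_0 (legendre N x - legendre (S N) x)). lra.
  + rewrite RInt_Rscal by (apply ex_RInt_cont; auto).
    apply Rmult_le_compat_l; [lra|].
    assert (E : RInt Q (-1) y + RInt Q y 1 = RInt Q (-1) 1)
      by (apply (RInt_Chasles (V:=R_CompleteNormedModule)); apply ex_RInt_cont; auto).
    assert (0 <= RInt Q (-1) y) by (apply RInt_ge_0; [lra|apply ex_RInt_cont; auto|auto]).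
    lra.
- unfold Q; rewrite RInt_Rplus by (apply ex_RInt_cont; intros; rcont).
  change (/ 2 * (legendre_ip N N + legendre_ip (S N) (S N)) <= 2 / (2 * INR N + 1)).
  rewrite !legendre_ip_diag, S_INR.
  assert (2 / (2 * (INR N + 1) + 1) <= 2 / (2 * INR N + 1)); [|lra].
  apply Rmult_le_compat_l; [lra|]. apply Rinv_le_contravar; lra.
Qed.

(** By [is_derive_step_residual] this is the integral of P_N P_{N+1} over [y,
    1], as it vanishes at y = 1. So the rate 1/N comes from the norms of P_N
    and P_{N+1} and is uniform in y. *)
Lemma step_residual_bound y N : -1 <= y <= 1 -> step_residual y N <= 2 / (2 * INR N + 1).
Proof.
intros Hy.
assert (H1 : step_residual 1 N = 0).
{ unfold step_residual, energy. rewrite (sum_eq _ (fun _ => 0)), sum_cte; [ring|].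
  intros; unfold step_coef. rewrite RInt_point. unfold zero; simpl. ring. }
pose proof (RInt_legendre_product_le y N Hy) as HL.
assert (E : RInt (fun s => - (legendre N s * legendre (S N) s)) y 1
  = step_residual 1 N - step_residual y N).
{ apply (RInt_derive_all (fun y => step_residual y N)); [|apply is_derive_step_residual].
  intros; apply (continuous_opp (V:=R_NormedModule)
    (fun s => legendre N s * legendre (S N) s)); rcont. }
rewrite (RInt_Rext _ (fun s => -1 * (legendre N s * legendre (S N) s))) in E
  by (intros; ring).
rewrite RInt_Rscal in E by (apply ex_RInt_cont; intros; rcont). lra.
Qed.

(** * Uniform error of the Legendre partial sums *)

(** Inserting the integrated form of the coefficients of g in its partial sum
    and collecting the coefficients of w leaves the expansion of the indicator
    of [y, 1] to order N together with two unpaired terms. The identity is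
    exact at every order, so no tail of a series has to be summed. *)
Lemma legendre_error_formula (g w : R -> R) (y : R) (N : nat) : -1 <= y <= 1 ->
  (forall x, continuous g x) -> (forall x, continuous w x) ->
  (forall x, -1 < x < 1 -> is_derive g x (w x)) ->
  g y - legendre_sum (legendre_coef g) (S N) y =
    - step_form w y N + / 2 * legendre N y * legendre_coef w (S N)
    + / 2 * legendre (S N) y * legendre_coef w (S (S N)).
Proof.
intros Hy Hg Hw Hd; induction N as [|N IH].
- unfold legendre_sum, step_form; simpl sum_f_R0.
  rewrite step_coef_0, (legendre_coef_derive_0 g w) by auto.
  assert (E1 : RInt w y 1 = g 1 - g y).
  { apply RInt_derive_interior; auto; [lra|]. intros; apply Hd; lra. }
  pose proof (legendre_coef_derive_S g w 0 Hg Hw Hd) as E2. simpl INR in *.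
  replace (legendre_coef g 1) with ((legendre_coef w 0 - legendre_coef w 2) / 3) by lra.
  rewrite E1. simpl legendre. field.
- unfold step_form in *; rewrite tech5.
  unfold legendre_sum in *; rewrite tech5.
  pose proof (legendre_coef_derive_S g w (S N) Hg Hw Hd) as E2.
  pose proof (step_coef_S y N) as E3. rewrite S_INR in E2.
  replace ((2 * INR (S (S N)) + 1) / 2 * legendre_coef g (S (S N)))
    with (/ 2 * (legendre_coef w (S N) - legendre_coef w (S (S (S N)))))
    by (rewrite <- E2, !S_INR; field).
  replace ((2 * INR (S N) + 1) / 2 * step_coef y (S N) * legendre_coef w (S N))
    with (/ 2 * (legendre N y - legendre (S (S N)) y) * legendre_coef w (S N))
    by (rewrite <- E3, S_INR; field).
  lra.
Qed.

Lemma energy_S c N :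
  energy c (S N) = energy c N + (2 * INR (S N) + 1) / 2 * c (S N) ^ 2.
Proof. apply tech5. Qed.

Lemma energy_incr c N : energy c N <= energy c (S N).
Proof.
unfold energy; rewrite tech5. pose proof (pos_INR (S N)).
pose proof (pow2_ge_0 (c (S N))). nra.
Qed.

Lemma energy_mono c N M : (N <= M)%nat -> energy c N <= energy c M.
Proof.
intros H; induction H as [|M H IH]; [lra|]. pose proof (energy_incr c M); lra.
Qed.

Lemma energy_ge_0 c N : 0 <= energy c N.
Proof.
apply Rle_trans with (energy c 0); [|apply energy_mono; lia].
unfold energy; simpl. pose proof (pow2_ge_0 (c 0%nat)). simpl in H. lra.
Qed.

Section Continuous_function.
Variables (w : R -> R) (Hw : forall x, continuous w x).

Lemma is_RInt_sqnorm : is_RInt (fun s => w s ^ 2) (-1) 1 (sqnorm w).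
Proof.
apply (RInt_correct (V:=R_CompleteNormedModule)), ex_RInt_cont; intros; rcont.
Qed.

Lemma is_RInt_legendre_coef n : is_RInt (fun s => w s * legendre n s) (-1) 1
  (legendre_coef w n).
Proof.
apply (RInt_correct (V:=R_CompleteNormedModule)), ex_RInt_cont; intros; rcont.
Qed.

Lemma energy_le_sqnorm N : energy (legendre_coef w) N <= sqnorm w.
Proof. apply (bessel w); [apply is_RInt_sqnorm|apply is_RInt_legendre_coef]. Qed.

Lemma residual_ge_0 N : 0 <= residual w N.
Proof. unfold residual; pose proof (energy_le_sqnorm N); lra. Qed.

Lemma residual_le_sqnorm N : residual w N <= sqnorm w.
Proof. unfold residual; pose proof (energy_ge_0 (legendre_coef w) N); lra. Qed.

(** Bessel's inequality at order N + 2: the next two terms of the energy still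
    fit into what is left after order N. *)
Lemma legendre_coef_sqr_le N :
  legendre_coef w (S N) ^ 2 + legendre_coef w (S (S N)) ^ 2 <= 2 /
    (2 * INR N + 3) * residual w N.
Proof.
pose proof (energy_le_sqnorm (S (S N))) as H. pose proof (pos_INR N).
unfold energy in H; rewrite !tech5 in H. fold (energy (legendre_coef w) N) in H.
rewrite !S_INR in H. unfold residual.
apply (Rmult_le_reg_l ((2 * INR N + 3) / 2)); [lra|].
replace ((2 * INR N + 3) / 2 *
  (2 / (2 * INR N + 3) * (sqnorm w - energy (legendre_coef w) N)))
  with (sqnorm w - energy (legendre_coef w) N) by (field; lra).
pose proof (pow2_ge_0 (legendre_coef w (S (S N)))). nra.
Qed.

End Continuous_function.

Lemma legendre_error_sqr (g w : R -> R) (y : R) (N : nat) : -1 <= y <= 1 ->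
  (forall x, continuous g x) -> (forall x, continuous w x) ->
  (forall x, -1 < x < 1 -> is_derive g x (w x)) ->
  (g y - legendre_sum (legendre_coef g) (S N) y) ^ 2 <= 6 / INR (S N) * residual w N.
Proof.
intros Hy Hg Hw Hd; rewrite (legendre_error_formula g w y N) by auto.
pose proof (step_form_bound w y N Hy Hw) as B.
pose proof (step_residual_bound y N Hy) as S1.
pose proof (legendre_coef_sqr_le w Hw N) as C.
pose proof (residual_ge_0 w Hw N) as R0. pose proof (pos_INR N) as HN.
pose proof (legendre_bounded N y Hy) as P1.
pose proof (legendre_bounded (S N) y Hy) as P2.
set (b := step_form w y N) in *; set (c1 := legendre_coef w (S N)) in *.
set (c2 := legendre_coef w (S (S N))) in *. set (r := residual w N) in *.
apply Rabs_le_between in P1; apply Rabs_le_between in P2.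
set (p1 := legendre N y) in *; set (p2 := legendre (S N) y) in *.
assert (B' : b ^ 2 <= r * (2 / (2 * INR N + 1))).
{ apply Rle_trans with (1 := B). now apply Rmult_le_compat_l. }
assert (Q1 : (p1 * c1) ^ 2 <= c1 ^ 2).
{ rewrite Rpow_mult_distr. rewrite <- (Rmult_1_l (c1 ^ 2)) at 2.
  apply Rmult_le_compat_r; [apply pow2_ge_0|nra]. }
assert (Q2 : (p2 * c2) ^ 2 <= c2 ^ 2).
{ rewrite Rpow_mult_distr. rewrite <- (Rmult_1_l (c2 ^ 2)) at 2.
  apply Rmult_le_compat_r; [apply pow2_ge_0|nra]. }
assert (T : (- b + / 2 * p1 * c1 + / 2 * p2 * c2) ^ 2
            <= 2 * b ^ 2 + (p1 * c1) ^ 2 + (p2 * c2) ^ 2).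
{ pose proof (pow2_ge_0 (b + (/ 2 * p1 * c1 + / 2 * p2 * c2))).
  pose proof (pow2_ge_0 (p1 * c1 - p2 * c2)). nra. }
assert (F1 : 2 / (2 * INR N + 3) <= 2 / (INR N + 1)).
{ apply Rmult_le_compat_l; [lra|]. apply Rinv_le_contravar; lra. }
assert (F2 : 2 / (2 * INR N + 1) <= 2 / (INR N + 1)).
{ apply Rmult_le_compat_l; [lra|]. apply Rinv_le_contravar; lra. }
apply (Rmult_le_compat_r r _ _ R0) in F1, F2.
rewrite S_INR. replace (6 / (INR N + 1) * r) with (3 * (2 / (INR N + 1) * r))
  by (field; lra).
lra.
Qed.

(** Integrating the uniform estimate gives the completeness of the Legendre
    system for differentiable functions. *)
Lemma residual_rate (g w : R -> R) (N : nat) :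
  (forall x, continuous g x) -> (forall x, continuous w x) ->
  (forall x, -1 < x < 1 -> is_derive g x (w x)) ->
  residual g (S N) <= 12 * sqnorm w / INR (S N).
Proof.
intros Hg Hw Hd.
destruct (is_RInt_residual g (legendre_coef g) (sqnorm g) (S N) (is_RInt_sqnorm g Hg)
  (is_RInt_legendre_coef g Hg))
  as [A _].
fold (residual g (S N)) in A.
pose proof (residual_le_sqnorm w N) as R1.
assert (P : 0 < INR (S N)) by apply lt_0_INR, Nat.lt_0_succ.
assert (B : residual g (S N) <= 6 / INR (S N) * residual w N * (1 - -1)).
{ refine (is_RInt_le _ (fun _ => 6 / INR (S N) * residual w N) (-1) 1 _ _ _ A _ _);
    [lra| |].
  - refine (is_RInt_Rcongr (fun _ => 6 / INR (S N) * residual w N) _ _ _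
       ((1 - -1) * (6 / INR (S N) * residual w N)) _ _ _
         (is_RInt_const (V:=R_NormedModule) _ _ _));
     [reflexivity|ring].
  - intros x Hx; apply legendre_error_sqr; auto; lra. }
apply Rle_trans with (1 := B).
apply (Rmult_le_reg_l (INR (S N))); [exact P|].
replace (INR (S N) * (6 / INR (S N) * residual w N * (1 - -1))) with (12 * residual w N)
  by (field; lra).
replace (INR (S N) * (12 * sqnorm w / INR (S N))) with (12 * sqnorm w) by (field; lra). lra.
Qed.

(** In (2n+3) c_{n+1}(w) = c_n(z) - c_{n+2}(z) the factor 2n+3 gains 1/n, and
    every square on the right is counted at most twice. *)
Lemma energy_tail (w z : R -> R) (N M : nat) :
  (forall x, continuous w x) -> (forall x, continuous z x) ->
  (forall x, -1 < x < 1 -> is_derive w x (z x)) ->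
  energy (legendre_coef w) (S (N + M)) - energy (legendre_coef w) (S N) <=
    / (2 * INR (S N) ^ 2) *
    ((energy (legendre_coef z) (N + M) - energy (legendre_coef z) N)
     + (energy (legendre_coef z) (S (S (N + M))) - energy (legendre_coef z) (S (S N)))).
Proof.
intros Hw Hz Hd; induction M as [|M IH].
- rewrite Nat.add_0_r. apply Req_le; ring.
- rewrite Nat.add_succ_r.
  set (n := S (N + M)) in *.
  assert (Hn : INR (S N) <= INR n) by (apply le_INR; unfold n; lia).
  assert (P : 0 < INR (S N)) by apply lt_0_INR, Nat.lt_0_succ.
  pose proof (legendre_coef_derive_S w z n Hw Hz Hd) as E.
  assert (En : energy (legendre_coef z) n
    = energy (legendre_coef z) (N + M) + (2 * INR n + 1) / 2 * legendre_coef z n ^ 2)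
    by apply energy_S.
  rewrite (energy_S (legendre_coef w) n), (energy_S (legendre_coef z) (S n)), En.
  rewrite !(S_INR n), (S_INR (S n)), (S_INR n).
  set (a := legendre_coef z n) in *; set (c := legendre_coef z (S (S n))) in *.
  set (d := legendre_coef w (S n)) in *. set (k := / (2 * INR (S N) ^ 2)) in *.
  enough (X : (2 * (INR n + 1) + 1) / 2 * d ^ 2 <=
      k * ((2 * INR n + 1) / 2 * a ^ 2 + (2 * (INR n + 1 + 1) + 1) / 2 * c ^ 2)).
  { change (S (S (N + M))) with (S n) in IH. lra. }
  assert (D : d ^ 2 <= / (2 * INR n + 3) ^ 2 * (2 * a ^ 2 + 2 * c ^ 2)).
  { replace d with (/ (2 * INR n + 3) * (a - c)) by (rewrite <- E; field; lra).
    rewrite Rpow_mult_distr, pow_inv. apply Rmult_le_compat_l.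
    - left; apply Rinv_0_lt_compat, pow_lt; lra.
    - pose proof (pow2_ge_0 (a + c)); nra. }
  apply Rle_trans with ((2 * (INR n + 1) + 1) / 2 *
    (/ (2 * INR n + 3) ^ 2 * (2 * a ^ 2 + 2 * c ^ 2))).
  { apply Rmult_le_compat_l; lra. }
  replace ((2 * (INR n + 1) + 1) / 2 * (/ (2 * INR n + 3) ^ 2 * (2 * a ^ 2 + 2 * c ^ 2)))
    with (/ (2 * INR n + 3) * (a ^ 2 + c ^ 2)) by (field; lra).
  assert (F : / (2 * INR n + 3) <= k * ((2 * INR n + 1) / 2)).
  { unfold k. apply (Rmult_le_reg_l (2 * INR n + 3)); [lra|].
    rewrite Rinv_r by lra.
    apply (Rmult_le_reg_l (2 * INR (S N) ^ 2)); [nra|].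
    replace (2 * INR (S N) ^ 2 *
      ((2 * INR n + 3) * (/ (2 * INR (S N) ^ 2) * ((2 * INR n + 1) / 2))))
      with ((2 * INR n + 3) * ((2 * INR n + 1) / 2)) by (field; lra).
    nra. }
  assert (k0 : 0 < k) by (apply Rinv_0_lt_compat; nra).
  pose proof (pow2_ge_0 a); pose proof (pow2_ge_0 c).
  assert (0 <= k * (2 * c ^ 2)) by (apply Rmult_le_pos; lra).
  apply Rle_trans with (k * ((2 * INR n + 1) / 2) * (a ^ 2 + c ^ 2)).
  + apply Rmult_le_compat_r; lra.
  + lra.
Qed.

(** A residual is the tail of the energy plus a later residual, which tends to
    0 by [residual_rate]; the tail is controlled by [energy_tail]. *)
Lemma residual_derive (w z : R -> R) (N : nat) :
  (forall x, continuous w x) -> (forall x, continuous z x) ->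
  (forall x, -1 < x < 1 -> is_derive w x (z x)) ->
  residual w (S N) <= / INR (S N) ^ 2 * residual z N.
Proof.
intros Hw Hz Hd.
assert (P : 0 < INR (S N)) by apply lt_0_INR, Nat.lt_0_succ.
set (A := 12 * sqnorm z).
assert (A0 : 0 <= A).
{ unfold A; pose proof (residual_ge_0 z Hz 0); pose proof (residual_le_sqnorm z 0); lra. }
assert (H : forall M, residual w (S N) <= / INR (S N) ^ 2 * residual z N + A / INR (S M)).
{ intros M.
  pose proof (energy_tail w z N M Hw Hz Hd) as T.
  pose proof (residual_rate w z (N + M) Hw Hz Hd) as Z. fold A in Z.
  pose proof (energy_le_sqnorm z Hz (N + M)) as E1.
  pose proof (energy_le_sqnorm z Hz (S (S (N + M)))) as E2.
  assert (E3 : energy (legendre_coef z) N <= energy (legendre_coef z) (S (S N)))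
    by (apply energy_mono; lia).
  assert (Z' : A / INR (S (N + M)) <= A / INR (S M)).
  { apply Rmult_le_compat_l; [exact A0|]. apply Rinv_le_contravar.
    - apply lt_0_INR; lia.
    - apply le_INR; lia. }
  assert (T' : energy (legendre_coef w) (S (N + M)) - energy (legendre_coef w) (S N)
               <= / (2 * INR (S N) ^ 2) * (2 * residual z N)).
  { apply Rle_trans with (1 := T). apply Rmult_le_compat_l.
    - left; apply Rinv_0_lt_compat; nra.
    - unfold residual; lra. }
  replace (/ (2 * INR (S N) ^ 2) * (2 * residual z N))
    with (/ INR (S N) ^ 2 * residual z N) in T'
    by (field; lra).
  unfold residual at 1; unfold residual at 1 in Z. lra. }
destruct (Rle_lt_dec (residual w (S N)) (/ INR (S N) ^ 2 * residual z N)) as [|L];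
  [assumption|exfalso].
set (d := residual w (S N) - / INR (S N) ^ 2 * residual z N) in *.
assert (d0 : 0 < d) by (unfold d; lra).
destruct (archimed_cor1 (d / (A + 1))) as [M [HM M0]].
{ apply Rdiv_lt_0_compat; lra. }
destruct M as [|M]; [lia|]. specialize (H M).
assert (A / INR (S M) < d).
{ apply Rle_lt_trans with ((A + 1) * / INR (S M)).
  - apply Rmult_le_compat_r; [left; apply Rinv_0_lt_compat, lt_0_INR; lia|lra].
  - replace d with ((A + 1) * (d / (A + 1))) by (field; lra).
    apply Rmult_lt_compat_l; lra. }
unfold d in *; lra.
Qed.

(** One derivative is spent on [legendre_error_sqr], which gives N^(-1/2)
    times the root of a residual of G 1. The p others gain 1/(N-1), ...,
    1/(N-p), each at most (p+1)/N because N > p. *)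
Lemma legendre_projection_error (p : nat) (G : nat -> R -> R) (V : R) (N : nat) (y : R) :
  (forall k x, continuous (G k) x) ->
  (forall k x, (k <= p)%nat -> -1 < x < 1 -> is_derive (G k) x (G (S k) x)) ->
  (forall x, -1 <= x <= 1 -> Rabs (G (S p) x) <= V) ->
  (p < N)%nat -> -1 <= y <= 1 ->
  Rabs (G 0%nat y - legendre_sum (legendre_coef (G 0%nat)) N y)
    <= 4 * (INR p + 1) ^ p * V / Rpower (INR N) (INR p + 1 / 2).
Proof.
intros Hc Hd HV HN Hy.
assert (V0 : 0 <= V) by (apply Rle_trans with (2 := HV y Hy), Rabs_pos).
assert (N0 : 0 < INR N) by (apply lt_0_INR; lia).
pose proof (pos_INR p) as p0.
assert (HR : forall i, (i <= p)%nat ->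
  residual (G 1%nat) (N - 1) <= ((INR p + 1) / INR N) ^ (2 * i) * residual (G (S i))
    (N - 1 - i)).
{ induction i as [|i IH]; intros Hi.
  - rewrite Nat.sub_0_r; simpl; lra.
  - apply Rle_trans with (1 := IH ltac:(lia)).
    replace (2 * S i)%nat with (2 * i + 2)%nat by lia. rewrite pow_add, Rmult_assoc.
    apply Rmult_le_compat_l.
    { apply pow_le; left; apply Rdiv_lt_0_compat; lra. }
    replace (N - 1 - i)%nat with (S (N - 1 - S i)) by lia.
    set (n := (N - 1 - S i)%nat).
    apply Rle_trans with (1 := residual_derive (G (S i)) (G (S (S i))) n (Hc _) (Hc _)
        (fun x => Hd (S i) x Hi)).
    apply Rmult_le_compat_r; [apply residual_ge_0; auto|].
    rewrite <- pow_inv. apply pow_incr.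
    assert (Hn : 0 < INR (S n)) by apply lt_0_INR, Nat.lt_0_succ.
    split; [left; now apply Rinv_0_lt_compat|].
    apply (Rmult_le_reg_l (INR (S n) * INR N)); [nra|].
    replace (INR (S n) * INR N * / INR (S n)) with (INR N) by (field; lra).
    replace (INR (S n) * INR N * ((INR p + 1) / INR N)) with (INR (S n) * (INR p + 1))
      by (field; lra).
    rewrite <- S_INR, <- mult_INR. apply le_INR. unfold n. nia. }
specialize (HR p (Nat.le_refl _)).
assert (HS : residual (G (S p)) (N - 1 - p) <= 2 * V ^ 2).
{ apply Rle_trans with (1 := residual_le_sqnorm _ _).
  refine (is_RInt_le (fun s => G (S p) s ^ 2) (fun _ => V ^ 2) (-1) 1 _ _ _
            (is_RInt_sqnorm _ (Hc _)) _ _); [lra| |].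
  - refine (is_RInt_Rcongr (fun _ => V ^ 2) _ _ _ ((1 - -1) * V ^ 2) _ _ _
       (is_RInt_const (V:=R_NormedModule) _ _ _)); [reflexivity|ring].
  - intros x Hx. rewrite <- pow2_abs. apply pow_incr; split;
      [apply Rabs_pos|apply HV; lra]. }
assert (HE : (G 0%nat y - legendre_sum (legendre_coef (G 0%nat)) N y) ^ 2
      <= 6 / INR N * residual (G 1%nat) (N - 1)).
{ replace N with (S (N - 1)) at 1 2 by lia.
  apply legendre_error_sqr; auto. intros; apply Hd; [lia|assumption]. }
rewrite Rpower_plus, Rpower_pow by assumption.
replace (1 / 2) with (/ 2) by lra. rewrite Rpower_sqrt by assumption.
set (q := (INR p + 1) / INR N) in *.
assert (q0 : 0 <= q) by (left; apply Rdiv_lt_0_compat; lra).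
assert (s0 : 0 < sqrt (INR N)) by now apply sqrt_lt_R0.
assert (Hq : 4 * (INR p + 1) ^ p * V / (INR N ^ p * sqrt (INR N))
  = 4 * q ^ p * V / sqrt (INR N)).
{ unfold q, Rdiv; rewrite Rpow_mult_distr, pow_inv. field; split;
    [lra|apply pow_nonzero; lra]. }
rewrite Hq.
assert (Y0 : 0 <= 4 * q ^ p * V / sqrt (INR N)).
{ apply Rmult_le_pos; [|left; now apply Rinv_0_lt_compat].
  pose proof (pow_le q p q0); nra. }
rewrite <- (Rabs_pos_eq _ Y0). apply Rsqr_le_abs_0. rewrite !Rsqr_pow2.
apply Rle_trans with (1 := HE).
apply Rle_trans with (6 / INR N * (q ^ (2 * p) * (2 * V ^ 2))).
- apply Rmult_le_compat_l; [left; apply Rdiv_lt_0_compat; lra|].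
  apply Rle_trans with (1 := HR). apply Rmult_le_compat_l; [now apply pow_le|exact HS].
- replace ((4 * q ^ p * V / sqrt (INR N)) ^ 2)
    with (16 * (q ^ p) ^ 2 * V ^ 2 / INR N).
  2:{ rewrite <- (sqrt_sqrt (INR N)) at 1 by lra. field; lra. }
  rewrite Nat.mul_comm, pow_mult.
  replace (6 / INR N * ((q ^ p) ^ 2 * (2 * V ^ 2)))
    with (12 * (q ^ p) ^ 2 * V ^ 2 / INR N) by (field; lra).
  apply Rmult_le_compat_r; [left; now apply Rinv_0_lt_compat|].
  pose proof (Rmult_le_pos _ _ (pow2_ge_0 (q ^ p)) (pow2_ge_0 V)). lra.
Qed.

(** * Continuous functions of two variables and the Leibniz rule *)

Definition cont2 (f : R -> R -> R) : Prop := forall x y, continuity_2d_pt f x y.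

Lemma cont2_comp (f : R -> R -> R) (a c : R -> R) x : cont2 f ->
  continuous a x -> continuous c x -> continuous (fun s => f (a s) (c s)) x.
Proof.
intros Hf Ha Hc. apply (continuous_comp_2 a c f x Ha Hc).
apply continuity_2d_pt_filterlim, Hf.
Qed.

Lemma cont2_comp2 (f g h : R -> R -> R) : cont2 f -> cont2 g -> cont2 h ->
  cont2 (fun u v => f (g u v) (h u v)).
Proof.
intros Hf Hg Hh x y. apply continuity_2d_pt_filterlim.
apply (continuous_comp_2 (U := prod_UniformSpace R_UniformSpace R_UniformSpace)
   (fun z : R * R => g (fst z) (snd z)) (fun z : R * R => h (fst z) (snd z)) f (x, y)).
- apply continuity_2d_pt_filterlim, Hg.
- apply continuity_2d_pt_filterlim, Hh.
- apply continuity_2d_pt_filterlim, Hf.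
Qed.

Lemma cont2_1 (f : R -> R) (g : R -> R -> R) : (forall x, continuous f x) -> cont2 g ->
  cont2 (fun u v => f (g u v)).
Proof.
intros Hf Hg x y; apply continuity_1d_2d_pt_comp; [|apply Hg].
apply continuity_pt_filterlim, Hf.
Qed.

Lemma cont2_fst : cont2 (fun u _ => u). Proof. intros x y; apply continuity_2d_pt_id1. Qed.
Lemma cont2_snd : cont2 (fun _ v => v). Proof. intros x y; apply continuity_2d_pt_id2. Qed.
Lemma cont2_const c : cont2 (fun _ _ => c).
Proof. intros x y; apply continuity_2d_pt_const. Qed.
Lemma cont2_plus f g : cont2 f -> cont2 g -> cont2 (fun u v => f u v + g u v).
Proof. intros Hf Hg x y; apply continuity_2d_pt_plus; auto. Qed.
Lemma cont2_minus f g : cont2 f -> cont2 g -> cont2 (fun u v => f u v - g u v).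
Proof. intros Hf Hg x y; apply continuity_2d_pt_minus; auto. Qed.
Lemma cont2_mult f g : cont2 f -> cont2 g -> cont2 (fun u v => f u v * g u v).
Proof. intros Hf Hg x y; apply continuity_2d_pt_mult; auto. Qed.
Lemma cont2_ext f g : (forall u v, f u v = g u v) -> cont2 f -> cont2 g.
Proof. intros H Hf x y; apply continuity_2d_pt_ext with f; auto. Qed.

Ltac cont2_tac := repeat lazymatch goal with
  | |- cont2 (fun u v => u) => apply cont2_fst
  | |- cont2 (fun u v => v) => apply cont2_snd
  | |- cont2 (fun _ _ => ?c) => apply (cont2_const c)
  | |- cont2 (fun u v => @?f u v + @?g u v) => apply (cont2_plus f g)
  | |- cont2 (fun u v => @?f u v - @?g u v) => apply (cont2_minus f g)
  | |- cont2 (fun u v => @?f u v * @?g u v) => apply (cont2_mult f g)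
  | H : cont2 ?f |- cont2 ?f => exact H
  | H : cont2 ?f |- cont2 (fun u v => ?f u v) => exact H
  | H : cont2 ?f |- cont2 (fun u v => ?f (@?g u v) (@?h u v)) => apply (cont2_comp2 f g h H)
  | H : forall x, continuous ?f x |- cont2 (fun u v => ?f (@?g u v)) =>
      apply (cont2_1 f g H)
  end.

Lemma ex_RInt_cont2_r (f : R -> R -> R) u a c : cont2 f -> ex_RInt (fun s => f u s) a c.
Proof.
intros Hf; apply ex_RInt_cont; intros x.
apply (cont2_comp f (fun _ => u) (fun s => s));
  [auto|apply continuous_const|apply continuous_id].
Qed.

Lemma is_derive_RInt_leibniz (f ft : R -> R -> R) (a c : R -> R) (t da dc : R) :
  (forall t s, is_derive (fun t => f t s) t (ft t s)) ->
  cont2 f -> cont2 ft -> is_derive a t da -> is_derive c t dc ->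
  is_derive (fun t => RInt (fun s => f t s) (a t) (c t)) t
    (RInt (fun s => ft t s) (a t) (c t) + f t (c t) * dc - f t (a t) * da).
Proof.
intros Hd Hf Hft Ha Hc.
assert (HD : forall u v, Derive (fun z => f z v) u = ft u v)
  by (intros; apply is_derive_unique, Hd).
assert (HDc : cont2 (fun u v => Derive (fun z => f z v) u))
  by (apply cont2_ext with ft; auto).
assert (Hfc : forall s, continuity_pt (fun s => f t s) s).
{ intros s; apply continuity_pt_filterlim.
  apply (cont2_comp f (fun _ => t) (fun s => s));
    [auto|apply continuous_const|apply continuous_id]. }
refine (is_derive_Rcongr _ _ _ _ _ (fun _ => eq_refl) _
   (is_derive_RInt_param_bound_comp f a c t da dc _ _ _ Ha Hc _ _ _ _ _ _)); auto.
- rewrite (RInt_Rext _ (fun s => ft t s)) by auto. ring.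
- apply filter_forall; intros; now apply ex_RInt_cont2_r.
- exists (mkposreal 1 Rlt_0_1); apply filter_forall; intros; now apply ex_RInt_cont2_r.
- exists (mkposreal 1 Rlt_0_1); apply filter_forall; intros; now apply ex_RInt_cont2_r.
- exists (mkposreal 1 Rlt_0_1); apply filter_forall; intros; eexists; apply Hd.
- exists (mkposreal 1 Rlt_0_1); intros; apply HDc.
- exists (mkposreal 1 Rlt_0_1); intros; apply HDc.
Qed.

Lemma is_derive_RInt_upper (f : R -> R) a x : (forall x, continuous f x) ->
  is_derive (fun x => RInt f a x) x (f x).
Proof.
intros Hf; apply (is_derive_RInt (V:=R_NormedModule) f _ a x); [|apply Hf].
apply filter_forall; intros z.
apply (RInt_correct (V:=R_CompleteNormedModule)), ex_RInt_cont; auto.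
Qed.

Lemma derive_continuous (f : R -> R) (x l : R) : is_derive f x l -> continuous f x.
Proof. intros H; apply (ex_derive_continuous (K:=R_AbsRing) (V:=R_NormedModule)); eexists;
  apply H. Qed.

(** Uniform continuity on a compact rectangle controls the variation of the
    integrand, while the moving endpoint is handled at the fixed parameter u0. *)
Lemma cont2_RInt (f : R -> R -> R) : cont2 f ->
  cont2 (fun u v => RInt (fun s => f u s) 0 v).
Proof.
intros Hf u0 v0 eps.
set (r := Rabs v0 + 1). assert (r0 : 0 < r) by (unfold r; pose proof (Rabs_pos v0); lra).
assert (e0 : 0 < eps / (2 * r)) by (apply Rdiv_lt_0_compat; [apply cond_pos|lra]).
destruct (uniform_continuity_2d f (u0 - 1) (u0 + 1) (- r) r (fun x y _ _ => Hf x y)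
   (mkposreal _ e0)) as [d1 Hd1]; simpl in Hd1.
assert (HI : continuous (fun v => RInt (fun s => f u0 s) 0 v) v0).
{ apply derive_continuous with (f u0 v0), (is_derive_RInt_upper (fun s => f u0 s)).
  intros; apply (cont2_comp f (fun _ => u0) (fun s => s));
    [auto|apply continuous_const|apply continuous_id]. }
assert (e1 : 0 < eps / 2) by (pose proof (cond_pos eps); lra).
apply continuity_pt_filterlim in HI.
destruct (proj1 (continuity_pt_locally _ _) HI (mkposreal _ e1)) as [d2 Hd2]; simpl in Hd2.
assert (d0 : 0 < Rmin (Rmin d1 d2) 1).
{ repeat apply Rmin_glb_lt; try apply cond_pos; lra. }
exists (mkposreal _ d0); simpl; intros u v Hu Hv.
pose proof (Rmin_l (Rmin d1 d2) 1); pose proof (Rmin_r (Rmin d1 d2) 1).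
pose proof (Rmin_l d1 d2); pose proof (Rmin_r d1 d2).
apply Rle_lt_trans with (Rabs (RInt (fun s => f u s) 0 v - RInt (fun s => f u0 s) 0 v)
   + Rabs (RInt (fun s => f u0 s) 0 v - RInt (fun s => f u0 s) 0 v0)).
{ eapply Rle_trans; [|apply Rabs_triang]. right; f_equal; ring. }
assert (A2 : Rabs (RInt (fun s => f u0 s) 0 v - RInt (fun s => f u0 s) 0 v0) < eps / 2).
{ apply Hd2. change (Rabs (v - v0) < d2). lra. }
assert (Hvr : Rabs v <= r).
{ unfold r. replace v with (v0 + (v - v0)) by ring.
  pose proof (Rabs_triang v0 (v - v0)). lra. }
rewrite <- RInt_Rminus by now apply ex_RInt_cont2_r.
assert (A1 : Rabs (RInt (fun s => f u s - f u0 s) 0 v) <= Rabs (v - 0) * (eps / (2 * r))).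
{ apply (norm_RInt_le_const_abs (V:=R_NormedModule) (fun s => f u s - f u0 s) 0 v
     (RInt (fun s => f u s - f u0 s) 0 v) (eps / (2 * r))).
  - intros s Hs.
    assert (Rabs s <= r).
    { unfold Rmin, Rmax in Hs; destruct (Rle_dec 0 v);
      apply Rabs_le; apply Rabs_le_between in Hvr; lra. }
    apply Rabs_le_between in H3.
    left. apply (Hd1 u0 s u s); try lra.
    + apply Rabs_lt_between' in Hu. lra.
    + rewrite Rminus_eq_0, Rabs_R0. apply cond_pos.
  - apply (RInt_correct (V:=R_CompleteNormedModule)).
    apply (ex_RInt_minus (V:=R_CompleteNormedModule)); now apply ex_RInt_cont2_r. }
rewrite Rminus_0_r in A1.
assert (Rabs v * (eps / (2 * r)) <= eps / 2).
{ replace (eps / 2) with (r * (eps / (2 * r))) by (field; lra).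
  apply Rmult_le_compat_r; lra. }
lra.
Qed.

(** * Smooth functions on the line and on the plane *)

Fixpoint smooth1 (n : nat) (g : R -> R) : Prop :=
  (forall x, continuous g x) /\
  match n with
  | O => True
  | S m => exists dg, smooth1 m dg /\ forall x, is_derive g x (dg x)
  end.

(** The derivative is taken along arbitrary lines, not just along the axes:
    this builds in the chain rule for the change of variables u = (x+t)/2, v =
    (x-t)/2. *)
Fixpoint smooth2 (n : nat) (h : R -> R -> R) : Prop :=
  cont2 h /\
  match n with
  | O => True
  | S m => exists hu hv, smooth2 m hu /\ smooth2 m hv /\
      forall a c d e s,
        is_derive (fun s => h (a + c * s) (d + e * s)) s
          (c * hu (a + c * s) (d + e * s) + e * hv (a + c * s) (d + e * s))
  end.

Lemma smooth1_cont n g : smooth1 n g -> forall x, continuous g x.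
Proof. destruct n; simpl; tauto. Qed.
Lemma smooth2_cont n h : smooth2 n h -> cont2 h.
Proof. destruct n; simpl; tauto. Qed.

Lemma smooth1_S n g : smooth1 (S n) g -> smooth1 n g.
Proof.
revert g; induction n as [|n IH]; intros g [Hc [dg [H1 H2]]].
- split; auto.
- split; [exact Hc|]. exists dg; split; auto.
Qed.
Lemma smooth1_le m n g : (m <= n)%nat -> smooth1 n g -> smooth1 m g.
Proof. induction 1; auto. intros; apply IHle; now apply smooth1_S. Qed.

Lemma smooth2_S n h : smooth2 (S n) h -> smooth2 n h.
Proof.
revert h; induction n as [|n IH]; intros h [Hc [hu [hv [H1 [H2 H3]]]]].
- split; auto.
- split; [exact Hc|]. exists hu, hv; auto.
Qed.

Lemma smooth2_const n c : smooth2 n (fun _ _ => c).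
Proof.
revert c; induction n as [|n IH]; intros c; (split; [apply cont2_const|]); [exact I|].
exists (fun _ _ => 0), (fun _ _ => 0); (split; [|split]); auto.
intros; refine (is_derive_Rcongr _ _ _ _ _ (fun _ => eq_refl) _
  (is_derive_const (V:=R_NormedModule) c s)).
change (0 = c0 * 0 + e * 0). ring.
Qed.

Lemma smooth2_plus n f g : smooth2 n f -> smooth2 n g ->
  smooth2 n (fun u v => f u v + g u v).
Proof.
revert f g; induction n as [|n IH]; intros f g Hf Hg;
 (split; [apply cont2_plus; eapply smooth2_cont; eassumption|]); [exact I|].
destruct Hf as [_ [fu [fv [Hfu [Hfv Hf]]]]], Hg as [_ [gu [gv [Hgu [Hgv Hg]]]]].
exists (fun u v => fu u v + gu u v), (fun u v => fv u v + gv u v); (split; [|split]); auto.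
intros a c d e s.
refine (is_derive_Rcongr _ _ _ _ _ (fun _ => eq_refl) _
   (is_derive_plus (V:=R_NormedModule) _ _ _ _ _ (Hf a c d e s) (Hg a c d e s))).
unfold plus; simpl; ring.
Qed.

Lemma smooth2_mult n f g : smooth2 n f -> smooth2 n g ->
  smooth2 n (fun u v => f u v * g u v).
Proof.
revert f g; induction n as [|n IH]; intros f g Hf Hg;
 (split; [apply cont2_mult; eapply smooth2_cont; eassumption|]); [exact I|].
pose proof (smooth2_S _ _ Hf) as Hf'; pose proof (smooth2_S _ _ Hg) as Hg'.
destruct Hf as [_ [fu [fv [Hfu [Hfv Hf]]]]], Hg as [_ [gu [gv [Hgu [Hgv Hg]]]]].
exists (fun u v => fu u v * g u v + f u v * gu u v),
  (fun u v => fv u v * g u v + f u v * gv u v).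
split; [|split]; [apply smooth2_plus; auto|apply smooth2_plus; auto|].
intros a c d e s.
refine (is_derive_Rcongr _ _ _ _ _ (fun _ => eq_refl) _
   (is_derive_mult (K:=R_AbsRing) _ _ _ _ _ (Hf a c d e s) (Hg a c d e s) Rmult_comm)).
unfold plus, mult; simpl; ring.
Qed.

Lemma is_derive_affine a c s : is_derive (fun s => a + c * s) s c.
Proof. auto_derive; trivial; ring. Qed.

Lemma smooth2_of_sum n g : smooth1 n g -> smooth2 n (fun u v => g (u + v)).
Proof.
revert g; induction n as [|n IH]; intros g Hg;
 (split; [pose proof (smooth1_cont _ _ Hg) as Hc; cont2_tac|]); [exact I|].
destruct Hg as [_ [dg [Hdg Hg]]].
exists (fun u v => dg (u + v)), (fun u v => dg (u + v)); (split; [|split]); auto.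
intros a c d e s.
refine (is_derive_Rcongr _ _ _ _ _ (fun _ => eq_refl) _
   (is_derive_comp (K:=R_AbsRing) (V:=R_NormedModule) g
     (fun s => a + c * s + (d + e * s)) s _ (c + e) (Hg _) _)).
- unfold scal; simpl; unfold mult; simpl; ring.
- auto_derive; trivial; ring.
Qed.

Lemma smooth2_of_fst n g : smooth1 n g -> smooth2 n (fun u v => g u).
Proof.
revert g; induction n as [|n IH]; intros g Hg;
 (split; [pose proof (smooth1_cont _ _ Hg) as Hc; cont2_tac|]); [exact I|].
destruct Hg as [_ [dg [Hdg Hg]]].
exists (fun u v => dg u), (fun u v => 0); (split; [|split]); auto using smooth2_const.
intros a c d e s.
refine (is_derive_Rcongr _ _ _ _ _ (fun _ => eq_refl) _
   (is_derive_comp (K:=R_AbsRing) (V:=R_NormedModule) g (fun s => a + c * s) s _ c (Hg _)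
     (is_derive_affine a c s))).
unfold scal; simpl; unfold mult; simpl; ring.
Qed.

Lemma smooth2_swap n h : smooth2 n h -> smooth2 n (fun u v => h v u).
Proof.
revert h; induction n as [|n IH]; intros h Hh;
 (split; [pose proof (smooth2_cont _ _ Hh) as Hc; cont2_tac|]); [exact I|].
destruct Hh as [_ [hu [hv [Hu [Hv Hh]]]]].
exists (fun u v => hv v u), (fun u v => hu v u); (split; [|split]); auto.
intros a c d e s.
refine (is_derive_Rcongr _ _ _ _ _ (fun _ => eq_refl) _ (Hh d e a c s)). ring.
Qed.

Definition int_snd (h : R -> R -> R) (u v : R) : R := RInt (fun s => h u s) 0 v.
Definition int_fst (h : R -> R -> R) (u v : R) : R := RInt (fun s => h s v) 0 u.
(** The solution operator of the Goursat problem H_uv = h with zero data on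
    the axes. *)
Definition goursat (h : R -> R -> R) (u v : R) : R := RInt (fun s => int_snd h s v) 0 u.

(** Differentiating under the integral sign produces [int_snd] of a partial
    derivative, and the moving endpoint produces h itself. *)
Lemma smooth2_int_snd n h : smooth2 n h -> smooth2 n (int_snd h).
Proof.
revert h; induction n as [|n IH]; intros h Hh;
 (split; [apply cont2_RInt; eapply smooth2_cont; eassumption|]); [exact I|].
pose proof (smooth2_S _ _ Hh) as Hh'.
destruct Hh as [Hc [hu [hv [Hu [Hv Hh]]]]]. pose proof (smooth2_cont _ _ Hu) as Huc.
exists (int_snd hu), h; (split; [|split]); auto.
intros a c d e s.
refine (is_derive_Rcongr _ _ _ _ _ (fun _ => eq_refl) _
  (is_derive_RInt_leibniz (fun t s => h (a + c * t) s) (fun t s => c * hu (a + c * t) s)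
     (fun _ => 0) (fun t => d + e * t) s 0 e _ _ _ _ (is_derive_affine d e s))).
- rewrite (RInt_Rscal (fun r => hu (a + c * s) r)) by now apply ex_RInt_cont2_r.
  unfold int_snd; cbv beta; ring.
- intros t r.
  refine (is_derive_Rcongr _ _ _ _ _ _ _ (Hh a c r 0 t)).
  + intros; simpl; f_equal; ring.
  + replace (r + 0 * t) with r by ring; ring.
- cont2_tac.
- cont2_tac.
- apply (is_derive_const (V:=R_NormedModule)).
Qed.

Lemma smooth2_int_fst n h : smooth2 n h -> smooth2 n (int_fst h).
Proof.
intros Hh. apply (smooth2_swap n (int_snd (fun u v => h v u))).
now apply smooth2_int_snd, smooth2_swap.
Qed.

Lemma cont2_int_snd h : cont2 h -> cont2 (int_snd h).
Proof. intros Hh; apply (smooth2_cont 0), smooth2_int_snd; now split. Qed.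
Lemma cont2_int_fst h : cont2 h -> cont2 (int_fst h).
Proof. intros Hh; apply (smooth2_cont 0), smooth2_int_fst; now split. Qed.

(** The partial derivatives of [goursat h] are [int_snd h] and [int_fst h]: in
    neither is h differentiated. *)
Lemma is_derive_goursat_curve (h : R -> R -> R) (a c : R -> R) t da dc : cont2 h ->
  is_derive a t da -> is_derive c t dc ->
  (forall t, continuous c t) -> (forall t, ex_derive c t) ->
    (forall t, continuous (Derive c) t) ->
  is_derive (fun t => goursat h (a t) (c t)) t
    (da * int_snd h (a t) (c t) + dc * int_fst h (a t) (c t)).
Proof.
intros Hh Ha Hc C1 C2 C3.
pose proof (cont2_int_snd h Hh) as Hs.
refine (is_derive_Rcongr _ _ _ _ _ (fun _ => eq_refl) _
  (is_derive_RInt_leibniz (fun t s => int_snd h s (c t)) (fun t s => Derive c t * h s (c t))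
     (fun _ => 0) a t 0 da _ _ _ _ Ha)).
- rewrite (RInt_Rscal (fun s => h s (c t))).
  + rewrite (is_derive_unique _ _ _ Hc). unfold int_fst; cbv beta; ring.
  + apply (ex_RInt_cont2_r (fun v s => h s v)). cont2_tac.
- intros t' s. unfold int_snd.
  refine (is_derive_Rcongr _ _ _ _ _ (fun _ => eq_refl) _
   (is_derive_comp (K:=R_AbsRing) (V:=R_NormedModule)
     (fun v => RInt (fun r => h s r) 0 v) c t'
      _ (Derive c t') (is_derive_RInt_upper (fun r => h s r) 0 (c t') _) _)).
  + reflexivity.
  + intros x; apply (cont2_comp h (fun _ => s) (fun r => r));
      [auto|apply continuous_const|apply continuous_id].
  + apply Derive_correct; auto.
- cont2_tac.
- cont2_tac.
- apply (is_derive_const (V:=R_NormedModule)).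
Qed.

(** One degree of smoothness is gained, as the partial derivatives are the
    single integrals of h, which are as smooth as h. *)
Lemma smooth2_goursat n h : smooth2 n h -> smooth2 (S n) (goursat h).
Proof.
intros Hh. pose proof (smooth2_cont _ _ Hh) as Hc. split.
- pose proof (cont2_int_snd h Hc) as Hs.
  apply cont2_ext with (fun u v => int_snd (fun v s => int_snd h s v) v u); [reflexivity|].
  assert (cont2 (int_snd (fun v s => int_snd h s v))) by (apply cont2_int_snd; cont2_tac).
  cont2_tac.
- exists (int_snd h), (int_fst h); split; [|split].
  + now apply smooth2_int_snd.
  + now apply smooth2_int_fst.
  + intros a c d e s.
    apply (is_derive_goursat_curve h (fun s => a + c * s) (fun s => d + e * s)); auto.
    * apply is_derive_affine.
    * apply is_derive_affine.
    * intros t; apply derive_continuous with e, is_derive_affine.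
    * intros t; eexists; apply is_derive_affine.
    * intros t; apply continuous_Rext with (fun _ => e); [|apply continuous_const].
      intros r; symmetry; apply is_derive_unique, is_derive_affine.
Qed.

(** * Complex-valued functions and one-sided derivatives *)

(** Derivatives and continuity of complex-valued functions are handled through
    components, so that the real theorems on parametric integrals apply. *)
Definition derC (g : R -> C) (x : R) (l : C) : Prop :=
  is_derive (fun s => Re (g s)) x (Re l) /\ is_derive (fun s => Im (g s)) x (Im l).

Definition contC (g : R -> C) : Prop :=
  (forall x, continuous (fun s => Re (g s)) x) /\
  (forall x, continuous (fun s => Im (g s)) x).

Lemma within_lim (D : R -> Prop) x : is_filter_lim (within D (locally x)) x.
Proof. intros P HP; unfold within; apply filter_imp with (2 := HP); auto. Qed.

Lemma filterdiff_components (F : (R -> Prop) -> Prop) (g : R -> C) (l : C) : Filter F ->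
  @filterdiff R_AbsRing R_NormedModule C_R_NormedModule g F
     (fun y : R => @scal R_AbsRing C_R_NormedModule y l) <->
  (filterdiff (fun s => Re (g s)) F (fun y => scal y (Re l)) /\
   filterdiff (fun s => Im (g s)) F (fun y => scal y (Im l))).
Proof.
intros FF; split.
- intros H; split.
  + apply (filterdiff_comp g fst _ fst H). apply filterdiff_linear, is_linear_fst.
  + apply (filterdiff_comp g snd _ snd H). apply filterdiff_linear, is_linear_snd.
- intros [H1 H2].
  apply (filterdiff_ext_lin (U := R_NormedModule) (V := C_R_NormedModule) g
    (fun y : R => (scal y (Re l), scal y (Im l)))).
  + apply (filterdiff_ext (U := R_NormedModule) (V := C_R_NormedModule)
      (fun s => (Re (g s), Im (g s)))).
    { intros y; now destruct (g y). }
    refine (filterdiff_comp_2 (W := C_R_NormedModule) _ _ (fun a c : R => (a, c)) _ _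
      (fun a c : R => (a, c)) H1 H2 _).
    apply (filterdiff_linear (U :=
      prod_NormedModule R_AbsRing R_NormedModule R_NormedModule)
      (V := C_R_NormedModule) (fun t => (fst t, snd t))).
    apply (is_linear_prod (V := R_NormedModule)); [apply is_linear_fst|apply is_linear_snd].
  + intros y; reflexivity.
Qed.

Lemma is_derive_in_of_derC (D : R -> Prop) (g : R -> C) (x : R) (l : C) :
  D x -> derC g x l -> is_derive_in D g x l.
Proof.
intros Dx H. unfold is_derive_in.
assert (PF : ProperFilter (within D (locally x))).
{ split; [|apply within_filter, locally_filter].
  intros P HP; exists x. apply (locally_singleton _ _ HP Dx). }
apply (filterdiff_locally (F := within D (locally x)) g x _ (within_lim D x)).
apply (filterdiff_components (locally x)); [apply locally_filter|exact H].
Qed.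

Lemma derC_of_is_derive_in (D : R -> Prop) (g : R -> C) (x : R) (l : C) :
  locally x D -> is_derive_in D g x l -> derC g x l.
Proof.
intros Dx H. apply (filterdiff_components (locally x)); [apply locally_filter|].
destruct H as [Hl H]; split; [exact Hl|]. intros z Hz eps.
assert (Hz' : is_filter_lim (within D (locally x)) z).
{ intros P HP; unfold within; apply filter_imp with (2 := Hz P HP); auto. }
specialize (H z Hz' eps). unfold within in H.
apply filter_imp with (2 := filter_and _ _ H Dx). tauto.
Qed.

Lemma is_derive_in_continuous (D : R -> Prop) (g : R -> C) (x : R) (l : C) :
  is_derive_in D g x l ->
  filterlim g (within D (locally x)) (@locally C_UniformSpace (g x)).
Proof.
intros H.
apply (filterdiff_continuous_aux (F := within D (locally x)) g).
- eexists; exact H.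
- apply within_lim.
Qed.

Lemma continuous_retract {T U V : UniformSpace} (D : U -> Prop) (f : U -> V) (r : T -> U)
  (x : T) :
  continuous_on D f -> (forall y, D (r y)) -> continuous r x ->
  continuous (fun y => f (r y)) x.
Proof.
intros Hf HD Hr. unfold continuous.
apply filterlim_comp with (2 := Hf (r x) (HD x)).
intros P HP. unfold within in HP. specialize (Hr _ HP).
unfold filtermap in *. apply filter_imp with (2 := Hr). intros y Hy; apply Hy, HD.
Qed.

Lemma continuous_Re {T : UniformSpace} (g : T -> C) x :
  @continuous T C_UniformSpace g x -> continuous (fun s => Re (g s)) x.
Proof.
intros H; apply (continuous_comp (V := C_UniformSpace) g fst x H).
destruct (g x); apply (continuous_fst (U := R_UniformSpace) (V := R_UniformSpace)).
Qed.

Lemma continuous_Im {T : UniformSpace} (g : T -> C) x :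
  @continuous T C_UniformSpace g x -> continuous (fun s => Im (g s)) x.
Proof.
intros H; apply (continuous_comp (V := C_UniformSpace) g snd x H).
destruct (g x); apply (continuous_snd (U := R_UniformSpace) (V := R_UniformSpace)).
Qed.

Definition clamp (a c x : R) : R := Rmax a (Rmin c x).

Lemma clamp_in a c x : a <= c -> a <= clamp a c x <= c.
Proof.
intros H; unfold clamp, Rmax, Rmin; destruct (Rle_dec c x), (Rle_dec a _); lra.
Qed.

Lemma clamp_id a c x : a <= x <= c -> clamp a c x = x.
Proof.
intros H; unfold clamp, Rmax, Rmin; destruct (Rle_dec c x), (Rle_dec a _); lra.
Qed.

Lemma continuous_Rmax_comp {T : UniformSpace} (f g : T -> R) x :
  continuous f x -> continuous g x -> continuous (fun s => Rmax (f s) (g s)) x.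
Proof.
intros Hf Hg.
apply (continuous_ext (fun s => / 2 * ((f s + g s) + Rabs (f s - g s)))).
{ intros s; unfold Rmax, Rabs; destruct (Rle_dec (f s) (g s)), (Rcase_abs (f s - g s));
    simpl; lra. }
apply (continuous_scal_r (V := R_NormedModule) (/ 2)
  (fun s => (f s + g s) + Rabs (f s - g s))).
apply (continuous_plus (V := R_NormedModule)).
- now apply (continuous_plus (V := R_NormedModule)).
- apply (continuous_comp (fun s => f s - g s) Rabs).
  + now apply (continuous_minus (V := R_NormedModule)).
  + apply continuous_Rabs.
Qed.

Lemma continuous_Rmin_comp {T : UniformSpace} (f g : T -> R) x :
  continuous f x -> continuous g x -> continuous (fun s => Rmin (f s) (g s)) x.
Proof.
intros Hf Hg.
apply (continuous_ext (fun s => - Rmax (- f s) (- g s))).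
{ intros s; unfold Rmax, Rmin; destruct (Rle_dec (- f s) (- g s)), (Rle_dec (f s) (g s));
    simpl; lra. }
apply (continuous_opp (V := R_NormedModule)).
apply continuous_Rmax_comp; now apply (continuous_opp (V := R_NormedModule)).
Qed.

Lemma continuous_clamp {T : UniformSpace} (a c g : T -> R) x :
  continuous a x -> continuous c x -> continuous g x ->
  continuous (fun s => clamp (a s) (c s) (g s)) x.
Proof. intros; apply continuous_Rmax_comp; [|apply continuous_Rmin_comp]; auto. Qed.

Lemma contC_clamp a c (g : R -> C) : a <= c ->
  @continuous_on R_UniformSpace C_UniformSpace (segment a c) g ->
  contC (fun x => g (clamp a c x)).
Proof.
intros Hac Hg.
assert (H : forall x, @continuous R_UniformSpace C_UniformSpace
  (fun x => g (clamp a c x)) x).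
{ intros x; apply (continuous_retract (segment a c) g (clamp a c)); auto.
  - intros y; now apply clamp_in.
  - apply (continuous_clamp (fun _ => a) (fun _ => c) (fun x => x));
      [apply continuous_const|apply continuous_const|apply continuous_id]. }
split; intros x; [apply continuous_Re|apply continuous_Im]; auto.
Qed.

Lemma locally_segment a c x : a < x < c -> locally x (segment a c).
Proof.
intros H. apply (locally_interval _ x (Finite a) (Finite c)); simpl; try tauto.
intros y H1 H2; split; simpl in *; lra.
Qed.

Lemma derC_clamp a c (g : R -> C) x l : a < x < c ->
  is_derive_in (segment a c) g x l -> derC (fun x => g (clamp a c x)) x l.
Proof.
intros Hx Hg. pose proof (locally_segment a c x Hx) as L.
destruct (derC_of_is_derive_in _ _ _ _ L Hg) as [H1 H2].
split; [refine (is_derive_ext_loc _ _ _ _ _ H1)|refine (is_derive_ext_loc _ _ _ _ _ H2)];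
  (apply filter_imp with (2 := L); intros y Hy; now rewrite clamp_id).
Qed.

Lemma C_ext (z w : C) : Re z = Re w -> Im z = Im w -> z = w.
Proof. destruct z, w; simpl; intros -> ->; reflexivity. Qed.

Lemma CInt_pair (f g : R -> R) a c : ex_RInt f a c -> ex_RInt g a c ->
  CInt (fun s => (f s, g s)) a c = (RInt f a c, RInt g a c).
Proof.
intros Hf Hg; apply (is_RInt_unique (V := C_R_CompleteNormedModule)).
apply (is_RInt_fct_extend_pair (U := R_NormedModule) (V := R_NormedModule));
  now apply (RInt_correct (V := R_CompleteNormedModule)).
Qed.

Lemma CInt_ext (f g : R -> C) a c : (forall x, Rmin a c < x < Rmax a c -> f x = g x) ->
  CInt f a c = CInt g a c.
Proof. apply (RInt_ext (V := C_R_CompleteNormedModule)). Qed.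

Lemma CInt_components (g : R -> C) a c : contC g ->
  CInt g a c = (RInt (fun s => Re (g s)) a c, RInt (fun s => Im (g s)) a c).
Proof.
intros [H1 H2].
rewrite <- CInt_pair by (apply ex_RInt_cont; auto).
apply CInt_ext; intros; now destruct (g x).
Qed.

(** * Extension of the potential to the line *)

Lemma smooth1_primitive n g a : smooth1 n g -> smooth1 (S n) (fun x => a + RInt g 0 x).
Proof.
intros Hg. pose proof (smooth1_cont _ _ Hg) as Hc.
assert (Hd : forall x, is_derive (fun x => a + RInt g 0 x) x (g x)).
{ intros x; refine (is_derive_Rcongr _ _ _ _ _ (fun _ => eq_refl) _
    (is_derive_plus (V := R_NormedModule) (fun _ => a) (fun x => RInt g 0 x) x 0 (g x)
       (is_derive_const (V := R_NormedModule) _ _) (is_derive_RInt_upper g 0 x Hc))).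
  unfold plus; simpl; ring. }
split; [|exists g; auto].
intros x; eapply derive_continuous, Hd.
Qed.

Lemma smooth1_scal n c g : smooth1 n g -> smooth1 n (fun x => c * g x).
Proof.
revert g; induction n as [|n IH]; intros g Hg;
  (split; [pose proof (smooth1_cont _ _ Hg) as Hc; intros x; rcont|]); [exact I|].
destruct Hg as [_ [dg [H1 H2]]].
exists (fun x => c * dg x); split; [auto|].
intros x; apply (is_derive_scal g x c (dg x)), H2.
Qed.

(** The highest derivative is extended by constants, and the lower ones by
    integration; thus no matching at the endpoints has to be checked. *)
Lemma Cn_extension (n : nat) (b : R) (g : R -> C) : 0 <= b -> is_Cn n (segment 0 b) g ->
  exists g1 g2 : R -> R, smooth1 n g1 /\ smooth1 n g2 /\
    forall x, 0 <= x <= b -> g x = (g1 x, g2 x).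
Proof.
intros Hb; revert g; induction n as [|n IH]; intros g [G [G0 [GS Gc]]].
- destruct (contC_clamp 0 b (G 0%nat) Hb (Gc 0%nat (Nat.le_refl _))) as [C1 C2].
  exists (fun x => Re (G 0%nat (clamp 0 b x))), (fun x => Im (G 0%nat (clamp 0 b x))).
  split; [|split]; [split; auto|split; auto|].
  intros x Hx; rewrite clamp_id, <- (G0 x) by exact Hx. now destruct (G 0%nat x).
- destruct (IH (G 1%nat)) as [g1 [g2 [S1 [S2 E]]]].
  { exists (fun k => G (S k)); split; [auto|split].
    - intros k x Hk; apply GS; lia.
    - intros k Hk; apply Gc; lia. }
  exists (fun x => Re (G 0%nat 0) + RInt g1 0 x), (fun x => Im (G 0%nat 0) + RInt g2 0 x).
  split; [|split]; [now apply smooth1_primitive|now apply smooth1_primitive|].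
  destruct (contC_clamp 0 b (G 0%nat) Hb (Gc 0%nat (Nat.le_0_l _))) as [C1 C2].
  intros x Hx; rewrite <- (G0 x) by exact Hx.
  assert (D : forall y, 0 < y < x -> derC (fun x => G 0%nat (clamp 0 b x)) y (g1 y, g2 y)).
  { intros y Hy; rewrite <- E by lra. apply derC_clamp; [lra|].
    apply GS; [lia|unfold segment; lra]. }
  apply C_ext; simpl.
  + rewrite (RInt_derive_interior (fun x => Re (G 0%nat (clamp 0 b x))) g1 0 x);
      [rewrite !clamp_id by lra; ring|lra|auto|now apply (smooth1_cont n)|].
    intros y Hy; apply (D y Hy).
  + rewrite (RInt_derive_interior (fun x => Im (G 0%nat (clamp 0 b x))) g2 0 x);
      [rewrite !clamp_id by lra; ring|lra|auto|now apply (smooth1_cont n)|].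
    intros y Hy; apply (D y Hy).
Qed.

(** * Extension of the kernel to the plane *)

(** The kernel is composed with a continuous retraction of the plane onto the
    triangle. *)
Lemma kernel_clamp b K : 0 <= b -> continuous_triangle b K ->
  exists h1 h2 : R -> R -> R, cont2 h1 /\ cont2 h2 /\
    forall x t, Defs.triangle b (x, t) -> K x t = (h1 x t, h2 x t).
Proof.
intros Hb HK.
set (r1 := fun z : R * R => clamp 0 b (fst z)).
set (r2 := fun z : R * R => clamp (- r1 z) (r1 z) (snd z)).
assert (H1 : forall z, continuous r1 z).
{ intros [x t]. apply (continuous_clamp
    (T := prod_UniformSpace R_UniformSpace R_UniformSpace)
    (fun _ => 0) (fun _ => b) fst); try apply continuous_const. apply continuous_fst. }
assert (H2 : forall z, continuous r2 z).
{ intros [x t]. apply (continuous_clamp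
    (T := prod_UniformSpace R_UniformSpace R_UniformSpace)
    (fun z => - r1 z) r1 snd); [|apply H1|apply continuous_snd].
  apply (continuous_opp (V := R_NormedModule)), H1. }
set (r := fun z : R * R => (r1 z, r2 z)).
assert (HD : forall z, Defs.triangle b (r z)).
{ intros z. pose proof (clamp_in 0 b (fst z) Hb) as B1. fold (r1 z) in B1.
  assert (B2 : - r1 z <= r2 z <= r1 z) by (apply clamp_in; lra).
  split; [exact B1|]. now apply Rabs_le. }
assert (HC : forall z, @continuous
  (prod_UniformSpace R_UniformSpace R_UniformSpace) C_UniformSpace
   (fun z => K (fst (r z)) (snd (r z))) z).
{ intros z; apply (continuous_retract (Defs.triangle b) (fun z => K (fst z) (snd z)) r);
    auto.
  apply (continuous_comp_2 r1 r2 (fun x t : R => (x, t)) z (H1 z) (H2 z)).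
  apply (continuous_ext (fun x => x)); [now intros []|apply continuous_id]. }
exists (fun x t => Re (K (r1 (x, t)) (r2 (x, t)))),
  (fun x t => Im (K (r1 (x, t)) (r2 (x, t)))).
split; [|split].
- intros x t; apply continuity_2d_pt_filterlim.
  apply filterlim_ext with (f := fun z : R * R => Re (K (fst (r z)) (snd (r z))));
    [now intros []|exact (continuous_Re _ _ (HC (x, t)))].
- intros x t; apply continuity_2d_pt_filterlim.
  apply filterlim_ext with (f := fun z : R * R => Im (K (fst (r z)) (snd (r z))));
    [now intros []|exact (continuous_Im _ _ (HC (x, t)))].
- intros x t [Hx Ht]; simpl in Hx, Ht. apply Rabs_le_between in Ht.
  unfold r2, r1; simpl. rewrite (clamp_id 0 b x Hx), clamp_id by exact Ht.
  now destruct (K x t).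
Qed.

(** * The kernel in characteristic coordinates *)

(** The pair (h1, h2) gives the real and imaginary parts of K in the variables
    u = (x+t)/2, v = (x-t)/2, on the image u, v >= 0, u + v <= b of the
    triangle. *)
Definition agrees (b : R) (K : R -> R -> C) (h1 h2 : R -> R -> R) : Prop :=
  forall u v, 0 <= u -> 0 <= v -> u + v <= b -> K (u + v) (u - v) = (h1 u v, h2 u v).

(** The real part of q(u + v) H(u, v); the difference is written as a sum
    because [smooth2] is closed under sums and products. *)
Definition prod_re (q1 q2 : R -> R) (h1 h2 : R -> R -> R) (u v : R) : R :=
  q1 (u + v) * h1 u v + -1 * (q2 (u + v) * h2 u v).
Definition prod_im (q1 q2 : R -> R) (h1 h2 : R -> R -> R) (u v : R) : R :=
  q1 (u + v) * h2 u v + q2 (u + v) * h1 u v.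

(** For (u, v) in the image of the triangle the whole rectangle [0, u] x [0,
    v] lies in it, so the integral equation only involves values where h1, h2
    agree with the kernel. The right-hand side, however, makes sense in the
    whole plane. *)
Lemma kernel_step b q h K (q1 q2 : R -> R) (h1 h2 : R -> R -> R) :
  is_transmutation_kernel b q h K ->
  (forall x, continuous q1 x) -> (forall x, continuous q2 x) ->
  (forall x, 0 <= x <= b -> q x = (q1 x, q2 x)) ->
  cont2 h1 -> cont2 h2 -> agrees b K h1 h2 ->
  agrees b K
    (fun u v => (Re h / 2 + RInt (fun s => / 2 * q1 s) 0 u)
      + goursat (prod_re q1 q2 h1 h2) u v)
    (fun u v => (Im h / 2 + RInt (fun s => / 2 * q2 s) 0 u)
      + goursat (prod_im q1 q2 h1 h2) u v).
Proof.
intros [_ HK] Q1 Q2 Hq H1 H2 Ha u v Hu Hv Huv.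
assert (P1 : cont2 (prod_re q1 q2 h1 h2)) by (unfold prod_re; cont2_tac).
assert (P2 : cont2 (prod_im q1 q2 h1 h2)) by (unfold prod_im; cont2_tac).
rewrite HK.
2:{ split; simpl; [lra|]. apply Rabs_le; lra. }
replace ((u + v + (u - v)) / 2) with u by field.
replace ((u + v - (u - v)) / 2) with v by field.
rewrite (CInt_ext q (fun s => (q1 s, q2 s)) 0 u).
2:{ rewrite Rmin_left, Rmax_right by lra. intros x Hx; apply Hq; lra. }
rewrite CInt_pair by (apply ex_RInt_cont; auto).
rewrite (CInt_ext _ (fun a =>
  (int_snd (prod_re q1 q2 h1 h2) a v, int_snd (prod_im q1 q2 h1 h2) a v)) 0 u).
2:{ rewrite Rmin_left, Rmax_right by lra. intros a Hx.
    rewrite (CInt_ext _ (fun s => (prod_re q1 q2 h1 h2 a s, prod_im q1 q2 h1 h2 a s)) 0 v).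
    { rewrite CInt_pair by now apply ex_RInt_cont2_r. reflexivity. }
    rewrite Rmin_left, Rmax_right by lra. intros s Hs.
    rewrite Hq, Ha by lra. unfold prod_re, prod_im. apply C_ext; simpl; ring. }
pose proof (cont2_int_snd _ P1) as I1; pose proof (cont2_int_snd _ P2) as I2.
rewrite CInt_pair.
2:{ apply (ex_RInt_cont2_r (fun v u => int_snd (prod_re q1 q2 h1 h2) u v)); cont2_tac. }
2:{ apply (ex_RInt_cont2_r (fun v u => int_snd (prod_im q1 q2 h1 h2) u v)); cont2_tac. }
rewrite !RInt_Rscal by (apply ex_RInt_cont; auto).
apply C_ext; unfold goursat, Re, Im; simpl; field.
Qed.

(** Bootstrap: by [smooth2_goursat] each application of [kernel_step] yields
    an extension of K that is one degree smoother, as long as q allows. Each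
    step may change the extension off the triangle, which is harmless. *)
Lemma kernel_smooth b q h K (q1 q2 : R -> R) p n : 0 <= b ->
  is_transmutation_kernel b q h K -> smooth1 p q1 -> smooth1 p q2 ->
  (forall x, 0 <= x <= b -> q x = (q1 x, q2 x)) -> (n <= S p)%nat ->
  exists h1 h2, smooth2 n h1 /\ smooth2 n h2 /\ agrees b K h1 h2.
Proof.
intros Hb HK S1 S2 Hq; induction n as [|n IH]; intros Hn.
- destruct (kernel_clamp b K Hb (proj1 HK)) as [h1 [h2 [C1 [C2 E]]]].
  exists (fun u v => h1 (u + v) (u - v)), (fun u v => h2 (u + v) (u - v)).
  split; [|split]; [split; [cont2_tac|exact I]|split; [cont2_tac|exact I]|].
  intros u v Hu Hv Huv; apply E. split; simpl; [lra|apply Rabs_le; lra].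
- destruct (IH ltac:(lia)) as [h1 [h2 [C1 [C2 E]]]].
  assert (T1 : smooth1 n q1) by (apply (smooth1_le n p); [lia|exact S1]).
  assert (T2 : smooth1 n q2) by (apply (smooth1_le n p); [lia|exact S2]).
  pose proof (smooth1_cont _ _ T1) as D1; pose proof (smooth1_cont _ _ T2) as D2.
  pose proof (kernel_step b q h K q1 q2 h1 h2 HK D1 D2 Hq (smooth2_cont _ _ C1)
     (smooth2_cont _ _ C2) E) as A.
  eexists; eexists; split; [|split; [|exact A]]; apply smooth2_plus.
  + apply (smooth2_of_fst (S n) (fun u => Re h / 2 + RInt (fun s => / 2 * q1 s) 0 u)).
    now apply smooth1_primitive, smooth1_scal.
  + apply smooth2_goursat, smooth2_plus; [|apply (smooth2_mult n (fun _ _ => -1));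
      [apply smooth2_const|]]; apply smooth2_mult; auto using smooth2_of_sum.
  + apply (smooth2_of_fst (S n) (fun u => Im h / 2 + RInt (fun s => / 2 * q2 s) 0 u)).
    now apply smooth1_primitive, smooth1_scal.
  + apply smooth2_goursat, smooth2_plus; apply smooth2_mult; auto using smooth2_of_sum.
Qed.

(** * Derivatives of the kernel in t and the maximum of their modulus *)

(** Differentiation in t is differentiation along the direction (1/2, -1/2) in
    the plane of (u, v). *)
Lemma t_tower n h : smooth2 n h ->
  exists T : nat -> R -> R -> R,
    (forall x t, T 0%nat x t = h ((x + t) / 2) ((x - t) / 2)) /\
    (forall k, cont2 (T k)) /\
    (forall k x t, (k < n)%nat -> is_derive (fun t => T k x t) t (T (S k) x t)).
Proof.
assert (HC : forall h, cont2 h -> cont2 (fun x t => h ((x + t) / 2) ((x - t) / 2)))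
  by (intros; unfold Rdiv; cont2_tac).
revert h; induction n as [|n IH]; intros h Hh.
- exists (fun _ x t => h ((x + t) / 2) ((x - t) / 2)); split; [auto|split].
  + intros _; apply HC, (smooth2_cont _ _ Hh).
  + intros; lia.
- pose proof (smooth2_cont _ _ Hh) as Hc.
  destruct Hh as [_ [hu [hv [Hu [Hv Hd]]]]].
  destruct (IH (fun u v => / 2 * hu u v + - / 2 * hv u v)) as [T [T0 [TC TD]]].
  { apply smooth2_plus; apply (smooth2_mult n (fun _ _ => _)); auto using smooth2_const. }
  exists (fun k => match k with
    | O => fun x t => h ((x + t) / 2) ((x - t) / 2) | S k => T k end).
  split; [auto|split].
  + intros [|k]; auto.
  + intros [|k] x t Hk; [|apply TD; lia]. rewrite T0.
    refine (is_derive_Rcongr _ _ _ _ _ _ _ (Hd (x / 2) (/ 2) (x / 2) (- / 2) t)).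
    * intros s; simpl; f_equal; field.
    * simpl. replace (x / 2 + / 2 * t) with ((x + t) / 2) by field.
      replace (x / 2 + - / 2 * t) with ((x - t) / 2) by field. reflexivity.
Qed.

(** The maximum over y is a continuous function of x by uniform continuity,
    and the extreme value theorem on an interval is applied twice. The
    supremum serves to define that function without a choice of maximizers. *)
Lemma cont2_max (f : R -> R -> R) a b c d : a <= b -> c <= d -> cont2 f ->
  exists x0 y0, a <= x0 <= b /\ c <= y0 <= d /\
    forall x y, a <= x <= b -> c <= y <= d -> f x y <= f x0 y0.
Proof.
intros Hab Hcd Hf.
assert (HM : forall x, exists y0, c <= y0 <= d /\ forall y, c <= y <= d -> f x y <= f x y0).
{ intros x. destruct (continuity_ab_maj (fun y => f x y) c d Hcd) as [y0 [H1 H2]].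
  - intros y _; apply continuity_pt_filterlim.
    apply (cont2_comp f (fun _ => x) (fun s => s));
      [auto|apply continuous_const|apply continuous_id].
  - exists y0; auto. }
set (m := fun x => real (Lub_Rbar (fun z => exists y, c <= y <= d /\ z = f x y))).
assert (Hm : forall x y0, c <= y0 <= d -> (forall y, c <= y <= d -> f x y <= f x y0) ->
  m x = f x y0).
{ intros x y0 Hy0 H. unfold m.
  rewrite (is_lub_Rbar_unique _ (Finite (f x y0))); [reflexivity|split].
  - intros z [y [Hy ->]]; simpl; auto.
  - intros B HB; apply HB; eauto. }
assert (Hmc : forall x, a <= x <= b -> continuity_pt m x).
{ intros x Hx; apply continuity_pt_locally; intros eps.
  assert (e0 : 0 < eps / 2) by (pose proof (cond_pos eps); lra).
  destruct (uniform_continuity_2d f (a - 1) (b + 1) c d (fun x y _ _ => Hf x y)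
    (mkposreal _ e0))
    as [de Hde]; simpl in Hde.
  assert (d0 : 0 < Rmin de 1) by (apply Rmin_glb_lt; [apply cond_pos|lra]).
  exists (mkposreal _ d0); intros x' Hx'. change (Rabs (x' - x) < Rmin de 1) in Hx'.
  pose proof (Rmin_l de 1); pose proof (Rmin_r de 1).
  assert (R' : a - 1 <= x' <= b + 1) by (apply Rabs_lt_between' in Hx'; lra).
  destruct (HM x) as [y0 [Hy0 My0]]; destruct (HM x') as [y1 [Hy1 My1]].
  rewrite (Hm x y0), (Hm x' y1) by auto.
  assert (A0 : forall y, c <= y <= d -> Rabs (f x' y - f x y) < eps / 2).
  { intros y Hy; apply Hde; try lra. rewrite Rminus_eq_0, Rabs_R0; apply cond_pos. }
  pose proof (A0 y0 Hy0) as B0; pose proof (A0 y1 Hy1) as B1.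
  apply Rabs_def2 in B0; apply Rabs_def2 in B1.
  specialize (My0 y1 Hy1); specialize (My1 y0 Hy0). apply Rabs_def1; lra. }
destruct (continuity_ab_maj m a b Hab Hmc) as [x0 [H1 H2]].
destruct (HM x0) as [y0 [Hy0 My0]].
exists x0, y0; split; [exact H2|split; [exact Hy0|]].
intros x y Hx Hy. destruct (HM x) as [y1 [Hy1 My1]].
apply Rle_trans with (1 := My1 y Hy). rewrite <- (Hm x y1), <- (Hm x0 y0) by auto. auto.
Qed.

(** The triangle is the image of a rectangle under (x, y) |-> (x, x y). *)
Lemma max_norm_exists b (T1 T2 : R -> R -> R) : 0 <= b -> cont2 T1 -> cont2 T2 ->
  exists M, is_max_norm b (fun x t => (T1 x t, T2 x t)) M.
Proof.
intros Hb H1 H2.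
destruct (cont2_max (fun x y => Cmod (T1 x (x * y), T2 x (x * y))) 0 b (-1) 1)
  as [x0 [y0 [Hx0 [Hy0 HM]]]];
  [lra|lra| |].
{ unfold Cmod; simpl.
  apply (cont2_1 sqrt (fun x y => T1 x (x * y) * (T1 x (x * y) * 1)
    + T2 x (x * y) * (T2 x (x * y) * 1))).
  - intros z; apply continuous_sqrt.
  - cont2_tac. }
exists (Cmod (T1 x0 (x0 * y0), T2 x0 (x0 * y0))); split.
- exists x0, (x0 * y0); split; [|reflexivity]. split; simpl; [lra|].
  rewrite Rabs_mult, (Rabs_pos_eq x0) by lra.
  assert (Rabs y0 <= 1) by (apply Rabs_le; lra). nra.
- intros x t [Hx Ht]; simpl in Hx, Ht.
  destruct (Req_dec x 0) as [->|Hx0'].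
  + assert (t = 0) by (destruct (Req_dec t 0); auto; pose proof (Rabs_pos_lt t H); lra).
    subst t. replace 0 with (0 * 0) at 2 4 by ring. apply (HM 0 0); lra.
  + replace t with (x * (t / x)) by (field; auto). apply HM; [lra|].
    assert (0 < x) by lra. apply Rabs_le_between in Ht.
    split; [apply (Rmult_le_reg_l x)|apply (Rmult_le_reg_l x)]; try lra;
      replace (x * (t / x)) with t by (field; auto); lra.
Qed.

Lemma continuous_triangle_pair b (T1 T2 : R -> R -> R) : cont2 T1 -> cont2 T2 ->
  continuous_triangle b (fun x t => (T1 x t, T2 x t)).
Proof.
intros H1 H2. apply continuous_on_forall; intros [x t] _.
apply (continuous_comp_2 (W := R_UniformSpace) (X := C_UniformSpace)
  (fun z : R * R => T1 (fst z) (snd z)) (fun z : R * R => T2 (fst z) (snd z))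
  (fun a c : R => (a, c))).
- apply continuity_2d_pt_filterlim, H1.
- apply continuity_2d_pt_filterlim, H2.
- apply (continuous_ext (fun z => z)); [now intros []|apply continuous_id].
Qed.

Lemma is_partial_t_tower b n (K : R -> R -> C) (T1 T2 : nat -> R -> R -> R) :
  (forall k, cont2 (T1 k)) -> (forall k, cont2 (T2 k)) ->
  (forall x t, Defs.triangle b (x, t) -> K x t = (T1 0%nat x t, T2 0%nat x t)) ->
  (forall k x t, (k < n)%nat -> is_derive (fun t => T1 k x t) t (T1 (S k) x t)) ->
  (forall k x t, (k < n)%nat -> is_derive (fun t => T2 k x t) t (T2 (S k) x t)) ->
  is_partial_t b n K (fun x t => (T1 n x t, T2 n x t)).
Proof.
intros C1 C2 E D1 D2. exists (fun k x t => (T1 k x t, T2 k x t)).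
split; [intros; symmetry; auto|split; [auto|split]].
- intros k _; now apply continuous_triangle_pair.
- intros k x t Hk Hx [_ Ht]; simpl in Ht.
  apply is_derive_in_of_derC; [now apply Rabs_le_between|].
  split; simpl; auto.
Qed.

(** * The transmutation operator on real components *)

Section Transmutation.
Variables (a da : R -> R) (f : R -> R -> R).
Hypothesis a_derive : forall x, is_derive a x (da x).
Hypothesis da_cont : forall x, continuous da x.
Hypothesis f_cont : cont2 f.

Let H (u v : R) : R := a u + goursat f u v.
Let Hu (u v : R) : R := da u + int_snd f u v.
Let Hv (u v : R) : R := int_fst f u v.

Lemma a_cont x : continuous a x.
Proof. eapply derive_continuous, a_derive. Qed.

Lemma cont2_goursat : cont2 (goursat f).
Proof. apply (smooth2_cont 1), smooth2_goursat; now split. Qed.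

Lemma cont2_Hu : cont2 Hu.
Proof. pose proof (cont2_int_snd f f_cont); unfold Hu; cont2_tac. Qed.
Lemma cont2_Hv : cont2 Hv.
Proof. apply cont2_int_fst, f_cont. Qed.
Lemma cont2_H : cont2 H.
Proof. pose proof cont2_goursat; pose proof a_cont; unfold H; cont2_tac. Qed.

Lemma int_snd_0 u : int_snd f u 0 = 0.
Proof. unfold int_snd; rewrite RInt_point; reflexivity. Qed.
Lemma int_fst_0 v : int_fst f 0 v = 0.
Proof. unfold int_fst; rewrite RInt_point; reflexivity. Qed.

Lemma goursat_0_r u : goursat f u 0 = 0.
Proof.
unfold goursat. rewrite (RInt_Rext _ (fun _ => 0)) by (intros; apply int_snd_0).
rewrite RInt_const. unfold scal; simpl; unfold mult; simpl; ring.
Qed.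

Lemma RInt_reflect (g : R -> R) x : (forall s, continuous g s) ->
  RInt (fun s => g (x - s)) 0 x = RInt g 0 x.
Proof.
intros Hg.
pose proof (RInt_comp_lin (V := R_CompleteNormedModule) g (-1) x x 0) as E.
replace (-1 * x + x) with 0 in E by ring. replace (-1 * 0 + x) with x in E by ring.
rewrite <- E by (apply ex_RInt_cont; auto).
rewrite <- (opp_RInt_swap (V := R_CompleteNormedModule) (fun s => g (x - s)) x 0).
2:{ apply ex_RInt_cont; intros s; apply (continuous_comp (fun s => x - s) g);
  [rcont|apply Hg]. }
rewrite (RInt_Rext (fun y => scal (-1) (g (-1 * y + x))) (fun y => -1 * g (x - y))).
2:{ intros y; change (-1 * g (-1 * y + x) = -1 * g (x - y)); f_equal; f_equal; ring. }
rewrite RInt_Rscal; [unfold opp; simpl; ring|].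
apply ex_RInt_cont; intros s; apply (continuous_comp (fun s => x - s) g); [rcont|apply Hg].
Qed.

Section Test_function.
Variables (w dw : R -> R).
Hypothesis w_derive : forall x, is_derive w x (dw x).
Hypothesis dw_cont : forall x, continuous dw x.

Lemma w_cont x : continuous w x.
Proof. eapply derive_continuous, w_derive. Qed.

Lemma is_derive_comp_affine (c d s : R) : is_derive (fun s => w (c * s + d)) s
  (c * dw (c * s + d)).
Proof.
refine (is_derive_Rcongr _ _ _ _ _ (fun _ => eq_refl) _
   (is_derive_comp (K:=R_AbsRing) (V:=R_NormedModule) w (fun s => c * s + d) s _ c
     (w_derive _) _)).
- reflexivity.
- auto_derive; trivial; ring.
Qed.

(** Along the line u + v = x the derivative of H is H_u - H_v, while dw is
    integrated to w. The last integral is reflected, s to x - s, so that x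
    enters H_v through its first argument: only that derivative of H_v exists
    when f is merely continuous. *)
Lemma int_by_parts x :
  2 * RInt (fun s => H s (x - s) * dw (2 * s - x)) 0 x =
    a x * w x - a 0 * w (- x)
    - RInt (fun s => Hu s (x - s) * w (2 * s - x)) 0 x
    + RInt (fun s => Hv (x - s) s * w (x - 2 * s)) 0 x.
Proof.
pose proof cont2_H as CH; pose proof cont2_Hu as CHu; pose proof cont2_Hv as CHv.
pose proof w_cont as Cw.
assert (X : forall g (v : R -> R), cont2 g -> (forall s, continuous v s) ->
  forall s, continuous (fun s => g s (x - s) * v (2 * s - x)) s).
{ intros g v Hg Hv' s; apply continuous_Rmult.
  - apply (cont2_comp g (fun s => s) (fun s => x - s)); auto; rcont.
  - apply (continuous_comp (fun s => 2 * s - x) v); [rcont|apply Hv']. }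
assert (E : RInt (fun s => Hu s (x - s) * w (2 * s - x) - Hv s (x - s) * w (2 * s - x)
                  + 2 * (H s (x - s) * dw (2 * s - x))) 0 x
            = H x (x - x) * w (2 * x - x) - H 0 (x - 0) * w (2 * 0 - x)).
{ apply (RInt_derive_all (fun s => H s (x - s) * w (2 * s - x))).
  - intros s. apply continuous_Rplus; [apply continuous_Rminus|
      apply continuous_Rmult; [apply continuous_const|]]; apply X; auto.
  - intros s.
    assert (D1 : is_derive (fun s => H s (x - s)) s (Hu s (x - s) - Hv s (x - s))).
    { assert (Dm : forall t, is_derive (fun s => x - s) t (-1))
        by (intros; auto_derive; trivial; ring).
      refine (is_derive_Rcongr _ _ _ _ _ (fun _ => eq_refl) _
        (is_derive_plus (V:=R_NormedModule) a (fun s => goursat f s (x - s)) s _ _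
          (a_derive s)
          (is_derive_goursat_curve f (fun s => s) (fun s => x - s) s 1 (-1) f_cont
             (is_derive_id s) (Dm s) _ _ _))).
      - unfold plus, Hu, Hv; simpl; ring.
      - intros t; rcont.
      - intros t; eexists; apply Dm.
      - intros t; apply continuous_Rext with (fun _ => -1); [|apply continuous_const].
        intros r; symmetry; apply is_derive_unique, Dm. }
    assert (D2 : is_derive (fun s => w (2 * s - x)) s (2 * dw (2 * s - x)))
      by apply (is_derive_comp_affine 2 (- x)).
    refine (is_derive_Rcongr _ _ _ _ _ (fun _ => eq_refl) _
       (is_derive_mult (K:=R_AbsRing) _ _ _ _ _ D1 D2 Rmult_comm)).
    unfold plus, mult; simpl; ring. }
rewrite RInt_Rplus in E.
2:{ apply ex_RInt_cont; intros s; apply continuous_Rminus; apply X; auto. }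
2:{ apply ex_RInt_cont; intros s; apply continuous_Rmult;
  [apply continuous_const|apply X; auto]. }
rewrite RInt_Rminus in E by (apply ex_RInt_cont; intros s; apply X; auto).
rewrite RInt_Rscal in E by (apply ex_RInt_cont; intros s; apply X; auto).
replace (x - x) with 0 in E by ring. replace (2 * x - x) with x in E by ring.
replace (2 * 0 - x) with (- x) in E by ring.
assert (H0 : H x 0 = a x) by (unfold H; rewrite goursat_0_r; ring).
assert (H1 : H 0 (x - 0) = a 0).
{ unfold H, goursat; rewrite RInt_point. unfold zero; simpl; ring. }
rewrite H0, H1 in E.
assert (E2 : RInt (fun s => Hv (x - s) s * w (x - 2 * s)) 0 x
   = RInt (fun s => Hv s (x - s) * w (2 * s - x)) 0 x).
{ rewrite <- (RInt_reflect (fun s => Hv s (x - s) * w (2 * s - x)))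
    by (intros; apply X; auto).
  apply RInt_Rext; intros s. f_equal; [f_equal; ring|f_equal; ring]. }
rewrite E2. lra.
Qed.

(** The first argument s of H_u stays fixed, and the derivative of H_u in the
    second one is f. *)
Lemma is_derive_int_Hu (x : R) :
  is_derive (fun x => RInt (fun s => Hu s (x - s) * w (2 * s - x)) 0 x) x
    (RInt (fun s => f s (x - s) * w (2 * s - x)) 0 x
     - RInt (fun s => Hu s (x - s) * dw (2 * s - x)) 0 x + da x * w x).
Proof.
pose proof cont2_Hu as CHu; pose proof w_cont as Cw.
refine (is_derive_Rcongr _ _ _ _ _ (fun _ => eq_refl) _
  (is_derive_RInt_leibniz (fun t s => Hu s (t - s) * w (2 * s - t))
     (fun t s => f s (t - s) * w (2 * s - t) - Hu s (t - s) * dw (2 * s - t))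
     (fun _ => 0) (fun t => t) x 0 1 _ _ _ (is_derive_const (V:=R_NormedModule) 0 x)
       (is_derive_id x))).
- rewrite RInt_Rminus.
  + replace (x - x) with 0 by ring. replace (2 * x - x) with x by ring.
    unfold Hu at 2; rewrite int_snd_0. ring.
  + apply (ex_RInt_cont2_r (fun t s => f s (t - s) * w (2 * s - t))); cont2_tac.
  + apply (ex_RInt_cont2_r (fun t s => Hu s (t - s) * dw (2 * s - t))); cont2_tac.
- intros t s. change R in t.
  assert (D1 : is_derive (fun t => Hu s (t - s)) t (f s (t - s))).
  { unfold Hu, int_snd.
    assert (Cf : forall r, continuous (fun r => f s r) r).
    { intros r; apply (cont2_comp f (fun _ => s) (fun r => r)); auto; rcont. }
    refine (is_derive_Rcongr _ _ _ _ _ (fun _ => eq_refl) _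
      (is_derive_plus (V:=R_NormedModule) (fun _ => da s)
        (fun t => RInt (fun r => f s r) 0 (t - s)) t 0 _
        (is_derive_const (V:=R_NormedModule) _ _)
        (is_derive_comp (K:=R_AbsRing) (V:=R_NormedModule)
          (fun v => RInt (fun r => f s r) 0 v)
           (fun t => t - s) t _ 1 (is_derive_RInt_upper (fun r => f s r) 0 (t - s) Cf) _))).
    - unfold plus, scal; simpl; unfold mult; simpl; ring.
    - auto_derive; trivial; ring. }
  assert (D2 : is_derive (fun t => w (2 * s - t)) t (- dw (2 * s - t))).
  { refine (is_derive_Rcongr _ _ _ _ _ _ _ (is_derive_comp_affine (-1) (2 * s) t)).
    - intros; f_equal; ring.
    - replace (-1 * t + 2 * s) with (2 * s - t) by ring; ring. }
  refine (is_derive_Rcongr _ _ _ _ _ (fun _ => eq_refl) _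
       (is_derive_mult (K:=R_AbsRing) _ _ _ _ _ D1 D2 Rmult_comm)).
  unfold plus, mult; simpl; ring.
- cont2_tac.
- cont2_tac.
Qed.

(** Here the second argument of H_v stays fixed; after reflection the same
    integral of f appears as in [is_derive_int_Hu]. *)
Lemma is_derive_int_Hv (x : R) :
  is_derive (fun x => RInt (fun s => Hv (x - s) s * w (x - 2 * s)) 0 x) x
    (RInt (fun s => f s (x - s) * w (2 * s - x)) 0 x
     + RInt (fun s => Hv (x - s) s * dw (x - 2 * s)) 0 x).
Proof.
pose proof cont2_Hv as CHv; pose proof w_cont as Cw.
refine (is_derive_Rcongr _ _ _ _ _ (fun _ => eq_refl) _
  (is_derive_RInt_leibniz (fun t s => Hv (t - s) s * w (t - 2 * s))
     (fun t s => f (t - s) s * w (t - 2 * s) + Hv (t - s) s * dw (t - 2 * s))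
     (fun _ => 0) (fun t => t) x 0 1 _ _ _ (is_derive_const (V:=R_NormedModule) 0 x)
       (is_derive_id x))).
- rewrite RInt_Rplus.
  + replace (x - x) with 0 by ring.
    unfold Hv at 2; rewrite int_fst_0.
    rewrite <- (RInt_reflect (fun s => f s (x - s) * w (2 * s - x))).
    2:{ intros s. apply (cont2_comp (fun t s => f s (t - s) * w (2 * s - t)) (fun _ => x)
      (fun s => s));
        [cont2_tac|rcont|rcont]. }
    rewrite (RInt_Rext (fun s => f (x - s) (x - (x - s)) * w (2 * (x - s) - x))
       (fun s => f (x - s) s * w (x - 2 * s))).
    2:{ intros s. f_equal; [f_equal; ring|f_equal; ring]. }
    ring.
  + apply (ex_RInt_cont2_r (fun t s => f (t - s) s * w (t - 2 * s))); cont2_tac.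
  + apply (ex_RInt_cont2_r (fun t s => Hv (t - s) s * dw (t - 2 * s))); cont2_tac.
- intros t s. change R in t.
  assert (D1 : is_derive (fun t => Hv (t - s) s) t (f (t - s) s)).
  { unfold Hv, int_fst.
    assert (Cf : forall r, continuous (fun r => f r s) r).
    { intros r; apply (cont2_comp f (fun r => r) (fun _ => s)); auto; rcont. }
    refine (is_derive_Rcongr _ _ _ _ _ (fun _ => eq_refl) _
        (is_derive_comp (K:=R_AbsRing) (V:=R_NormedModule)
          (fun v => RInt (fun r => f r s) 0 v)
           (fun t => t - s) t _ 1 (is_derive_RInt_upper (fun r => f r s) 0 (t - s) Cf) _)).
    - unfold scal; simpl; unfold mult; simpl; ring.
    - auto_derive; trivial; ring. }
  assert (D2 : is_derive (fun t => w (t - 2 * s)) t (dw (t - 2 * s))).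
  { refine (is_derive_Rcongr _ _ _ _ _ _ _ (is_derive_comp_affine 1 (- (2 * s)) t)).
    - intros; f_equal; ring.
    - replace (1 * t + - (2 * s)) with (t - 2 * s) by ring; ring. }
  refine (is_derive_Rcongr _ _ _ _ _ (fun _ => eq_refl) _
       (is_derive_mult (K:=R_AbsRing) _ _ _ _ _ D1 D2 Rmult_comm)).
  unfold plus, mult; simpl; ring.
- cont2_tac.
- cont2_tac.
Qed.

End Test_function.

(** A component of T[u](x) = u(x) + integral of K(x, t) u(t) over [-x, x],
    with t = 2s - x; e is the component (1 or 0) of the constant 1. *)
Definition transmuted (e : R) (u : R -> R) (x : R) : R :=
  e * u x + 2 * RInt (fun s => H s (x - s) * u (2 * s - x)) 0 x.

Definition transmuted' (e : R) (u u1 : R -> R) (x : R) : R :=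
  e * u1 x + (a x * u x + a 0 * u (- x)
  + (RInt (fun s => Hu s (x - s) * u (2 * s - x)) 0 x
     + RInt (fun s => Hv (x - s) s * u (x - 2 * s)) 0 x)).

(** In the form given by [int_by_parts] the two integrals of f against U
    cancel, so the first derivative contains only H_u and H_v. *)
Lemma is_derive_transmuted (e : R) (U u u1 : R -> R) (x : R) :
  (forall x, is_derive U x (u x)) -> (forall x, is_derive u x (u1 x)) ->
  is_derive (transmuted e u) x (transmuted' e u u1 x).
Proof.
intros HU Hu1.
assert (Cu : forall x, continuous u x) by (intros; eapply derive_continuous, Hu1).
apply (is_derive_Rcongr
  (fun x => e * u x + (a x * U x + -1 * (a 0 * U (- x))
    + (-1 * RInt (fun s => Hu s (x - s) * U (2 * s - x)) 0 x
    + RInt (fun s => Hv (x - s) s * U (x - 2 * s)) 0 x))) _ _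
  (e * u1 x + ((da x * U x + a x * u x) + -1 * (a 0 * - u (- x))
   + (-1 * (RInt (fun s => f s (x - s) * U (2 * s - x)) 0 x
     - RInt (fun s => Hu s (x - s) * u (2 * s - x)) 0 x + da x * U x)
    + (RInt (fun s => f s (x - s) * U (2 * s - x)) 0 x
     + RInt (fun s => Hv (x - s) s * u (x - 2 * s)) 0 x)))) _).
- intros s; unfold transmuted. rewrite (int_by_parts U u HU Cu s). ring.
- unfold transmuted'; ring.
- apply (is_derive_plus (V:=R_NormedModule)); [apply is_derive_scal, Hu1|].
  apply (is_derive_plus (V:=R_NormedModule)).
  + apply (is_derive_plus (V:=R_NormedModule)).
    * refine (is_derive_Rcongr _ _ _ _ _ (fun _ => eq_refl) _
       (is_derive_mult (K:=R_AbsRing) _ _ _ _ _ (a_derive x) (HU x) Rmult_comm)).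
      unfold plus, mult; simpl; ring.
    * apply is_derive_scal, is_derive_scal.
      refine (is_derive_Rcongr _ _ _ _ _ _ _ (is_derive_comp_affine U u HU (-1) 0 x)).
      -- intros; f_equal; ring.
      -- replace (-1 * x + 0) with (- x) by ring; ring.
  + apply (is_derive_plus (V:=R_NormedModule)).
    * apply is_derive_scal. apply (is_derive_int_Hu U u HU Cu).
    * apply (is_derive_int_Hv U u HU Cu).
Qed.

(** Now the two integrals of f add up instead of cancelling. When f = q H they
    give the term q T[u] of the differential equation, and [int_by_parts],
    read backwards, gives T[u'']. *)
Lemma is_derive_transmuted' (e : R) (u u1 u2 : R -> R) (x : R) :
  (forall x, is_derive u x (u1 x)) -> (forall x, is_derive u1 x (u2 x)) ->
  (forall x, continuous u2 x) ->
  is_derive (transmuted' e u u1) x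
    (transmuted e u2 x + 2 * da x * u x
     + 2 * RInt (fun s => f s (x - s) * u (2 * s - x)) 0 x).
Proof.
intros Hu1 Hu2 C2.
assert (C1 : forall x, continuous u1 x) by (intros; eapply derive_continuous, Hu2).
refine (is_derive_Rcongr _ _ _
  (e * u2 x + ((da x * u x + a x * u1 x) + a 0 * - u1 (- x)
   + ((RInt (fun s => f s (x - s) * u (2 * s - x)) 0 x
     - RInt (fun s => Hu s (x - s) * u1 (2 * s - x)) 0 x + da x * u x)
    + (RInt (fun s => f s (x - s) * u (2 * s - x)) 0 x
     + RInt (fun s => Hv (x - s) s * u1 (x - 2 * s)) 0 x)))) _ (fun _ => eq_refl) _ _).
- unfold transmuted. rewrite (int_by_parts u1 u2 Hu2 C2 x). ring.
- apply (is_derive_plus (V:=R_NormedModule)); [apply is_derive_scal, Hu2|].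
  apply (is_derive_plus (V:=R_NormedModule)).
  + apply (is_derive_plus (V:=R_NormedModule)).
    * refine (is_derive_Rcongr _ _ _ _ _ (fun _ => eq_refl) _
       (is_derive_mult (K:=R_AbsRing) _ _ _ _ _ (a_derive x) (Hu1 x) Rmult_comm)).
      unfold plus, mult; simpl; ring.
    * apply is_derive_scal.
      refine (is_derive_Rcongr _ _ _ _ _ _ _ (is_derive_comp_affine u u1 Hu1 (-1) 0 x)).
      -- intros; f_equal; ring.
      -- replace (-1 * x + 0) with (- x) by ring; ring.
  + apply (is_derive_plus (V:=R_NormedModule)).
    * apply (is_derive_int_Hu u u1 Hu1 C1).
    * apply (is_derive_int_Hv u u1 Hu1 C1).
Qed.

Lemma transmuted_0 e u : transmuted e u 0 = e * u 0.
Proof. unfold transmuted; rewrite RInt_point; unfold zero; simpl; ring. Qed.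

Lemma transmuted'_0 e u u1 : transmuted' e u u1 0 = e * u1 0 + 2 * a 0 * u 0.
Proof.
unfold transmuted'; rewrite !RInt_point, Ropp_0; unfold zero; simpl; ring.
Qed.

End Transmutation.

(** * Algebra of complex derivatives *)

Lemma derC_minus (g k : R -> C) (x : R) (l m : C) : derC g x l -> derC k x m ->
  derC (fun s => (g s - k s)%C) x (l - m)%C.
Proof.
intros [H1 H2] [H3 H4]; split; simpl.
- exact (is_derive_minus (V:=R_NormedModule) _ _ _ _ _ H1 H3).
- exact (is_derive_minus (V:=R_NormedModule) _ _ _ _ _ H2 H4).
Qed.

Lemma derC_mult (g k : R -> C) (x : R) (l m : C) : derC g x l -> derC k x m ->
  derC (fun s => (g s * k s)%C) x (l * k x + g x * m)%C.
Proof.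
intros [H1 H2] [H3 H4]; split.
- refine (is_derive_Rcongr _ _ _ _ _ (fun _ => eq_refl) _
   (is_derive_minus (V:=R_NormedModule) _ _ _ _ _
     (is_derive_mult (K:=R_AbsRing) _ _ _ _ _ H1 H3 Rmult_comm)
     (is_derive_mult (K:=R_AbsRing) _ _ _ _ _ H2 H4 Rmult_comm))).
  unfold minus, plus, opp, mult, Re, Im; simpl; ring.
- refine (is_derive_Rcongr _ _ _ _ _ (fun _ => eq_refl) _
   (is_derive_plus (V:=R_NormedModule) _ _ _ _ _
     (is_derive_mult (K:=R_AbsRing) _ _ _ _ _ H1 H4 Rmult_comm)
     (is_derive_mult (K:=R_AbsRing) _ _ _ _ _ H2 H3 Rmult_comm))).
  unfold minus, plus, opp, mult, Re, Im; simpl; ring.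
Qed.

Lemma C_norm_neq_0 (z : C) : z <> 0%C -> Re z ^ 2 + Im z ^ 2 <> 0.
Proof.
intros Hz E; apply Hz. assert (Re z = 0 /\ Im z = 0) as [A B] by (split; nra).
apply C_ext; simpl; auto.
Qed.

Lemma derC_inv (g : R -> C) (x : R) (l : C) : g x <> 0%C -> derC g x l ->
  derC (fun s => (/ g s)%C) x (- l / (g x ^ 2))%C.
Proof.
intros Hg [H1 H2]. pose proof (C_norm_neq_0 _ Hg) as HN.
assert (HNd : is_derive (fun s => Re (g s) ^ 2 + Im (g s) ^ 2) x
   (2 * Re l * Re (g x) + 2 * Im l * Im (g x))).
{ refine (is_derive_Rcongr _ _ _ _ _ (fun _ => eq_refl) _
    (is_derive_plus (V:=R_NormedModule) _ _ _ _ _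
      (is_derive_pow _ 2 _ _ H1) (is_derive_pow _ 2 _ _ H2))).
  unfold plus; simpl; ring. }
assert (HN2 : (Re (g x) * Re (g x) - Im (g x) * Im (g x)) ^ 2
   + (2 * Re (g x) * Im (g x)) ^ 2 <> 0).
{ replace (_ + _) with ((Re (g x) ^ 2 + Im (g x) ^ 2) ^ 2) by ring. now apply pow_nonzero. }
split.
- refine (is_derive_Rcongr _ _ _ _ _ (fun _ => eq_refl) _
    (is_derive_div _ _ _ _ _ H1 HNd HN)).
  unfold Re, Im in *; simpl in *. field. split; intros E; [apply HN2|apply HN];
    rewrite <- E; ring.
- refine (is_derive_Rcongr _ _ _ _ _ (fun _ => eq_refl) _
    (is_derive_div _ _ _ _ _ (is_derive_opp (V:=R_NormedModule) _ _ _ H2) HNd HN)).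
  unfold opp, Re, Im in *; simpl in *. field. split; intros E; [apply HN2|apply HN];
    rewrite <- E; ring.
Qed.

Lemma contC_mult (g k : R -> C) : contC g -> contC k -> contC (fun s => (g s * k s)%C).
Proof.
intros [H1 H2] [H3 H4]; split; intros x; unfold Re, Im in *; simpl.
- apply continuous_Rminus; apply continuous_Rmult; auto.
- apply continuous_Rplus; apply continuous_Rmult; auto.
Qed.
Lemma contC_minus (g k : R -> C) : contC g -> contC k -> contC (fun s => (g s - k s)%C).
Proof.
intros [H1 H2] [H3 H4]; split; intros x; unfold Re, Im in *; simpl.
- now apply continuous_Rminus.
- now apply continuous_Rminus.
Qed.
Lemma contC_const (c : C) : contC (fun _ => c).
Proof. split; intros; apply continuous_const. Qed.

Lemma contC_of_derC g dg : (forall x, derC g x (dg x)) -> contC g.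
Proof. intros H; split; intros x; eapply derive_continuous, H. Qed.

Lemma contC_inv (g : R -> C) : contC g -> (forall x, g x <> 0%C) ->
  contC (fun s => (/ g s)%C).
Proof.
intros [H1 H2] Hg.
assert (HI : forall x, continuous (fun s => / (Re (g s) ^ 2 + Im (g s) ^ 2)) x).
{ intros x. apply (continuous_comp (fun s => Re (g s) ^ 2 + Im (g s) ^ 2) Rinv).
  - apply continuous_Rplus; apply continuous_Rpow; auto.
  - apply continuous_Rinv. now apply C_norm_neq_0. }
split; intros x.
- apply (continuous_Rmult (fun s => Re (g s)) (fun s => / (Re (g s) ^ 2 + Im (g s) ^ 2)));
    auto.
- apply (continuous_Rmult (fun s => - Im (g s))
    (fun s => / (Re (g s) ^ 2 + Im (g s) ^ 2))); auto.
  apply (continuous_opp (V:=R_NormedModule)); auto.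
Qed.

Lemma derC_CInt (g : R -> C) (x : R) : contC g -> derC (fun x => CInt g 0 x) x (g x).
Proof.
intros Hg; split.
- refine (is_derive_Rcongr _ _ _ _ _ _ eq_refl (is_derive_RInt_upper _ 0 x (proj1 Hg))).
  intros s; now rewrite CInt_components.
- refine (is_derive_Rcongr _ _ _ _ _ _ eq_refl (is_derive_RInt_upper _ 0 x (proj2 Hg))).
  intros s; now rewrite CInt_components.
Qed.

Lemma derC_const (c : C) (x : R) : derC (fun _ => c) x 0%C.
Proof. split; apply (is_derive_const (V:=R_NormedModule)). Qed.

Lemma derC_eq (g : R -> C) (x : R) (l m : C) : l = m -> derC g x l -> derC g x m.
Proof. now intros ->. Qed.

Lemma equal_derivatives (b : R) (g k : R -> C) (dg : R -> C) : contC g -> contC k ->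
  (forall x, 0 < x < b -> derC g x (dg x)) -> (forall x, 0 < x < b -> derC k x (dg x)) ->
  g 0 = k 0 -> forall x, 0 <= x <= b -> g x = k x.
Proof.
intros Cg Ck Dg Dk E0 x Hx.
assert (Z : forall F : R -> R, (forall x, continuous F x) ->
   (forall y, 0 < y < b -> is_derive F y 0) -> F x = F 0).
{ intros F CF DF. assert (E : RInt (fun _ => 0) 0 x = F x - F 0).
  { apply RInt_derive_interior; [lra|auto|intros; apply continuous_const|].
    intros y Hy; apply DF; lra. }
  rewrite RInt_const in E. unfold scal in E; simpl in E; unfold mult in E; simpl in E.
  lra. }
assert (D : forall y, 0 < y < b -> derC (fun s => (g s - k s)%C) y 0%C).
{ intros y Hy. apply (derC_eq _ _ (dg y - dg y)%C); [ring|]. apply derC_minus; auto. }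
destruct (contC_minus _ _ Cg Ck) as [C1 C2].
pose proof (Z _ C1 (fun y Hy => proj1 (D y Hy))) as E1.
pose proof (Z _ C2 (fun y Hy => proj2 (D y Hy))) as E2.
cbv beta in E1, E2. rewrite E0 in E1, E2. unfold Re, Im in *; simpl in *. apply C_ext;
  unfold Re, Im; lra.
Qed.

(** * Formal powers *)

Lemma Xpow_ext (b : R) (f g : R -> C) n x : (forall x, 0 <= x <= b -> f x = g x) ->
  0 <= x <= b ->
  Xpow f n x = Xpow g n x /\ Xtpow f n x = Xtpow g n x.
Proof.
intros E; revert x; induction n as [|n IH]; intros x Hx; [split; reflexivity|].
split; cbn [Xpow Xtpow]; f_equal; apply CInt_ext; rewrite Rmin_left, Rmax_right by lra;
  intros s Hs; destruct (IH s) as [E1 E2]; try lra; rewrite E by lra; now f_equal.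
Qed.

Lemma phi_ext (b : R) (f g : R -> C) n x : (forall x, 0 <= x <= b -> f x = g x) ->
  0 <= x <= b ->
  phi f n x = phi g n x.
Proof.
intros E Hx; unfold phi. rewrite (E x Hx).
destruct (Xpow_ext b f g n x E Hx) as [E1 E2]. now rewrite E1, E2.
Qed.

Section Formal_powers.
Variable f : R -> C.
Hypothesis f_cont : contC f.
Hypothesis f_neq_0 : forall x, f x <> 0%C.

Lemma contC_pow_sign n : contC (fun s => pow_sign (f s ^ 2) n).
Proof.
assert (H : contC (fun s => f s ^ 2)%C).
{ simpl. apply contC_mult; [auto|]. apply contC_mult; [auto|apply contC_const]. }
unfold pow_sign; destruct (Nat.even n); [exact H|]. apply contC_inv; [exact H|].
intros x; apply Cpow_nz; auto.
Qed.

Lemma derC_primitive (c : C) (g : R -> C) (x : R) : contC g ->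
  derC (fun x => c * CInt g 0 x)%C x (c * g x)%C.
Proof.
intros Hg. apply (derC_eq _ _ (0 * CInt g 0 x + c * g x)%C); [ring|].
apply derC_mult; [apply derC_const|now apply derC_CInt].
Qed.

Lemma contC_Xpow n : contC (Xpow f n).
Proof.
induction n as [|n IH]; [apply contC_const|].
apply (contC_of_derC _ (fun x => INR (S n) * (Xpow f n x * pow_sign (f x ^ 2) (S n)))%C).
intros x; apply derC_primitive. apply contC_mult; [exact IH|apply contC_pow_sign].
Qed.
Lemma contC_Xtpow n : contC (Xtpow f n).
Proof.
induction n as [|n IH]; [apply contC_const|].
apply (contC_of_derC _ (fun x => INR (S n) * (Xtpow f n x * pow_sign (f x ^ 2) n))%C).
intros x; apply derC_primitive. apply contC_mult; [exact IH|apply contC_pow_sign].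
Qed.

Lemma derC_Xpow n x :
  derC (Xpow f (S n)) x (INR (S n) * (Xpow f n x * pow_sign (f x ^ 2) (S n)))%C.
Proof.
apply (derC_primitive (INR (S n)) (fun s => Xpow f n s * pow_sign (f s ^ 2) (S n))%C).
apply contC_mult; [apply contC_Xpow|apply contC_pow_sign].
Qed.
Lemma derC_Xtpow n x :
  derC (Xtpow f (S n)) x (INR (S n) * (Xtpow f n x * pow_sign (f x ^ 2) n))%C.
Proof.
apply (derC_primitive (INR (S n)) (fun s => Xtpow f n s * pow_sign (f s ^ 2) n)%C).
apply contC_mult; [apply contC_Xtpow|apply contC_pow_sign].
Qed.

(** In the recursion for X^(k) with k odd, the predecessor is X^(k-1), which
    is not the one that enters phi_{k-1}. So [phi f k] involves one of the two
    families throughout, chosen by the parity of k, and k - 2 selects the same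
    family. *)
Definition Apow (k n : nat) (x : R) : C := if Nat.even k then Xtpow f n x else Xpow f n x.

Lemma phi_Apow k x : phi f k x = (f x * Apow k k x)%C.
Proof. reflexivity. Qed.

Lemma contC_Apow k n : contC (Apow k n).
Proof. unfold Apow; destruct (Nat.even k); [apply contC_Xtpow|apply contC_Xpow]. Qed.

Lemma Apow_0 k n : Apow k (S n) 0 = 0%C.
Proof.
assert (H : forall g : R -> C, CInt g 0 0 = 0%C)
  by (intros; apply (RInt_point (V:=C_R_CompleteNormedModule))).
unfold Apow; destruct (Nat.even k); cbn [Xpow Xtpow]; rewrite H; ring.
Qed.

(** Together with [derC_Apow_next]: below the top index k the weights
    alternate between f^(-2) and f^2, starting with f^(-2). *)
Lemma derC_Apow_top n x :
  derC (Apow (S n) (S n)) x (INR (S n) * Apow (S n) n x / f x ^ 2)%C.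
Proof.
unfold Apow; destruct (Nat.even (S n)) eqn:E.
- eapply derC_eq; [|apply derC_Xtpow].
  unfold pow_sign. rewrite Nat.even_succ, <- Nat.negb_even in E.
  destruct (Nat.even n); [discriminate|]. unfold Cdiv; ring.
- eapply derC_eq; [|apply derC_Xpow].
  unfold pow_sign. rewrite E. unfold Cdiv; ring.
Qed.

Lemma derC_Apow_next n x :
  derC (Apow (S (S n)) (S n)) x (INR (S n) * Apow n n x * f x ^ 2)%C.
Proof.
unfold Apow; change (Nat.even (S (S n))) with (Nat.even n); destruct (Nat.even n) eqn:E.
- eapply derC_eq; [|apply derC_Xtpow].
  unfold pow_sign. rewrite E. ring.
- eapply derC_eq; [|apply derC_Xpow].
  unfold pow_sign. rewrite Nat.even_succ, <- Nat.negb_even, E. simpl. ring.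
Qed.
End Formal_powers.

(** * Images of the monomials *)

Lemma is_derive_monomial k (x : R) : is_derive (fun t => t ^ k) x (INR k * x ^ (k - 1)).
Proof.
refine (is_derive_Rcongr _ _ _ _ _ (fun _ => eq_refl) _
  (is_derive_pow (fun t => t) k x 1 (is_derive_id x))).
rewrite Nat.sub_1_r. cbv beta. ring.
Qed.
Lemma is_derive_monomial_primitive k (x : R) : is_derive
  (fun t => / INR (S k) * t ^ S k) x (x ^ k).
Proof.
refine (is_derive_Rcongr _ _ _ _ _ (fun _ => eq_refl) _
  (is_derive_scal _ x (/ INR (S k)) _ (is_derive_monomial (S k) x))).
replace (S k - 1)%nat with k by lia. field. apply INR_S_neq_0.
Qed.
Lemma is_derive_monomial' k (x : R) :
  is_derive (fun t => INR k * t ^ (k - 1)) x (INR k * INR (k - 1) * x ^ (k - 2)).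
Proof.
refine (is_derive_Rcongr _ _ _ _ _ (fun _ => eq_refl) _
  (is_derive_scal _ x (INR k) _ (is_derive_monomial (k - 1) x))).
replace (k - 1 - 1)%nat with (k - 2)%nat by lia. ring.
Qed.

Section Monomials.
Variables (b : R) (q : R -> C) (h : C) (K : R -> R -> C) (q1 q2 : R -> R)
  (h1 h2 : R -> R -> R).
Hypothesis HK : is_transmutation_kernel b q h K.
Hypothesis Q1 : forall x, continuous q1 x.
Hypothesis Q2 : forall x, continuous q2 x.
Hypothesis Hq : forall x, 0 <= x <= b -> q x = (q1 x, q2 x).
Hypothesis H1 : cont2 h1.
Hypothesis H2 : cont2 h2.
Hypothesis Ha : agrees b K h1 h2.

Let a1 x := Re h / 2 + RInt (fun s => / 2 * q1 s) 0 x.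
Let a2 x := Im h / 2 + RInt (fun s => / 2 * q2 s) 0 x.
Let f1 := prod_re q1 q2 h1 h2.
Let f2 := prod_im q1 q2 h1 h2.
Let d1 x := / 2 * q1 x.
Let d2 x := / 2 * q2 x.

Lemma f1_cont : cont2 f1. Proof. unfold f1, prod_re; cont2_tac. Qed.
Lemma f2_cont : cont2 f2. Proof. unfold f2, prod_im; cont2_tac. Qed.

Lemma is_derive_half_primitive c (g : R -> R) (x : R) : (forall x, continuous g x) ->
  is_derive (fun x => c + RInt (fun s => / 2 * g s) 0 x) x (/ 2 * g x).
Proof.
intros Hg.
assert (C : forall x, continuous (fun s => / 2 * g s) x) by (intros; rcont).
refine (is_derive_Rcongr _ _ _ _ _ (fun _ => eq_refl) _
  (is_derive_plus (V:=R_NormedModule) (fun _ => c) _ _ _ _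
    (is_derive_const (V:=R_NormedModule) _ _)
     (is_derive_RInt_upper _ 0 x C))).
unfold plus, zero; simpl; ring.
Qed.

(** On [0, b] this is T[t^k]. Written with the right-hand side of the integral
    equation in place of K, it makes sense and is differentiable on the whole
    line. *)
Definition transmuted_monomial (k : nat) (x : R) : C :=
  (transmuted a1 f1 1 (fun t => t ^ k) x, transmuted a2 f2 0 (fun t => t ^ k) x).
Definition transmuted_monomial' (k : nat) (x : R) : C :=
  (transmuted' a1 d1 f1 1 (fun t => t ^ k) (fun t => INR k * t ^ (k - 1)) x,
   transmuted' a2 d2 f2 0 (fun t => t ^ k) (fun t => INR k * t ^ (k - 1)) x).

Lemma d1_cont x : continuous d1 x. Proof. unfold d1; rcont. Qed.
Lemma d2_cont x : continuous d2 x. Proof. unfold d2; rcont. Qed.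

Lemma derC_transmuted_monomial k x : derC (transmuted_monomial k) x
  (transmuted_monomial' k x).
Proof.
split.
- apply (is_derive_transmuted a1 d1 f1
    (fun x => is_derive_half_primitive _ q1 x Q1) d1_cont f1_cont 1
    (fun t => / INR (S k) * t ^ S k)); intros;
      [apply is_derive_monomial_primitive|apply is_derive_monomial].
- apply (is_derive_transmuted a2 d2 f2
    (fun x => is_derive_half_primitive _ q2 x Q2) d2_cont f2_cont 0
    (fun t => / INR (S k) * t ^ S k)); intros;
      [apply is_derive_monomial_primitive|apply is_derive_monomial].
Qed.

(** This serves for the continuity of [transmuted_monomial'] on the whole
    line; on [0, b] the derivative is identified by [transmuted_monomial_ode]. *)
Lemma derC_transmuted_monomial'_exists k : exists dd, forall x,
  derC (transmuted_monomial' k) x (dd x).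
Proof.
eexists (fun x => (_, _)); intros x; split.
- simpl. apply (is_derive_transmuted' a1 d1 f1
    (fun x => is_derive_half_primitive _ q1 x Q1) d1_cont f1_cont 1
    _ _ (fun t => INR k * INR (k - 1) * t ^ (k - 2)));
   [intros; apply is_derive_monomial|intros; apply is_derive_monomial'|intros; rcont].
- simpl. apply (is_derive_transmuted' a2 d2 f2
    (fun x => is_derive_half_primitive _ q2 x Q2) d2_cont f2_cont 0
    _ _ (fun t => INR k * INR (k - 1) * t ^ (k - 2)));
   [intros; apply is_derive_monomial|intros; apply is_derive_monomial'|intros; rcont].
Qed.

Lemma continuous_kernel_monomial (c : R) (g : R -> R) (F : R -> R -> R) (k : nat) (x : R) :
  (forall x, continuous g x) -> cont2 F ->
  forall s, continuous (fun s =>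
    (c + RInt (fun s => / 2 * g s) 0 s + goursat F s (x - s)) * (2 * s - x) ^ k) s.
Proof.
intros Hg HF s.
assert (CH : cont2 (fun u v => c + RInt (fun s => / 2 * g s) 0 u + goursat F u v)).
{ apply (cont2_H (fun x => c + RInt (fun s => / 2 * g s) 0 x) (fun x => / 2 * g x)); auto.
  intros; now apply is_derive_half_primitive. }
apply continuous_Rmult.
- apply (cont2_comp _ (fun s => s) (fun s => x - s) s CH); rcont.
- apply continuous_Rpow. rcont.
Qed.

(** The equation T[u]'' = q T[u] + T[u''] for u = t^k. For x in [0, b] the
    potential q(u + v) is constant, equal to q(x), along u + v = x, so it
    leaves the integral of q H. *)
Lemma transmuted_monomial_ode k x : 0 <= x <= b ->
  derC (transmuted_monomial' k) x
    (q x * transmuted_monomial k x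
      + (INR k * INR (k - 1))%R * transmuted_monomial (k - 2) x)%C.
Proof.
intros Hx.
pose proof (kernel_step b q h K q1 q2 h1 h2 HK Q1 Q2 Hq H1 H2 Ha) as Hb.
fold f1 f2 in Hb.
set (I1 := RInt (fun s => (a1 s + goursat f1 s (x - s)) * (2 * s - x) ^ k) 0 x).
set (I2 := RInt (fun s => (a2 s + goursat f2 s (x - s)) * (2 * s - x) ^ k) 0 x).
assert (X1 : ex_RInt (fun s => (a1 s + goursat f1 s (x - s)) * (2 * s - x) ^ k) 0 x).
{ apply ex_RInt_cont, continuous_kernel_monomial; [exact Q1|exact f1_cont]. }
assert (X2 : ex_RInt (fun s => (a2 s + goursat f2 s (x - s)) * (2 * s - x) ^ k) 0 x).
{ apply ex_RInt_cont, continuous_kernel_monomial; [exact Q2|exact f2_cont]. }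
assert (E : forall s, 0 < s < x -> h1 s (x - s) = a1 s + goursat f1 s (x - s)
    /\ h2 s (x - s) = a2 s + goursat f2 s (x - s)).
{ intros s Hs. pose proof (Ha s (x - s) ltac:(lra) ltac:(lra) ltac:(lra)) as E1.
  rewrite (Hb s (x - s)) in E1 by lra. injection E1; intros; split; symmetry; assumption. }
assert (F1 : RInt (fun s => f1 s (x - s) * (2 * s - x) ^ k) 0 x = q1 x * I1 - q2 x * I2).
{ unfold I1, I2. rewrite <- !RInt_Rscal by assumption.
  rewrite <- RInt_Rminus by (apply (ex_RInt_scal (V:=R_NormedModule)); assumption).
  apply (RInt_ext (V:=R_CompleteNormedModule)). rewrite Rmin_left, Rmax_right by lra.
  intros s Hs. unfold f1 at 1, prod_re. destruct (E s Hs) as [-> ->].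
  replace (s + (x - s)) with x by ring. change (@eq R_CompleteNormedModule) with (@eq R).
  ring. }
assert (F2 : RInt (fun s => f2 s (x - s) * (2 * s - x) ^ k) 0 x = q1 x * I2 + q2 x * I1).
{ unfold I1, I2. rewrite <- !RInt_Rscal by assumption.
  rewrite <- RInt_Rplus by (apply (ex_RInt_scal (V:=R_NormedModule)); assumption).
  apply (RInt_ext (V:=R_CompleteNormedModule)). rewrite Rmin_left, Rmax_right by lra.
  intros s Hs. unfold f2 at 1, prod_im. destruct (E s Hs) as [-> ->].
  replace (s + (x - s)) with x by ring. change (@eq R_CompleteNormedModule) with (@eq R).
  ring. }
assert (L : forall (c : R) g F e, (forall x, continuous g x) -> cont2 F ->
   transmuted (fun x => c + RInt (fun s => / 2 * g s) 0 x) F e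
     (fun t => INR k * INR (k - 1) * t ^ (k - 2)) x
   = INR k * INR (k - 1) * transmuted (fun x => c + RInt (fun s => / 2 * g s) 0 x) F e
     (fun t => t ^ (k - 2)) x).
{ intros c g F e Hg HF. unfold transmuted.
  rewrite (RInt_Rext _ (fun s => INR k * INR (k - 1) *
    ((c + RInt (fun s0 => / 2 * g s0) 0 s + goursat F s (x - s)) * (2 * s - x) ^ (k - 2))))
   by (intros; ring).
  rewrite RInt_Rscal by (apply ex_RInt_cont, continuous_kernel_monomial; assumption).
  ring. }
rewrite (Hq x Hx).
pose proof (L (Re h / 2) q1 f1 1 Q1 f1_cont) as L1; fold a1 in L1.
pose proof (L (Im h / 2) q2 f2 0 Q2 f2_cont) as L2; fold a2 in L2.
assert (T0 : transmuted_monomial k x = (1 * x ^ k + 2 * I1, 0 * x ^ k + 2 * I2))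
  by reflexivity.
rewrite T0. unfold transmuted_monomial. split.
- refine (is_derive_Rcongr _ _ _ _ _ (fun _ => eq_refl) _
   (is_derive_transmuted' a1 d1 f1
     (fun x => is_derive_half_primitive _ q1 x Q1) d1_cont f1_cont 1
    _ _ (fun t => INR k * INR (k - 1) * t ^ (k - 2)) x
    (is_derive_monomial k) (is_derive_monomial' k) _)); [|intros; rcont].
  rewrite L1, F1. unfold d1, Re, Im; simpl; field.
- refine (is_derive_Rcongr _ _ _ _ _ (fun _ => eq_refl) _
   (is_derive_transmuted' a2 d2 f2
     (fun x => is_derive_half_primitive _ q2 x Q2) d2_cont f2_cont 0
    _ _ (fun t => INR k * INR (k - 1) * t ^ (k - 2)) x
    (is_derive_monomial k) (is_derive_monomial' k) _)); [|intros; rcont].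
  rewrite L2, F2. unfold d2, Re, Im; simpl; field.
Qed.
End Monomials.

(** * The images of the monomials are the functions phi_k *)

Lemma contC_clamp_of_derive (b : R) (f df : R -> C) : 0 <= b ->
  (forall x, 0 <= x <= b -> is_derive_in (segment 0 b) f x (df x)) ->
  contC (fun x => f (clamp 0 b x)).
Proof.
intros Hb Hf; apply contC_clamp; [exact Hb|].
intros x Hx; apply (is_derive_in_continuous _ _ _ _ (Hf x Hx)).
Qed.

(** Let y_k = T[t^k]. The Wronskian W = y_k' f - y_k f' has derivative k (k-1)
    y_{k-2} f, and W / f^2 is the derivative of y_k / f. By induction y_{k-2}
    is phi_{k-2}, so W and y_k / f satisfy the two successive steps of the
    recursion for the formal powers, with the same initial values: T[t^k](0) =
    0^k, and h is the initial slope of f because K(0, 0) = h / 2. *)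
Lemma phi_transmuted (b : R) (q f f' : R -> C) (K : R -> R -> C)
    (q1 q2 : R -> R) (h1 h2 : R -> R -> R) : 0 < b ->
  (forall x, 0 <= x <= b -> is_derive_in (segment 0 b) f x (f' x)) ->
  (forall x, 0 <= x <= b -> is_derive_in (segment 0 b) f' x (q x * f x)%C) ->
  (forall x, 0 <= x <= b -> f x <> 0%C) -> f 0 = 1%C ->
  is_transmutation_kernel b q (f' 0) K ->
  (forall x, continuous q1 x) -> (forall x, continuous q2 x) ->
  (forall x, 0 <= x <= b -> q x = (q1 x, q2 x)) ->
  cont2 h1 -> cont2 h2 -> agrees b K h1 h2 ->
  forall k x, 0 <= x <= b -> phi f k x = transmuted_monomial (f' 0) q1 q2 h1 h2 k x.
Proof.
intros Hb Df Df' Hf0 f0 HK Q1 Q2 Hq H1 H2 Ha.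
(* Extended by constants, f stays continuous and nonvanishing on the line, so its
   formal powers are differentiable everywhere. *)
set (g := fun x => f (clamp 0 b x)). set (g' := fun x => f' (clamp 0 b x)).
assert (Cg : contC g) by (apply (contC_clamp_of_derive b f f'); [lra|exact Df]).
assert (Cg' : contC g') by
  (apply (contC_clamp_of_derive b f' (fun x => q x * f x)%C); [lra|exact Df']).
assert (Eg : forall x, 0 <= x <= b -> f x = g x)
  by (intros x Hx; unfold g; now rewrite clamp_id).
assert (Eg' : forall x, 0 <= x <= b -> f' x = g' x)
  by (intros x Hx; unfold g'; now rewrite clamp_id).
assert (Dg : forall x, 0 < x < b -> derC g x (g' x)).
{ intros x Hx; rewrite <- Eg' by lra. apply derC_clamp; [exact Hx|]. apply Df; lra. }
assert (Dg' : forall x, 0 < x < b -> derC g' x (q x * g x)%C).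
{ intros x Hx; rewrite <- Eg by lra. apply (derC_clamp 0 b f'); [exact Hx|]. apply Df';
    lra. }
assert (g_neq : forall x, g x <> 0%C) by (intros x; apply Hf0, clamp_in; lra).
assert (g0 : g 0 = 1%C) by (rewrite <- Eg by lra; exact f0).
set (h := f' 0) in *.
assert (g'0 : g' 0 = h) by (symmetry; apply Eg'; lra).
set (T := transmuted_monomial h q1 q2 h1 h2).
set (T' := transmuted_monomial' h q1 q2 h1 h2).
assert (DT : forall k x, derC (T k) x (T' k x))
  by (intros; now apply derC_transmuted_monomial).
assert (CT : forall k, contC (T k)) by (intros k; apply (contC_of_derC _ (T' k)), DT).
assert (CT' : forall k, contC (T' k)).
{ intros k. destruct (derC_transmuted_monomial'_exists h q1 q2 h1 h2 Q1 Q2 H1 H2 k)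
    as [dd Hd].
  apply (contC_of_derC _ dd), Hd. }
assert (ODE : forall k x, 0 <= x <= b ->
   derC (T' k) x (q x * T k x + (INR k * INR (k - 1))%R * T (k - 2)%nat x)%C)
  by (intros; now apply (transmuted_monomial_ode b q h K)).
assert (T0 : forall k, T k 0 = RtoC (0 ^ k)).
{ intros k; unfold T, transmuted_monomial. rewrite !transmuted_0. apply C_ext; simpl;
    ring. }
assert (T'0 : forall k, T' k 0 = (RtoC (INR k * 0 ^ (k - 1)) + h * RtoC (0 ^ k))%C).
{ intros k; unfold T', transmuted_monomial'. rewrite !transmuted'_0, !RInt_point.
  unfold zero; apply C_ext; unfold Re, Im; simpl; field. }
set (W := fun k x => (T' k x * g x - T k x * g' x)%C).
assert (CW : forall k, contC (W k)) by (intros; apply contC_minus; apply contC_mult; auto).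
assert (DW : forall k x, 0 < x < b ->
  derC (W k) x ((INR k * INR (k - 1))%R * T (k - 2)%nat x * g x)%C).
{ intros k x Hx. eapply derC_eq; [|apply derC_minus; apply derC_mult;
    [apply ODE; lra|apply Dg; exact Hx|apply DT|apply Dg'; exact Hx]]. ring. }
(* The derivative of T k / g is W k / g^2. *)
assert (Final : forall k, T k 0 = (g 0 * Apow g k k 0)%C ->
  (forall x, 0 < x < b -> derC (Apow g k k) x (W k x / g x ^ 2)%C) ->
  forall x, 0 <= x <= b -> T k x = (g x * Apow g k k x)%C).
{ intros k E0 DA x Hx.
  assert (E : (T k x * / g x)%C = Apow g k k x).
  { apply (equal_derivatives b (fun x => T k x * / g x)%C (Apow g k k)
      (fun x => W k x / g x ^ 2)%C).
    - apply contC_mult; [apply CT|]. now apply contC_inv.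
    - now apply contC_Apow.
    - intros y Hy. eapply derC_eq;
        [|apply derC_mult; [apply DT|apply derC_inv; [apply g_neq|apply Dg; exact Hy]]].
      unfold W. field. apply g_neq.
    - exact DA.
    - rewrite E0, g0. field.
    - exact Hx. }
  rewrite <- E. field. apply g_neq. }
assert (Main : forall k x, 0 <= x <= b -> T k x = (g x * Apow g k k x)%C).
{ assert (EW : forall k, (forall x, 0 < x < b -> T k x = (g x * Apow g k k x)%C) ->
     forall x, 0 < x < b -> W (S (S k)) x = (INR (S (S k)) * Apow g (S (S k)) (S k) x)%C).
  { intros k IH x Hx.
    apply (equal_derivatives b (W (S (S k)))
      (fun x => INR (S (S k)) * Apow g (S (S k)) (S k) x)%C
      (fun x => (INR (S (S k)) * INR (S k))%R * T k x * g x)%C).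
    - apply CW.
    - apply contC_mult; [apply contC_const|now apply contC_Apow].
    - intros y Hy. pose proof (DW (S (S k)) y Hy) as D.
      replace (S (S k) - 1)%nat with (S k) in D by lia.
      replace (S (S k) - 2)%nat with k in D by lia. exact D.
    - intros y Hy. eapply derC_eq;
        [|apply derC_mult; [apply derC_const|now apply derC_Apow_next]].
      rewrite (IH y Hy), RtoC_mult. ring.
    - unfold W. rewrite T0, T'0, g'0, Apow_0.
      replace (S (S k) - 1)%nat with (S k) by lia.
      rewrite !pow_i by lia. rewrite Rmult_0_r. ring.
    - lra. }
  assert (W1 : forall x, 0 < x < b -> W 1%nat x = 1%C).
  { intros x Hx. apply (equal_derivatives b (W 1%nat) (fun _ => 1%C) (fun _ => 0%C)).
    - apply CW.
    - apply contC_const.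
    - intros y Hy; eapply derC_eq; [|apply DW; exact Hy]. simpl. rewrite Rmult_0_r. ring.
    - intros; apply derC_const.
    - unfold W. rewrite T0, T'0, g'0, g0. simpl. apply C_ext; unfold Re, Im; simpl; ring.
    - lra. }
  assert (W0 : forall x, 0 < x < b -> W 0%nat x = 0%C).
  { intros x Hx. apply (equal_derivatives b (W 0%nat) (fun _ => 0%C) (fun _ => 0%C)).
    - apply CW.
    - apply contC_const.
    - intros y Hy; eapply derC_eq; [|apply DW; exact Hy]. simpl. rewrite Rmult_0_l. ring.
    - intros; apply derC_const.
    - unfold W. rewrite T0, T'0, g'0, g0. simpl. apply C_ext; unfold Re, Im; simpl; ring.
    - lra. }
  induction k as [| |k IH _] using nat_pair_ind.
  - apply Final.
    + rewrite T0, g0. simpl. apply C_ext; unfold Re, Im; simpl; ring.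
    + intros x Hx. rewrite (W0 x Hx).
      apply (derC_eq _ _ 0%C); [unfold Cdiv; ring|]. exact (derC_const 1%C x).
  - apply Final.
    + rewrite T0, g0, Apow_0. simpl. rewrite Rmult_0_l. ring.
    + intros x Hx. rewrite (W1 x Hx). eapply derC_eq; [|now apply derC_Apow_top].
      unfold Apow; simpl. unfold Cdiv; ring.
  - apply Final.
    + rewrite T0, Apow_0, pow_i by lia. ring.
    + intros x Hx. rewrite (EW k) by (auto; intros; apply IH; lra).
      now apply derC_Apow_top. }
intros k x Hx. rewrite (phi_ext b f g k x Eg Hx), phi_Apow. symmetry; now apply Main.
Qed.

(** * Moments of the Legendre polynomials and the coefficients beta_k *)

Lemma moment_rec_S j k :
  (2 * INR j + 3) * legendre_moment (S j) (S k) =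
    (INR j + 2) * legendre_moment (S (S j)) k + (INR j + 1) * legendre_moment j k.
Proof.
unfold legendre_moment.
rewrite <- !RInt_Rscal by (apply ex_RInt_cont; intros; rcont).
rewrite <- RInt_Rplus by (apply ex_RInt_cont; intros; rcont).
apply RInt_Rext; intros y.
transitivity (((2 * INR j + 3) * y * legendre (S j) y) * y ^ k); [simpl; ring|].
replace ((2 * INR j + 3) * y * legendre (S j) y)
  with ((INR j + 2) * legendre (S (S j)) y + (INR j + 1) * legendre j y)
  by (rewrite legendre_bonnet; ring).
ring.
Qed.

Lemma moment_rec_0 k : legendre_moment 0 (S k) = legendre_moment 1 k.
Proof. apply RInt_Rext; intros y. simpl. ring. Qed.

Lemma moment_0_0 : legendre_moment 0 0 = 2.
Proof.
unfold legendre_moment; simpl. rewrite (RInt_Rext _ (fun _ => 1)) by (intros; ring).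
rewrite RInt_const. unfold scal; simpl; unfold mult; simpl; ring.
Qed.

Lemma moment_S_0 j : legendre_moment (S j) 0 = 0.
Proof.
rewrite <- (legendre_ip_0_S j). apply RInt_Rext; intros y. simpl legendre at 2. simpl pow.
ring.
Qed.

Lemma moment_lt j k : (k < j)%nat -> legendre_moment j k = 0.
Proof.
revert j; induction k as [|k IH]; intros j Hj; (destruct j as [|j]; [lia|]).
- apply moment_S_0.
- pose proof (moment_rec_S j k) as E. rewrite !IH in E by lia. pose proof (pos_INR j). nra.
Qed.

Lemma moment_parity j k : Nat.even j <> Nat.even k -> legendre_moment j k = 0.
Proof.
revert j; induction k as [|k IH]; intros j Hj.
- destruct j as [|j]; [now destruct Hj|apply moment_S_0].
- destruct j as [|j].
  + rewrite moment_rec_0. apply IH. intros E. apply Hj.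
    rewrite Nat.even_succ, <- Nat.negb_even, <- E. reflexivity.
  + pose proof (moment_rec_S j k) as E.
    assert (Hk : Nat.even j <> Nat.even k).
    { intros E'; apply Hj. rewrite !Nat.even_succ, <- !Nat.negb_even. now f_equal. }
    rewrite (IH (S (S j)) Hk), (IH j Hk) in E. pose proof (pos_INR j). nra.
Qed.

Lemma moment_diag_pos k : 0 < legendre_moment k k.
Proof.
induction k as [|k IH]; [rewrite moment_0_0; lra|].
pose proof (moment_rec_S k k) as E. rewrite (moment_lt (S (S k)) k) in E by lia.
pose proof (pos_INR k). nra.
Qed.

(** A discrete summation by parts: b lists the Legendre moments of y g when a
    lists those of g. Multiplying a partial sum by y makes an error only at
    the cut. *)
Lemma legendre_sum_shift (a b : nat -> R) (N : nat) (y : R) :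
  b 0%nat = a 1%nat ->
  (forall j, (2 * INR j + 3) * b (S j) = (INR j + 2) * a (S (S j)) + (INR j + 1) * a j) ->
  legendre_sum b N y - y * legendre_sum a N y
    = / 2 * (INR N + 1) * (a (S N) * legendre N y - a N * legendre (S N) y).
Proof.
intros H0 HS; induction N as [|N IH].
- unfold legendre_sum; simpl. rewrite H0. field.
- unfold legendre_sum in *. rewrite !tech5.
  pose proof (HS N) as E. pose proof (legendre_bonnet N y) as L.
  replace ((2 * INR (S N) + 1) / 2 * b (S N))
    with (/ 2 * ((INR N + 2) * a (S (S N)) + (INR N + 1) * a N))
    by (rewrite <- E, S_INR; field).
  rewrite S_INR.
  assert (L' : (2 * INR N + 3) * y * legendre (S N) y
      = (INR N + 2) * legendre (S (S N)) y + (INR N + 1) * legendre N y) by lra.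
  replace (y * (sum_f_R0 (fun n => (2 * INR n + 1) / 2 * a n * legendre n y) N +
    (2 * (INR N + 1) + 1) / 2 * a (S N) * legendre (S N) y))
   with (y * sum_f_R0 (fun n => (2 * INR n + 1) / 2 * a n * legendre n y) N
     + / 2 * a (S N) * ((2 * INR N + 3) * y * legendre (S N) y)) by field.
  rewrite L'.
  replace (INR N + 1 + 1) with (INR N + 2) by ring. lra.
Qed.

(** For N > k the error in [legendre_sum_shift] vanishes by [moment_lt], so
    the expansion of y^(k+1) follows from that of y^k. *)
Lemma monomial_legendre_sum k N y : (k <= N)%nat ->
  y ^ k = legendre_sum (fun j => legendre_moment j k) N y.
Proof.
revert N; induction k as [|k IH]; intros N HN.
- induction N as [|N IHN].
  + unfold legendre_sum; simpl. rewrite moment_0_0. field.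
  + unfold legendre_sum; rewrite tech5, moment_S_0.
    rewrite (IHN (Nat.le_0_l _)) at 1. unfold legendre_sum. ring.
- pose proof (legendre_sum_shift (fun j => legendre_moment j k)
    (fun j => legendre_moment j (S k)) N y
     (moment_rec_0 k) (fun j => moment_rec_S j k)) as E.
  cbv beta in E. rewrite !moment_lt in E by lia.
  rewrite <- (IH N) in E by lia. simpl pow. lra.
Qed.

Lemma moment_of_legendre_coef (g : R -> R) k : (forall x, continuous g x) ->
  RInt (fun y => g y * y ^ k) (-1) 1 =
    sum_f_R0 (fun j => (2 * INR j + 1) / 2 * legendre_moment j k * legendre_coef g j) k.
Proof.
intros Hg.
rewrite (RInt_Rext _ (fun y => sum_f_R0 (fun j => (2 * INR j + 1) / 2 * legendre_moment j k
   * (g y * legendre j y)) k)).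
2:{ intros y. rewrite (monomial_legendre_sum k k y (Nat.le_refl _)) at 1.
    unfold legendre_sum. rewrite scal_sum. apply sum_eq; intros; ring. }
assert (X : forall N, is_RInt
  (fun y => sum_f_R0 (fun j => (2 * INR j + 1) / 2 * legendre_moment j k
   * (g y * legendre j y)) N) (-1) 1
   (sum_f_R0 (fun j => (2 * INR j + 1) / 2 * legendre_moment j k * legendre_coef g j) N)).
{ assert (Y : forall j, is_RInt (fun y => (2 * INR j + 1) / 2 * legendre_moment j k
   * (g y * legendre j y)) (-1) 1
       ((2 * INR j + 1) / 2 * legendre_moment j k * legendre_coef g j)).
  { intros j. apply (is_RInt_scal (V:=R_NormedModule)).
    apply (RInt_correct (V:=R_CompleteNormedModule)), ex_RInt_cont; intros; rcont. }
  induction N as [|N IHN]; [apply Y|].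
  rewrite tech5. refine (is_RInt_Rcongr _ _ _ _ _ _ _ eq_refl
     (is_RInt_plus (V:=R_NormedModule) _ _ _ _ _ _ IHN (Y (S N)))).
  intros; now rewrite tech5. }
apply (is_RInt_unique (V:=R_CompleteNormedModule)), X.
Qed.

Lemma sum_f_R0_scal x u N : sum_f_R0 (fun j => x * u j) N = x * sum_f_R0 u N.
Proof. rewrite scal_sum; apply sum_eq; intros; ring. Qed.

Lemma Cmult_cancel_l (a z w : C) : a <> 0%C -> (a * z = a * w)%C -> z = w.
Proof.
intros Ha E. rewrite <- (Cmult_1_l z), <- (Cmult_1_l w), <- (Cinv_l a Ha), <- !Cmult_assoc.
now rewrite E.
Qed.

Lemma Csum_S a n : Csum a (S n) = (Csum a n + a (S n))%C.
Proof. apply (sum_Sn (G := C_AbelianMonoid)). Qed.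
Lemma Csum_0 a : Csum a 0 = a 0%nat.
Proof. apply (sum_O (G := C_AbelianMonoid)). Qed.

Lemma Csum_pair (u v : nat -> R) N :
  Csum (fun j => (u j, v j)) N = (sum_f_R0 u N, sum_f_R0 v N).
Proof.
induction N as [|N IH]; [apply Csum_0|]. rewrite Csum_S, IH. reflexivity.
Qed.

Lemma Csum_ext a c N : (forall j, (j <= N)%nat -> a j = c j) -> Csum a N = Csum c N.
Proof. apply (sum_n_ext_loc (G := C_AbelianMonoid)). Qed.

(** The recursion for beta_k solves, one index at a time, the triangular
    system that expresses the moments of g = K(x, x .) against y^k by its
    Legendre coefficients. The coefficients of that system with j and k of
    different parity vanish, in particular the one with j = k - 1, so the
    recursion loses nothing by skipping them. *)
Lemma beta_coef (f : R -> C) (x : R) (g1 g2 : R -> R) :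
  (forall y, continuous g1 y) -> (forall y, continuous g2 y) ->
  (forall k, (phi f k x / RtoC x ^ k)%C =
     (1 + RtoC x * (RInt (fun y => g1 y * y ^ k)%R (-1) 1,
                    RInt (fun y => g2 y * y ^ k)%R (-1) 1))%C) ->
  forall k, beta f k x = (RtoC x *
    ((2 * INR k + 1) / 2 * legendre_coef g1 k,
      (2 * INR k + 1) / 2 * legendre_coef g2 k)%R)%C.
Proof.
intros C1 C2 Hphi.
set (X := fun k => (RtoC x *
  ((2 * INR k + 1) / 2 * legendre_coef g1 k,
    (2 * INR k + 1) / 2 * legendre_coef g2 k)%R)%C).
assert (HX : forall k, (phi f k x / RtoC x ^ k - 1)%C
  = Csum (fun j => RtoC (legendre_moment j k) * X j)%C k).
{ intros k. rewrite Hphi, !moment_of_legendre_coef by assumption.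
  rewrite (Csum_ext _ (fun j =>
    (x * ((2 * INR j + 1) / 2 * legendre_moment j k * legendre_coef g1 j),
       x * ((2 * INR j + 1) / 2 * legendre_moment j k * legendre_coef g2 j)))).
  2:{ intros j _; unfold X; apply C_ext; unfold Re, Im; simpl; ring. }
  rewrite Csum_pair, !sum_f_R0_scal. apply C_ext; unfold Re, Im; simpl; ring. }
assert (HP : forall k, RtoC (legendre_moment k k) <> 0%C).
{ intros k E. apply RtoC_inj in E. pose proof (moment_diag_pos k); lra. }
change (forall k, beta f k x = X k).
induction k as [k IH] using lt_wf_ind.
destruct k as [|[|m]].
- rewrite beta_0. pose proof (HX 0%nat) as E. rewrite Csum_0, moment_0_0 in E.
  unfold phi in E; simpl in E.
  apply (Cmult_cancel_l 2); [intros E2; apply RtoC_inj in E2; lra|].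
  rewrite <- E. field.
- rewrite beta_1. pose proof (HX 1%nat) as E. rewrite Csum_S, Csum_0 in E.
  rewrite (moment_parity 0 1) in E by discriminate.
  assert (M : legendre_moment 1 1 = 2 / 3).
  { pose proof (moment_rec_S 0 0) as R. rewrite moment_0_0, moment_S_0 in R. simpl in R.
    lra. }
  rewrite M in E. simpl Cpow in E. rewrite Cmult_1_r in E. rewrite E. unfold Cdiv.
  apply C_ext; unfold Re, Im; simpl; field.
- rewrite beta_rec by lia. replace (S (S m) - 2)%nat with m by lia.
  rewrite (Csum_ext _ (fun j => RtoC (legendre_moment j (S (S m))) * X j)%C).
  2:{ intros j Hj. destruct (Bool.eqb (Nat.even j) (Nat.even (S (S m)))) eqn:E.
      - now rewrite IH by lia.
      - apply Bool.eqb_false_iff in E. rewrite moment_parity by exact E. ring. }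
  pose proof (HX (S (S m))) as E. rewrite !Csum_S in E.
  rewrite (moment_parity (S m) (S (S m))) in E.
  2:{ rewrite (Nat.even_succ (S m)), <- Nat.negb_even.
      now destruct (Nat.even (S m)). }
  apply (Cmult_cancel_l (legendre_moment (S (S m)) (S (S m)))); [apply HP|].
  rewrite Cmult_assoc, Cinv_r, Cmult_1_l by apply HP. rewrite E. ring.
Qed.

(** * The error estimate *)

Lemma Cmod_le_components (z : C) : Cmod z <= Rabs (Re z) + Rabs (Im z).
Proof.
pose proof (Rabs_pos (Re z)); pose proof (Rabs_pos (Im z)).
rewrite <- (sqrt_pow2 (Rabs (Re z) + Rabs (Im z))) by lra.
unfold Cmod; apply sqrt_le_1_alt.
change (fst z) with (Re z); change (snd z) with (Im z).
rewrite <- (pow2_abs (Re z)), <- (pow2_abs (Im z)). nra.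
Qed.

Lemma im_le_Cmod (z : C) : Rabs (Im z) <= Cmod z.
Proof.
unfold Cmod, Im. rewrite <- sqrt_Rsqr_abs. apply sqrt_le_1_alt.
unfold Rsqr; nra.
Qed.

(** The substitution s = x (1 + y) / 2 carries t = 2s - x to x y. *)
Lemma moment_rescale (H : R -> R -> R) (x : R) (k : nat) : cont2 H ->
  2 * RInt (fun s => H s (x - s) * (2 * s - x) ^ k) 0 x =
    x * x ^ k * RInt (fun y => H ((x + x * y) / 2) ((x - x * y) / 2) * y ^ k) (-1) 1.
Proof.
intros HH.
assert (C : forall s, continuous (fun s => H s (x - s) * (2 * s - x) ^ k) s).
{ intros s; apply continuous_Rmult; [|apply continuous_Rpow; rcont].
  apply (cont2_comp H (fun s => s) (fun s => x - s)); auto; rcont. }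
pose proof (RInt_comp_lin (V := R_CompleteNormedModule)
  (fun s => H s (x - s) * (2 * s - x) ^ k) (x / 2) (x / 2) (-1) 1) as E.
replace (x / 2 * -1 + x / 2) with 0 in E by field.
replace (x / 2 * 1 + x / 2) with x in E by field.
rewrite <- E by (apply ex_RInt_cont; exact C).
rewrite <- !RInt_Rscal.
- apply RInt_Rext; intros y. unfold scal; simpl; unfold mult; simpl.
  replace (x / 2 * y + x / 2) with ((x + x * y) / 2) by field.
  replace (x - (x + x * y) / 2) with ((x - x * y) / 2) by field.
  replace (2 * ((x + x * y) / 2) - x) with (x * y) by field.
  rewrite Rpow_mult_distr. field.
- apply ex_RInt_cont; intros y; apply continuous_Rmult; [|apply continuous_Rpow; rcont].
  apply (cont2_comp H (fun y => (x + x * y) / 2) (fun y => (x - x * y) / 2)); auto;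
    unfold Rdiv; rcont.
- apply ex_RInt_cont; intros y. apply continuous_Rmult; [apply continuous_const|].
  apply (continuous_comp (fun y => x / 2 * y + x / 2)
    (fun s => H s (x - s) * (2 * s - x) ^ k));
    [rcont|apply C].
Qed.

Lemma phi_quotient (b : R) (q f f' : R -> C) (K : R -> R -> C)
    (q1 q2 : R -> R) (h1 h2 : R -> R -> R) : 0 < b ->
  (forall x, 0 <= x <= b -> is_derive_in (segment 0 b) f x (f' x)) ->
  (forall x, 0 <= x <= b -> is_derive_in (segment 0 b) f' x (q x * f x)%C) ->
  (forall x, 0 <= x <= b -> f x <> 0%C) -> f 0 = 1%C ->
  is_transmutation_kernel b q (f' 0) K ->
  (forall x, continuous q1 x) -> (forall x, continuous q2 x) ->
  (forall x, 0 <= x <= b -> q x = (q1 x, q2 x)) ->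
  cont2 h1 -> cont2 h2 -> agrees b K h1 h2 ->
  forall k x, 0 < x <= b ->
  (phi f k x / RtoC x ^ k)%C =
    (1 + RtoC x *
       (RInt (fun y => h1 ((x + x * y) / 2) ((x - x * y) / 2) * y ^ k)%R (-1) 1,
        RInt (fun y => h2 ((x + x * y) / 2) ((x - x * y) / 2) * y ^ k)%R (-1) 1))%C.
Proof.
intros hb Df Df' Hf0 f0 HK Q1 Q2 Eq H1 H2 Ha k x Hx.
rewrite (phi_transmuted b q f f' K q1 q2 h1 h2 hb Df Df' Hf0 f0 HK Q1 Q2 Eq H1 H2 Ha k x)
  by lra.
pose proof (kernel_step b q (f' 0) K q1 q2 h1 h2 HK Q1 Q2 Eq H1 H2 Ha) as Hb.
assert (xk : x ^ k <> 0) by (apply pow_nonzero; lra).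
assert (E : forall s, 0 < s < x ->
  Re (f' 0) / 2 + RInt (fun s => / 2 * q1 s) 0 s
    + goursat (prod_re q1 q2 h1 h2) s (x - s) = h1 s (x - s) /\
  Im (f' 0) / 2 + RInt (fun s => / 2 * q2 s) 0 s
    + goursat (prod_im q1 q2 h1 h2) s (x - s) = h2 s (x - s)).
{ intros s Hs. pose proof (Ha s (x - s) ltac:(lra) ltac:(lra) ltac:(lra)) as E1.
  rewrite (Hb s (x - s)) in E1 by lra. injection E1; intros; split; assumption. }
assert (TM : transmuted_monomial (f' 0) q1 q2 h1 h2 k x =
   (1 * x ^ k + 2 * RInt (fun s => h1 s (x - s) * (2 * s - x) ^ k) 0 x,
    0 * x ^ k + 2 * RInt (fun s => h2 s (x - s) * (2 * s - x) ^ k) 0 x)).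
{ unfold transmuted_monomial, transmuted. f_equal; f_equal; f_equal;
  (apply (RInt_ext (V:=R_CompleteNormedModule)); rewrite Rmin_left, Rmax_right by lra;
   intros s Hs; destruct (E s Hs) as [E1 E2]).
  - now rewrite E1.
  - now rewrite E2. }
rewrite TM, (moment_rescale h1 x k H1), (moment_rescale h2 x k H2), <- RtoC_pow.
assert (xk' : RtoC (x ^ k) <> 0%C) by (intros E0; apply RtoC_inj in E0; auto).
apply (Cmult_cancel_l (RtoC (x ^ k)%R)); [exact xk'|].
unfold Cdiv. rewrite (Cmult_comm _ (/ _)), Cmult_assoc, Cinv_r, Cmult_1_l by exact xk'.
apply C_ext; unfold Re, Im; simpl; ring.
Qed.

Theorem theorem3p3 (b : R) (p : nat) (hb : 0 < b) :
  exists c_p : R,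
    forall (q f f' : R -> C) (K : R -> R -> C),
      is_Cn p (segment 0 b) q ->
      (forall x, 0 <= x <= b -> is_derive_in (segment 0 b) f x (f' x)) ->
      (forall x, 0 <= x <= b ->
         is_derive_in (segment 0 b) f' x (q x * f x)%C) ->
      (forall x, 0 <= x <= b -> f x <> 0%C) ->
      f 0 = 1%C ->
      is_transmutation_kernel b q (f' 0) K ->
      exists (D : R -> R -> C) (M : R),
        is_partial_t b (S p) K D /\
        is_max_norm b D M /\
        forall (N : nat) (x t : R),
          (p < N)%nat -> 0 < x <= b -> Rabs t <= x ->
          Cmod (K x t - K_approx f N x t)%C
            <= c_p * M * x ^ S p / Rpower (INR N) (INR p + 1 / 2).
Proof.
(* 4 (p + 1)^p for the real and for the imaginary part *)
exists (8 * (INR p + 1) ^ p).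
intros q f f' K Hq Df Df' Hf0 f0 HK.
destruct (Cn_extension p b q (Rlt_le _ _ hb) Hq) as [q1 [q2 [S1 [S2 Eq]]]].
destruct (kernel_smooth b q (f' 0) K q1 q2 p (S p) (Rlt_le _ _ hb) HK S1 S2 Eq
  (Nat.le_refl _))
  as [h1 [h2 [C1 [C2 Ha]]]].
pose proof (smooth2_cont _ _ C1) as H1; pose proof (smooth2_cont _ _ C2) as H2.
pose proof (smooth1_cont _ _ S1) as Q1; pose proof (smooth1_cont _ _ S2) as Q2.
destruct (t_tower _ _ C1) as [T1 [T10 [T1C T1D]]].
destruct (t_tower _ _ C2) as [T2 [T20 [T2C T2D]]].
destruct (max_norm_exists b (T1 (S p)) (T2 (S p)) (Rlt_le _ _ hb) (T1C _) (T2C _))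
  as [M HM].
assert (EK : forall x t, Defs.triangle b (x, t) -> K x t = (T1 0%nat x t, T2 0%nat x t)).
{ intros x t [Hx Ht]; simpl in Hx, Ht. apply Rabs_le_between in Ht.
  rewrite T10, T20, <- Ha by lra. f_equal; field. }
exists (fun x t => (T1 (S p) x t, T2 (S p) x t)), M.
split; [now apply is_partial_t_tower|split; [exact HM|]].
destruct HM as [_ HM].
intros N x t HN Hx Ht.
assert (Hxt : Defs.triangle b (x, t)) by (split; simpl; lra).
set (y := t / x). assert (Ey : x * y = t) by (unfold y; field; lra).
assert (Hy : -1 <= y <= 1).
{ apply Rabs_le_between in Ht. unfold y.
  split; apply (Rmult_le_reg_l x); try lra; replace (x * (t / x)) with t by (field; lra);
    lra. }
(* Derivatives of y |-> K(x, x y): each one brings out a factor x. *)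
set (G := fun (T : nat -> R -> R -> R) (k : nat) (y : R) => x ^ k * T k x (x * y)).
assert (GC : forall T, (forall k, cont2 (T k)) -> forall k y, continuous (G T k) y).
{ intros T TC k z. apply continuous_Rmult; [apply continuous_const|].
  apply (cont2_comp (T k) (fun _ => x) (fun y => x * y)); [apply TC|rcont|rcont]. }
assert (GD : forall T, (forall k x t, (k < S p)%nat ->
  is_derive (fun t => T k x t) t (T (S k) x t)) ->
  forall k z, (k <= p)%nat -> -1 < z < 1 -> is_derive (G T k) z (G T (S k) z)).
{ intros T TD k z Hk _.
  assert (L : is_derive (fun z => x * z) z x) by (auto_derive; trivial; ring).
  refine (is_derive_Rcongr _ _ _ _ _ (fun _ => eq_refl) _ (is_derive_scal _ z (x ^ k) _
    (is_derive_comp (K:=R_AbsRing) (V:=R_NormedModule) (fun t => T k x t)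
      (fun z => x * z) z _ x
       (TD k x (x * z) (le_n_S _ _ Hk)) L))).
  unfold G, scal; simpl; unfold mult; simpl; ring. }
assert (Htri : forall z, -1 <= z <= 1 -> Defs.triangle b (x, x * z)).
{ intros z Hz; split; simpl; [lra|]. rewrite Rabs_mult, (Rabs_pos_eq x) by lra.
  assert (Rabs z <= 1) by (apply Rabs_le; lra). nra. }
assert (xp : 0 <= x ^ S p) by (apply pow_le; lra).
assert (V1 : forall z, -1 <= z <= 1 -> Rabs (G T1 (S p) z) <= x ^ S p * M).
{ intros z Hz. unfold G; rewrite Rabs_mult, (Rabs_pos_eq (x ^ S p)) by exact xp.
  apply Rmult_le_compat_l; [exact xp|].
  eapply Rle_trans; [|apply (HM x (x * z) (Htri z Hz))]. apply (re_le_Cmod (_, _)). }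
assert (V2 : forall z, -1 <= z <= 1 -> Rabs (G T2 (S p) z) <= x ^ S p * M).
{ intros z Hz. unfold G; rewrite Rabs_mult, (Rabs_pos_eq (x ^ S p)) by exact xp.
  apply Rmult_le_compat_l; [exact xp|].
  eapply Rle_trans; [|apply (HM x (x * z) (Htri z Hz))]. apply (im_le_Cmod (_, _)). }
pose proof (legendre_projection_error p (G T1) _ N y (GC T1 T1C) (GD T1 T1D) V1 HN Hy)
  as B1.
pose proof (legendre_projection_error p (G T2) _ N y (GC T2 T2C) (GD T2 T2D) V2 HN Hy)
  as B2.
assert (Hphi : forall k, (phi f k x / RtoC x ^ k)%C =
     (1 + RtoC x * (RInt (fun y => G T1 0%nat y * y ^ k)%R (-1) 1,
                    RInt (fun y => G T2 0%nat y * y ^ k)%R (-1) 1))%C).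
{ intros k.
  rewrite (phi_quotient b q f f' K q1 q2 h1 h2 hb Df Df' Hf0 f0 HK Q1 Q2 Eq H1 H2 Ha k x)
    by lra.
  f_equal; f_equal; f_equal; apply RInt_Rext; intros z; unfold G;
    [rewrite T10|rewrite T20]; ring. }
pose proof (beta_coef f x (G T1 0%nat) (G T2 0%nat) (GC T1 T1C 0%nat)
  (GC T2 T2C 0%nat) Hphi) as HB.
assert (EA : K_approx f N x t
  = (legendre_sum (legendre_coef (G T1 0%nat)) N y,
    legendre_sum (legendre_coef (G T2 0%nat)) N y)).
{ unfold K_approx, legendre_sum. rewrite <- Csum_pair. apply Csum_ext; intros j _.
  rewrite HB. fold y. assert (x0 : RtoC x <> 0%C) by (intros E0; apply RtoC_inj in E0; lra).
  apply (Cmult_cancel_l x); [exact x0|].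
  unfold Cdiv. rewrite !Cmult_assoc, (Cmult_comm (_ * _) (/ _)), !Cmult_assoc, Cinv_l
    by exact x0.
  apply C_ext; unfold Re, Im; simpl; ring. }
rewrite EA, (EK x t Hxt), <- Ey.
apply Rle_trans with (1 := Cmod_le_components _).
assert (G0 : forall T, G T 0%nat y = T 0%nat x (x * y)) by (intros; unfold G; simpl; ring).
rewrite G0 in B1, B2.
replace (8 * (INR p + 1) ^ p * M * x ^ S p / Rpower (INR N) (INR p + 1 / 2))
  with (4 * (INR p + 1) ^ p * (x ^ S p * M) / Rpower (INR N) (INR p + 1 / 2)
        + 4 * (INR p + 1) ^ p * (x ^ S p * M) / Rpower (INR N) (INR p + 1 / 2))
  by (unfold Rdiv; ring).
now apply Rplus_le_compat.
Qed.
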